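(* Let $\alpha\in(1,2)$, let $r\in(r_{\min}(\alpha),+\infty)$ with $r_{\min}(\alpha)=\frac{2(\alpha-1)}\alpha$, let $\nu_\alpha$ be a non-degenerate symmetric $\alpha$-stable Lévy measure on $\mathbb{R}^d$, let $\mu_\alpha$ be the associated $\alpha$-stable probability measure with spectral measure $\lambda_1$, let $\mathbf{D}^{\alpha-1}$ be the associated fractional gradient, and let $\mathcal{L}$ be the generator of the ''carré de Mehler'' $(\mathcal{P}_t)_{t\ge0}$. Then, for all $p\in(\alpha/(\alpha-1),+\infty)$ and all $f\in L^p(\mu_\alpha)$, $$\big\|\,\|\mathbf{D}^{\alpha-1}\circ(E-\mathcal{L})^{-\frac r2}(f)\|\,\big\|_{L^p(\mu_\alpha)}\le\alpha^{\frac{\alpha-1}\alpha}\,C_\alpha\,\gamma_\alpha(q)\,\frac{\Gamma\left(\frac r2+\frac1\alpha-1\right)}{\Gamma(\frac r2)}\,\|f\|_{L^p(\mu_\alpha)},$$ with $q=p/(p-1)$, $$C_\alpha=\sup_{t>0}\frac{t^{1-\frac1\alpha}e^{-(\alpha-1)t}}{(1-e^{-\alpha t})^{1-\frac1\alpha}},\qquad\gamma_\alpha(q)=\left(\mathbb{E}|Y_\alpha|^q\right)^{1/q}\sup_{z\in\mathbb{R}^d,\ \|z\|=1}\left(\int_{\mathbb{S}^{d-1}}|\langle z;x\rangle|^\alpha\lambda_1(dx)\right)^{1/\alpha},$$ where $Y_\alpha$ is a symmetric real $\alpha$-stable random variable with characteristic function $\exp(-|\xi|^\alpha)$, $\xi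\in\mathbb{R}$.
   Context: $\|\cdot\|$ and $\langle\cdot;\cdot\rangle$ are the Euclidean norm and inner product on $\mathbb{R}^d$; $\mathbb{S}^{d-1}$ is the unit sphere; $\mathcal{S}(\mathbb{R}^d)$ is the Schwartz space; $E$ is the identity operator. A (non-degenerate symmetric) $\alpha$-stable Lévy measure, $\alpha\in(1,2)$: a Lévy measure $\nu_\alpha$ on $\mathbb{R}^d$ (positive Borel measure, $\nu_\alpha(\{0\})=0$, $\int(1\wedge\|u\|^2)\nu_\alpha(du)<\infty$) such that $c^{-\alpha}T_c(\nu_\alpha)=\nu_\alpha$ for all $c>0$, where $T_c(\nu_\alpha)(B)=\nu_\alpha(B/c)$. Equivalently, in polar coordinates $u=ry$, $\nu_\alpha(du)=\mathbf 1_{(0,\infty)}(r)\mathbf 1_{\mathbb{S}^{d-1}}(y)\frac{dr}{r^{\alpha+1}}\sigma(dy)$ with $\sigma$ a finite positive measure on $\mathbb{S}^{d-1}$. Symmetric means $\sigma$ is symmetric. The associated probability measure $\mu_\alpha$ has characteristic function $$\hat\mu_\alpha(\xi)=\exp\Big(\int_{\mathbb{R}^d}(e^{i\langle u;\xi\rangle}-1-i\langle\xi;u\rangle)\nu_\alpha(du)\Big)=\exp\Big(-\int_{\mathbb{S}^{d-1}}|\langle y;\xi\rangle|^\alpha\lambda_1(dy)\Big),$$ where the spectral measure $\lambda_1$ is a symmetric finite positive measure on $\mathbb{S}^{d-1}$ proportional to $\sigma$. Non-degenerate means $\inf_{y\in\mathbb{S}^{d-1}}\int_{\mathbb{S}^{d-1}}|\langle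 y;x\rangle|^\alpha\lambda_1(dx)\neq0$. Fractional gradient: $D^{\alpha-1}(f)(x)=\int_{\mathbb{R}^d}(f(x+u)-f(x))u\,\nu_\alpha(du)$, $(D^{\alpha-1})^*(f)(x)=\int_{\mathbb{R}^d}(f(x-u)-f(x))u\,\nu_\alpha(du)$, $\mathbf{D}^{\alpha-1}=\frac12(D^{\alpha-1}-(D^{\alpha-1})^* )$ ($\mathbb{R}^d$-valued). Stable Ornstein-Uhlenbeck semigroup: $P^{\nu_\alpha}_t(f)(x)=\int_{\mathbb{R}^d}f(xe^{-t}+(1-e^{-\alpha t})^{1/\alpha}y)\mu_\alpha(dy)$; it extends to a $C_0$-semigroup of contractions on each $L^p(\mu_\alpha)$, $p\in(1,\infty)$, and $((P^{\nu_\alpha}_t)^* )_{t\ge0}$ is the dual semigroup, acting compatibly on each $L^p(\mu_\alpha)$. The ''carré de Mehler'' is the family $\mathcal{P}_t=P^{\nu_\alpha}_{t/\alpha}\circ(P^{\nu_\alpha}_{t/\alpha})^*$, $t\ge0$, with generator denoted $\mathcal{L}$, and $(E-\mathcal{L})^{-r/2}$ is its gamma transform $(E-\mathcal{L})^{-r/2}f=\frac1{\Gamma(r/2)}\int_0^\infty\frac{e^{-t}}{t^{1-r/2}}\mathcal{P}_t(f)\,dt$ (Bochner integral). The operator in the claim is $$\mathbf{D}^{\alpha-1}\circ(E-\mathcal{L})^{-\frac r2}(f)=\int_0^{+\infty}\frac{e^{-t}}{\Gamma(\frac r2)t^{1-\frac r2}}\,\mathbf{D}^{\alpha-1}(\mathcal{P}_t(f))\,dt,$$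 where $\mathbf{D}^{\alpha-1}(\mathcal{P}_t(f))$ means $(\mathbf{D}^{\alpha-1}P^{\nu_\alpha}_{t/\alpha})\big((P^{\nu_\alpha}_{t/\alpha})^*f\big)$ with $\mathbf{D}^{\alpha-1}P^{\nu_\alpha}_{t/\alpha}$ extended continuously from $\mathcal{S}(\mathbb{R}^d)$ to $L^p(\mu_\alpha)$. *)

(* Defs.v *)
From HB Require Import structures.
From mathcomp Require Import all_boot all_order all_algebra.
From mathcomp Require Import complex.
From mathcomp Require Import all_classical all_reals all_analysis.

Set Implicit Arguments.
Unset Strict Implicit.
Unset Printing Implicit Defensive.
Import Order.TTheory GRing.Theory Num.Theory.
Import numFieldNormedType.Exports.

Local Open Scope classical_set_scope.
Local Open Scope ring_scope.
Local Open Scope complex_scope.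

(* Borel sigma-algebra. The library norm on matrices is the sup norm; it
   induces the Euclidean topology. *)
HB.instance Definition _ (R : realType) (m n : nat) :=
  isMeasurable.Build (sigma_display (@open 'M[R]_(m, n))) 'M[R]_(m, n)
    (@sigma_algebra0 _ setT (@open 'M[R]_(m, n)))
    (@sigma_algebraC _ (@open 'M[R]_(m, n)))
    (@sigma_algebra_bigcup _ setT (@open 'M[R]_(m, n))).

Section euclidean.
Context {R : realType} {d : nat}.
Implicit Types x y : 'rV[R]_d.

Definition dotv x y : R := \sum_i x 0 i * y 0 i.
Definition enorm x : R := Num.sqrt (dotv x x).
Definition usphere : set 'rV[R]_d := [set x | enorm x = 1].

Definition iter_partial (s : seq 'I_d) (f : 'rV[R]_d -> R) : 'rV[R]_d -> R :=
  foldr (fun i g x => 'D_(delta_mx 0 i) g x) f s.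

Definition schwartz (f : 'rV[R]_d -> R) : Prop :=
  forall s : seq 'I_d,
    (forall x, differentiable (iter_partial s f) x) /\
    (forall k : nat, exists M : R,
       forall x, (1 + enorm x) ^+ k * `|iter_partial s f x| <= M).

End euclidean.

Section complex_integral.
Context {R : realType}.

Definition expi (t : R) : R[i] := cos t +i* sin t.
Definition cexp (z : R[i]) : R[i] := (expR (complex.Re z))%:C * expi (complex.Im z).

Definition cintegral d (T : measurableType d) (m : {measure set T -> \bar R})
    (h : T -> R[i]) : R[i] :=
  (\int[m]_x complex.Re (h x)) +i* (\int[m]_x complex.Im (h x)).

Definition char_fun d (m : {measure set 'rV[R]_d -> \bar R}) (xi : 'rV[R]_d) :
    R[i] :=
  cintegral m (fun u => expi (dotv u xi)).

End complex_integral.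

Definition Gamma {R : realType} (s : R) : R :=
  \int[lebesgue_measure]_(t in `]0, +oo[) (t `^ (s - 1) * expR (- t)).

Section stable_measures.
Context {R : realType} {d : nat}.
Variable alpha : R.
Implicit Types nu sigma lambda mu : {measure set 'rV[R]_d -> \bar R}.

Definition levy_measure nu : Prop :=
  nu [set 0] = 0%E /\
  (\int[nu]_u (Num.min 1 (enorm u ^+ 2))%:E < +oo)%E.

(* [set u | B (c *: u)] is B / c *)
Definition stable_levy_measure nu : Prop :=
  levy_measure nu /\
  forall (c : R) (B : set 'rV[R]_d), 0 < c -> measurable B ->
    ((c `^ (- alpha))%:E * nu [set u | B (c *: u)] = nu B)%E.

(* measures on the unit sphere are encoded as measures on the whole space that
   do not charge its complement *)
Definition on_sphere sigma : Prop := sigma (~` usphere) = 0%E.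

Definition symmetric_measure sigma : Prop :=
  forall B : set 'rV[R]_d, measurable B -> sigma [set x | B (- x)] = sigma B.

Definition polar_part nu sigma : Prop :=
  on_sphere sigma /\
  forall B : set 'rV[R]_d, measurable B ->
    nu B = (\int[sigma]_(y in usphere)
              \int[lebesgue_measure]_(r in `]0%R, +oo[)
                (\1_B (r *: y) * (r `^ (alpha + 1))^-1)%:E)%E.

Definition stable_law nu mu : Prop :=
  forall xi : 'rV[R]_d,
    char_fun mu xi =
    cexp (cintegral nu
      (fun u => expi (dotv u xi) - 1 - 'i * (dotv xi u)%:C)).

Definition spectral_measure sigma mu lambda : Prop :=
  [/\ on_sphere lambda,
      symmetric_measure lambda,
      exists2 c : R, 0 < c &
        forall B : set 'rV[R]_d, measurable B ->
          lambda B = (c%:E * sigma B)%E &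
      forall xi : 'rV[R]_d,
        char_fun mu xi =
        (expR (- \int[lambda]_(y in usphere) (`|dotv y xi| `^ alpha)))%:C].

Definition nondegenerate_spectral lambda : Prop :=
  (ereal_inf [set \int[lambda]_(x in usphere) (`|dotv y x| `^ alpha)%:E
             | y in usphere] != 0)%E.

End stable_measures.

Section fractional_gradient.
Context {R : realType} {d : nat}.
Variable nu : {measure set 'rV[R]_d -> \bar R}.
Implicit Types f : 'rV[R]_d -> R.

Definition frac_grad f (x : 'rV[R]_d) : 'rV[R]_d :=
  \row_i \int[nu]_u ((f (x + u) - f x) * u 0 i).

Definition frac_grad_adj f (x : 'rV[R]_d) : 'rV[R]_d :=
  \row_i \int[nu]_u ((f (x - u) - f x) * u 0 i).

Definition frac_grad_sym f (x : 'rV[R]_d) : 'rV[R]_d :=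
  2^-1 *: (frac_grad f x - frac_grad_adj f x).

End fractional_gradient.

Section vector_Lp.
Context {R : realType} {d : nat}.
Variable mu : {measure set 'rV[R]_d -> \bar R}.
Variable p : R.
Implicit Types F G : 'rV[R]_d -> 'rV[R]_d.

Definition vLnorm F : \bar R := 'N[mu]_p%:E [EFin \o (enorm \o F)]%E.

Definition in_vLp F : Prop := measurable_fun setT F /\ (vLnorm F < +oo)%E.

(* Bochner integrability over D, with integral G, of a family h of elements of
   L^p(mu; R^d): the n-th approximating simple function takes the value v n i
   on the set A n i of finite measure (these sets need not be disjoint). *)
Definition bochner_integral (D : set R)
    (h : R -> 'rV[R]_d -> 'rV[R]_d) G : Prop :=
  in_vLp G /\ (forall t, D t -> in_vLp (h t)) /\
  exists (k : nat -> nat) (A : nat -> nat -> set R)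
         (v : nat -> nat -> 'rV[R]_d -> 'rV[R]_d),
    let s n t := \sum_(i < k n) (\1_(A n i) t : R) *: v n i in
    [/\ forall n i, [/\ measurable (A n i), A n i `<=` D,
                        (lebesgue_measure (A n i) < +oo)%E & in_vLp (v n i)],
        {ae lebesgue_measure, forall t, D t ->
           (fun n => vLnorm (h t - s n t)) @ \oo --> 0%E},
        (fun n => \int[lebesgue_measure]_(t in D) vLnorm (h t - s n t)%R)%E
          @ \oo --> 0%E &
        (fun n => vLnorm (\sum_(i < k n)
                            fine (lebesgue_measure (A n i)) *: v n i - G))
          @ \oo --> 0%E].

End vector_Lp.

Section stable_OU.
Context {R : realType} {d : nat}.
Variables (alpha : R) (nu mu : {measure set 'rV[R]_d -> \bar R}).

Local Notation V := 'rV[R]_d.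

(* mu is invariant, so that for f in L^p(mu) this formula makes sense for
   mu-almost every x and gives the extension of the semigroup to L^p(mu). *)
Definition OU (t : R) (f : V -> R) (x : V) : R :=
  \int[mu]_y f (expR (- t) *: x + (1 - expR (- (alpha * t))) `^ alpha^-1 *: y).

(* Elements of L^p(mu) are represented by functions, so that Pstar t f is
   determined up to mu-almost everywhere equality. *)
Definition dual_OU (Pstar : R -> (V -> R) -> V -> R) : Prop :=
  forall (p t : R) (f : V -> R), 1 < p -> 0 <= t -> f \in Lfun mu p%:E ->
    Pstar t f \in Lfun mu p%:E /\
    forall g : V -> R, g \in Lfun mu (p / (p - 1))%:E ->
      \int[mu]_x (Pstar t f x * g x) = \int[mu]_x (f x * OU t g x).

(* DP t is the continuous extension of frac_grad_sym nu \o OU t from Schwartz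
   functions to L^p(mu). *)
Definition grad_OU_extension (p : R) (DP : R -> (V -> R) -> V -> V) : Prop :=
  forall t : R, 0 < t ->
  [/\ forall f, f \in Lfun mu p%:E -> in_vLp mu p (DP t f),
      forall f, schwartz f ->
        {ae mu, forall x, DP t f x = frac_grad_sym nu (OU t f) x} &
      forall (u : nat -> V -> R) f, (forall n, u n \in Lfun mu p%:E) ->
        f \in Lfun mu p%:E ->
        (fun n => 'N[mu]_p%:E [EFin \o (u n - f)%R])%E @ \oo --> 0%E ->
        (fun n => vLnorm mu p (DP t (u n) - DP t f)) @ \oo --> 0%E].

(* G = D^{alpha-1} \o (E - L)^{-r/2} f in L^p(mu; R^d), L being the generator of
   the semigroup P_t = OU (t / alpha) \o Pstar (t / alpha). *)
Definition grad_gamma_transform (r p : R) (Pstar : R -> (V -> R) -> V -> R)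
    (DP : R -> (V -> R) -> V -> V) (f : V -> R) (G : V -> V) : Prop :=
  bochner_integral mu p `]0, +oo[
    (fun t => (expR (- t) / (Gamma (r / 2) * t `^ (1 - r / 2))) *:
              DP (t / alpha) (Pstar (t / alpha) f))
    G.

End stable_OU.

Section constants.
Context {R : realType}.
Variable alpha : R.

Definition C_const : \bar R :=
  ereal_sup [set ((t `^ (1 - alpha^-1) * expR (- ((alpha - 1) * t)))
                  / (1 - expR (- (alpha * t))) `^ (1 - alpha^-1))%:E
            | t in `]0, +oo[].

Definition sym_stable_rv dO (Omega : measurableType dO)
    (P : probability Omega R) (Y : {RV P >-> R}) : Prop :=
  forall xi : R,
    cintegral P (fun w => expi (xi * Y w)) = (expR (- (`|xi| `^ alpha)))%:C.

Definition gamma_const d (lambda : {measure set 'rV[R]_d -> \bar R})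
    dO (Omega : measurableType dO) (P : probability Omega R)
    (Y : {RV P >-> R}) (q : R) : \bar R :=
  ('E_P[(fun w => `|Y w| `^ q)%R] `^ q^-1 *
   ereal_sup [set (\int[lambda]_(x in usphere) (`|dotv z x| `^ alpha)%:E)
                    `^ alpha^-1 | z in usphere])%E.

End constants.

(* Main.v *)
(* For a test function f one has
     D P_t f (x) = kappa_t * int y f (e^-t x + c_t y) mu(dy),
   with c_t = (1 - e^(-alpha t))^(1/alpha) and
   kappa_t = e^(-(alpha-1) t) / c_t^(alpha-1). For a character this is an
   explicit computation from the derivative of the characteristic function and
   the homogeneity of the exponent, and both sides are linear and stable under
   dominated limits. Hoelder's inequality, with the identity in law
   <z, X> = (int |<z, x>|^alpha lambda(dx))^(1/alpha) Y, and the invariance of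
   mu then bound D P_t on L^p(mu) by kappa_t gamma(q). Since the dual semigroup
   contracts L^p(mu), the integrand of the gamma transform at time t has norm at
   most C alpha^((alpha-1)/alpha) gamma(q) |f| e^-t t^(r/2+1/alpha-2) / Gamma(r/2),
   whose integral over t is the announced constant. The integrand is continuous
   from the right, because the dual semigroup is strongly continuous, and hence
   it is Bochner integrable. *)
Require Import Defs.
From HB Require Import structures.
From mathcomp Require Import all_boot all_order all_algebra.
From mathcomp Require Import complex.
From mathcomp Require Import all_classical all_reals all_analysis.
From mathcomp Require Import measurable_realfun simple_functions hoelder.
From mathcomp Require Import lebesgue_integral_under lebesgue_integral_fubini.
From mathcomp Require Import ring lra.

Set Implicit Arguments.
Unset Strict Implicit.
Unset Printing Implicit Defensive.
Import Order.TTheory GRing.Theory Num.Theory.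
Import numFieldNormedType.Exports.

Local Open Scope classical_set_scope.
Local Open Scope ring_scope.

(** * Euclidean space *)

(** The extension [DP] is prescribed on Schwartz functions, whereas the formula for D P_t is reached
    from characters, which are not Schwartz. The proof therefore needs functions that are Schwartz,
    are dominated limits of trigonometric sums, and are dense in L^p. Products of one-variable
    functions exp(-N z^(4N)) have the three properties without Fourier inversion: exp(-g) is a limit
    of powers of 1 - g/n, a coordinate is a limit of N sin(x/N), and the products tend to indicators
    of boxes, which also gives the uniqueness of laws. The factor kappa_t compares two scales: the
    gradient of the exponent is homogeneous of degree alpha - 1, and the fractional gradient
    evaluates it at e^-t xi, the integral against mu at c_t xi. The condition on p says that q <
    alpha, the range of finite moments, and forces p > 2, so that strong continuity of the dual
    semigroup can be drawn from L^2. The condition on r says that t^(r/2+1/alpha-2) is integrable at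
    0. Continuity is taken from the right because kappa decreases: later times share the constant of
    t, and the increment of the dual semigroup from t to t + s is bounded by the one from 0 to s. *)

Section dot_product.
Context {R : realType} {d : nat}.
Implicit Types x y z : 'rV[R]_d.

Lemma dotvC x y : dotv x y = dotv y x.
Proof. by apply: eq_bigr => i _; rewrite mulrC. Qed.

Lemma dotvDl x y z : dotv (x + y) z = dotv x z + dotv y z.
Proof. by rewrite /dotv -big_split; apply: eq_bigr => i _; rewrite mxE mulrDl. Qed.

Lemma dotvZl (a : R) x z : dotv (a *: x) z = a * dotv x z.
Proof. by rewrite /dotv mulr_sumr; apply: eq_bigr => i _; rewrite mxE mulrA. Qed.

Lemma dotvDr x y z : dotv z (x + y) = dotv z x + dotv z y.
Proof. by rewrite !(dotvC z) dotvDl. Qed.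

Lemma dotvZr (a : R) x z : dotv z (a *: x) = a * dotv z x.
Proof. by rewrite !(dotvC z) dotvZl. Qed.

Lemma dotvNl x z : dotv (- x) z = - dotv x z.
Proof. by rewrite -scaleN1r dotvZl mulN1r. Qed.

Lemma dotvNr x z : dotv z (- x) = - dotv z x.
Proof. by rewrite !(dotvC z) dotvNl. Qed.

Lemma dotv0l z : dotv 0 z = 0.
Proof. by rewrite -(scale0r (0 : 'rV[R]_d)) dotvZl mul0r. Qed.

Lemma dotv0r z : dotv z 0 = 0.
Proof. by rewrite dotvC dotv0l. Qed.

Lemma dotv_delta x i : dotv x (delta_mx 0 i) = x 0 i.
Proof.
rewrite /dotv (bigD1 i) //= mxE !eqxx mulr1 big1 ?addr0 // => j ji.
by rewrite mxE eqxx (negbTE ji) mulr0.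
Qed.

Lemma dotv_ge0 x : 0 <= dotv x x.
Proof. by apply: sumr_ge0 => i _; rewrite -expr2 sqr_ge0. Qed.

Lemma enorm_ge0 x : 0 <= enorm x.
Proof. exact: sqrtr_ge0. Qed.

Lemma enorm_sqr x : enorm x ^+ 2 = dotv x x.
Proof. by rewrite sqr_sqrtr // dotv_ge0. Qed.

Lemma enorm_eq0 x : enorm x = 0 -> x = 0.
Proof.
move=> x0; have := enorm_sqr x; rewrite x0 expr0n /= => /esym/eqP.
rewrite psumr_eq0 => [/allP h|i _]; last by rewrite -expr2 sqr_ge0.
apply/rowP => i; have := h i; rewrite mem_index_enum -expr2 sqrf_eq0 mxE.
by move=> /(_ isT)/eqP.
Qed.

Lemma enormZ (a : R) x : enorm (a *: x) = `|a| * enorm x.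
Proof.
rewrite /enorm dotvZl dotvZr mulrA -expr2 sqrtrM ?sqr_ge0 //.
by rewrite sqrtr_sqr.
Qed.

Lemma enormN x : enorm (- x) = enorm x.
Proof. by rewrite -scaleN1r enormZ normrN1 mul1r. Qed.

Lemma enorm0 : enorm (0 : 'rV[R]_d) = 0.
Proof. by rewrite -(scale0r (0 : 'rV[R]_d)) enormZ normr0 mul0r. Qed.

Lemma enormB x y : enorm (x - y) = enorm (y - x).
Proof. by rewrite -enormN opprB. Qed.

Lemma dotv_le_enorm x y : `|dotv x y| <= enorm x * enorm y.
Proof.
have [->|y0] := eqVneq y 0; first by rewrite dotv0r normr0 mulr_ge0 ?enorm_ge0.
have yp : 0 < dotv y y.
  rewrite -enorm_sqr exprn_gt0 // lt_def enorm_ge0 andbT.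
  by apply: contra y0 => /eqP/enorm_eq0 ->.
rewrite -(@ler_pXn2r _ 2) // ?nnegrE ?mulr_ge0 ?enorm_ge0 //.
rewrite exprMn !enorm_sqr real_normK ?num_real //.
(* The square of this vector is [dotv y y] times the defect in the Cauchy-Schwarz inequality. *)
have := dotv_ge0 (dotv y y *: x - dotv x y *: y).
rewrite !(dotvDl, dotvDr, dotvNl, dotvNr, dotvZl, dotvZr) (dotvC y x) => h.
rewrite -subr_ge0 -(pmulr_rge0 _ yp); apply: le_trans h _.
by rewrite le_eqVlt; apply/orP; left; apply/eqP; ring.
Qed.

Lemma enormD x y : enorm (x + y) <= enorm x + enorm y.
Proof.
rewrite -(@ler_pXn2r _ 2) // ?nnegrE ?addr_ge0 ?enorm_ge0 //.
rewrite sqrrD !enorm_sqr !(dotvDl, dotvDr) (dotvC y x).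
have := le_trans (ler_norm _) (dotv_le_enorm x y); lra.
Qed.

Lemma coord_le_enorm x i : `|x 0 i| <= enorm x.
Proof.
rewrite -sqrtr_sqr; apply: ler_wsqrtr; rewrite /dotv (bigD1 i) //= expr2 lerDl.
by apply: sumr_ge0 => j _; rewrite -expr2 sqr_ge0.
Qed.

Lemma enorm_delta i : enorm (delta_mx 0 i : 'rV[R]_d) = 1.
Proof. by rewrite /enorm dotv_delta mxE !eqxx sqrtr1. Qed.

Lemma enorm_le_sum x : enorm x <= \sum_i `|x 0 i|.
Proof.
rewrite {1}[x]row_sum_delta.
elim/big_ind2 : _ => [|a b u v h1 h2|i _].
- by rewrite enorm0.
- exact: le_trans (enormD _ _) (lerD h1 h2).
- by rewrite enormZ enorm_delta mulr1.
Qed.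

End dot_product.

(** * Borel sets of row vectors and boxes *)

Section borel_row_vectors.
Context {R : realType} {d : nat}.
Local Notation V := 'rV[R]_d.

Definition open_box (l u : V) : set V :=
  [set x | forall i, l 0 i < x 0 i < u 0 i].

Lemma open_boxI (l u l' u' : V) : exists a b,
  open_box l u `&` open_box l' u' = open_box a b.
Proof.
exists (\row_i Num.max (l 0 i) (l' 0 i)), (\row_i Num.min (u 0 i) (u' 0 i)).
apply/seteqP; split => x.
  move=> [h1 h2] i; rewrite !mxE gt_max lt_min.
  by have /andP[-> ->] := h1 i; have /andP[-> ->] := h2 i.
move=> h; split => i; have := h i; rewrite !mxE gt_max lt_min;
  by move=> /andP[/andP[a b] /andP[c e]]; apply/andP; split.
Qed.

Lemma open_measurable_rV (A : set V) : open A -> measurable A.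
Proof. by move=> oA; apply: sub_sigma_algebra. Qed.

Lemma continuous_measurable_rV (g : V -> R) :
  continuous g -> measurable_fun setT g.
Proof.
move=> cg; apply: (measurability _ (RGenOpens.measurableE R)).
move=> _ [_ [a [b ->] <-]]; rewrite setTI; apply: open_measurable_rV.
by apply: open_comp => [x _|]; [exact: cg|exact: interval_open].
Qed.

Lemma measurable_coord i : measurable_fun setT (fun x : V => x 0 i).
Proof. by apply: continuous_measurable_rV; exact: coord_continuous. Qed.

Lemma measurable_open_box l u : measurable (open_box l u).
Proof.
have -> : open_box l u =
    \bigcap_(i in [set: 'I_d]) ((fun x : V => x 0 i) @^-1` `]l 0 i, u 0 i[%classic).
  apply/seteqP; split => x h i; first by move=> _; rewrite /= in_itv /= h.
  by have := h i I; rewrite /= in_itv.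
apply: fin_bigcap_measurable => [|i _]; first exact: finite_finset.
by rewrite -[X in measurable X]setTI; apply: measurable_coord.
Qed.

(** The option type matches [unpickle]: the natural numbers enumerate all boxes with rational
    corners, and those that encode nothing give the empty set. *)
Definition rat_box (q : option ('rV[rat]_d * 'rV[rat]_d)) : set V :=
  if q is Some lu then open_box (map_mx ratr lu.1) (map_mx ratr lu.2) else set0.

(** Second countability: rational corners fit between a point and the faces of a sup-norm ball
    around it. This reduces measurability of maps into row vectors to their coordinates. *)
Lemma open_bigcup_rat_box (A : set V) : open A ->
  A = \bigcup_(n in [set n | rat_box (unpickle n) `<=` A]) rat_box (unpickle n).
Proof.
move=> oA; apply/seteqP; split => [x Ax|x [n nA]]; last exact: nA.
have /nbhs_ballP[e /= e0 eA] : nbhs x A by exact: open_nbhs_nbhs.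
have /choice[l lP] i : exists q : rat, x 0 i - e < ratr q < x 0 i.
  have /rat_in_itvoo[q] : x 0 i - e < x 0 i by rewrite ltrBlDr ltrDl.
  by rewrite in_itv /=; exists q.
have /choice[u uP] i : exists q : rat, x 0 i < ratr q < x 0 i + e.
  have /rat_in_itvoo[q] : x 0 i < x 0 i + e by rewrite ltrDl.
  by rewrite in_itv /=; exists q.
exists (pickle (\row_i l i : 'rV[rat]_d, \row_i u i : 'rV[rat]_d)) => /=; rewrite pickleK /=.
  move=> y yb; apply: eA; split => // i j; rewrite ord1 => {i}.
  have := yb j; have := lP j; have := uP j.
  rewrite !mxE /ball /= => /andP[_ a] /andP[b _] /andP[c' d'].
  by rewrite ltr_norml; apply/andP; split; lra.
move=> i; rewrite !mxE; have := lP i; have := uP i.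
by move=> /andP[a _] /andP[_ b]; rewrite a b.
Qed.

Lemma measurable_rV_boxes :
  @measurable _ V = <<s [set B | exists l u, B = open_box l u] >>.
Proof.
apply/seteqP; split.
- apply: smallest_sub; first exact: smallest_sigma_algebra.
  move=> A /open_bigcup_rat_box ->.
  apply: (@bigcup_measurable _ (g_sigma_algebraType _)) => n _ /=.
  case: (unpickle n) => [[l u]|] /=; last exact: sigma_algebra0.
  by apply: sub_sigma_algebra; eexists; eexists.
- apply: smallest_sub; first exact: sigma_algebra_measurable.
  by move=> _ [l [u ->]]; exact: measurable_open_box.
Qed.

Lemma measurable_fun_rV dT (T : measurableType dT) (g : T -> V) :
  (forall i, measurable_fun setT (fun t => g t 0 i)) -> measurable_fun setT g.
Proof.
move=> mg; apply: (measurability (@open V)) => // _ [A oA <-].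
rewrite setTI (open_bigcup_rat_box oA) preimage_bigcup.
apply: bigcup_measurable => n _; case: (unpickle n) => [[l u]|] /=; last first.
  by rewrite preimage_set0.
have -> : g @^-1` open_box (map_mx ratr l) (map_mx ratr u) =
    \bigcap_(i in [set: 'I_d]) ((fun t => g t 0 i) @^-1`
      `](map_mx ratr l : V) 0 i, (map_mx ratr u : V) 0 i[%classic).
  apply/seteqP; split => x h i; first by move=> _; rewrite /= in_itv /= h.
  by have := h i I; rewrite /= in_itv.
apply: fin_bigcap_measurable => [|i _]; first exact: finite_finset.
by rewrite -[X in measurable X]setTI; apply: mg.
Qed.

Lemma measurable_dotv (z : V) : measurable_fun setT (fun x : V => dotv x z).
Proof.
apply: measurable_sum => i; apply: measurable_funM => //.
exact: measurable_coord.
Qed.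

Lemma measurable_fun_enorm dT (T : measurableType dT) (g : T -> V) :
  measurable_fun setT g -> measurable_fun setT (fun t => enorm (g t)).
Proof.
move=> mg.
apply: (measurableT_comp (continuous_measurable_fun (@sqrt_continuous R))).
apply: measurable_sum => i; apply: measurable_funM;
  exact: (measurableT_comp (measurable_coord i) mg).
Qed.

Lemma measurable_enorm : measurable_fun setT (@enorm R d).
Proof. exact: (@measurable_fun_enorm _ _ id). Qed.

Lemma measurable_affine (x : V) (c : R) :
  measurable_fun setT (fun y : V => x + c *: y).
Proof.
apply: measurable_fun_rV => i; under eq_fun do rewrite !mxE.
by apply: measurable_funD => //; apply: measurable_funM => //; exact: measurable_coord.
Qed.

Lemma measurable_lincomb (a b : R) :
  measurable_fun setT (fun xy : V * V => a *: xy.1 + b *: xy.2).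
Proof.
apply: measurable_fun_rV => i; under eq_fun do rewrite !mxE.
apply: measurable_funD; apply: measurable_funM => //.
- exact: (measurableT_comp (measurable_coord i) measurable_fst).
- exact: (measurableT_comp (measurable_coord i) measurable_snd).
Qed.

End borel_row_vectors.

(** * Convergence of real-valued integrals *)

Section integration_helpers.
Context dT (T : measurableType dT) (R : realType).

Lemma squeeze_cvgn (u v : nat -> R) (l : R) :
  (forall n, `|u n - l| <= v n) -> v @ \oo --> 0 -> u @ \oo --> l.
Proof.
move=> uv v0; apply/cvgrPdist_lt => e e0.
have /cvgrPdist_lt/(_ _ e0) := v0; apply: filterS => n; rewrite (distrC l).
rewrite sub0r normrN; apply: le_lt_trans; exact: le_trans (uv n) (ler_norm _).
Qed.

Lemma bounded_integrable (m : {finite_measure set T -> \bar R}) (f : T -> R) M :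
  measurable_fun setT f -> (forall x, `|f x| <= M) ->
  m.-integrable setT (EFin \o f).
Proof.
move=> mf fM; apply: (@le_integrable _ _ _ _ _ measurableT _ (EFin \o cst M)).
- exact/measurable_EFinP.
- by move=> x _ /=; rewrite lee_fin (le_trans (fM x)) // ler_norm.
- exact: finite_measure_integrable_cst.
Qed.

Lemma cvg_Rintegral_dominated (m : {measure set T -> \bar R}) D
    (F : nat -> T -> R) f g : measurable D ->
  (forall n, measurable_fun D (F n)) ->
  (forall x, D x -> F n x @[n --> \oo] --> f x) ->
  m.-integrable D (EFin \o g) ->
  (forall n x, D x -> `|F n x| <= g x) ->
  \int[m]_(x in D) F n x @[n --> \oo] --> \int[m]_(x in D) f x.
Proof.
move=> mD mF Ff ig Fg.
have mf : measurable_fun D f by apply: (measurable_fun_cvg mF) => x Dx; exact: Ff.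
have h := @dominated_cvg _ _ _ m D mD (fun n => EFin \o F n) (EFin \o f)
  (EFin \o g).
apply: fine_cvg; rewrite fineK; last first.
  apply: integrable_fin_num => //.
  apply: (le_integrable mD _ _ ig); first exact/measurable_EFinP.
  move=> x Dx /=; rewrite lee_fin (le_trans _ (ler_norm _)) //.
  have /cvg_norm c := Ff x Dx.
  by apply: (cvgr_to_le c); apply: nearW => n; exact: Fg.
apply: h => //.
- by move=> n; exact/measurable_EFinP.
- by move=> x Dx; apply: cvg_EFin; [exact: nearW|exact: Ff].
Qed.

Lemma cvg_Rintegral_bounded (m : {finite_measure set T -> \bar R})
    (F : nat -> T -> R) f M :
  (forall n, measurable_fun setT (F n)) ->
  (forall x, F n x @[n --> \oo] --> f x) ->
  (forall n x, `|F n x| <= M) ->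
  \int[m]_x F n x @[n --> \oo] --> \int[m]_x f x.
Proof.
move=> mF Ff FM; apply: (@cvg_Rintegral_dominated _ _ _ _ (cst M)) => //.
exact: finite_measure_integrable_cst.
Qed.

End integration_helpers.

(** * Elementary inequalities and one-variable bumps *)

Section calculus.
Context {R : realType}.

Lemma lipschitz_derive (f df : R -> R) (L : R) :
  (forall x : R, is_derive x 1 f (df x)) -> (forall x, `|df x| <= L) ->
  forall x y, `|f x - f y| <= L * `|x - y|.
Proof.
move=> fd dfL x y; wlog yx : x y / y <= x => [h|].
  have [/h//|/ltW/h] := leP y x.
  by rewrite distrC [in leRHS]distrC.
have cf : {within `[y, x], continuous f}.
  apply: derivable_within_continuous => z _; exact: ex_derive.
have [c _ ->] := MVT_segment yx (fun z _ => fd z) cf.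
by rewrite normrM ler_wpM2r.
Qed.

Lemma sin_lipschitz (x y : R) : `|sin x - sin y| <= `|x - y|.
Proof.
rewrite -[leRHS]mul1r; apply: (lipschitz_derive (df := cos)) => // z.
exact: cos_max.
Qed.

Lemma cos_lipschitz (x y : R) : `|cos x - cos y| <= `|x - y|.
Proof.
rewrite -[leRHS]mul1r; apply: (lipschitz_derive (df := fun z => - sin z)) => // z.
by rewrite normrN; exact: sin_max.
Qed.

Lemma norm_sin_le (x : R) : `|sin x| <= `|x|.
Proof. by have := sin_lipschitz x 0; rewrite sin0 !subr0. Qed.

(** The mean value theorem with |cos c - 1| <= |c| yields the exponent 2, which is enough for k sin
    (w / k) to tend to w. *)
Lemma norm_sinB_id (x : R) : `|sin x - x| <= x ^+ 2.
Proof.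
wlog x0 : x / 0 <= x => [h|].
  have [/h//|/ltW x0] := leP 0 x.
  have := h (- x); rewrite oppr_ge0 sinN -opprD normrN sqrrN; exact.
have cf : {within `[0, x], continuous (fun z : R => sin z - z)}.
  apply: derivable_within_continuous => z _; exact: ex_derive.
have fd (z : R) : z \in `]0, x[ -> is_derive z 1 (fun z : R => sin z - z) (cos z - 1).
  by move=> _; apply: is_deriveB.
have [c] := MVT_segment x0 fd cf.
rewrite in_itv /= => /andP[c0 cx].
rewrite sin0 !subr0 => ->; rewrite expr2 normrM [`|x|]ger0_norm // ler_wpM2r //.
have := cos_lipschitz c 0; rewrite cos0 subr0 => /le_trans; apply.
by rewrite ger0_norm.
Qed.

Lemma normrXB_le (a b : R) n : `|a| <= 1 -> `|b| <= 1 ->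
  `|a ^+ n - b ^+ n| <= n%:R * `|a - b|.
Proof.
move=> a1 b1; elim: n => [|n IH]; first by rewrite !expr0 subrr normr0 mul0r.
rewrite !exprS.
have -> : a * a ^+ n - b * b ^+ n = a * (a ^+ n - b ^+ n) + (a - b) * b ^+ n by ring.
have -> : n.+1%:R * `|a - b| = n%:R * `|a - b| + `|a - b|.
  by rewrite -natr1 mulrDl mul1r.
rewrite (le_trans (ler_normD _ _)) // lerD //.
  by rewrite normrM (le_trans _ IH) // ler_piMl.
by rewrite normrM ler_piMr // normrX exprn_ile1.
Qed.

Lemma expRN_le (w : R) : 0 <= w -> expR (- w) <= 1 - w + w ^+ 2.
Proof.
move=> w0; rewrite expRN invf_ple ?posrE ?expR_gt0 //; last by nra.
apply: le_trans (expR_ge1Dx w); rewrite invf_ple ?posrE; [|nra|lra].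
by rewrite -div1r ler_pdivrMr; [nra|lra].
Qed.

(** With w = z / n, both terms are n-th powers of numbers in [0, 1], namely 1 - w and exp(-w). These
    differ by at most w^2, and taking n-th powers multiplies the difference by at most n. *)
Lemma norm_expRN_pow (z : R) n : 0 <= z -> z <= n%:R ->
  `|(1 - z / n%:R) ^+ n - expR (- z)| <= z ^+ 2 / n%:R.
Proof.
case: n => [|n] z0 zn.
  (* For [n = 0] the two bounds on [z] force [z = 0]. *)
  by rewrite expr0 invr0 mulr0 (@le_anti _ _ z 0) ?zn // oppr0 expR0 subrr normr0.
have w0 : 0 <= z / n.+1%:R by rewrite divr_ge0.
have w1 : z / n.+1%:R <= 1 by rewrite ler_pdivrMr ?mul1r // ltr0n.
have -> : - z = n.+1%:R * (- (z / n.+1%:R)).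
  by rewrite mulrN mulrCA divff ?mulr1 // pnatr_eq0.
rewrite expRM_natl.
set w := z / _ in w0 w1 *.
apply: le_trans (normrXB_le _ _ _) _.
- by rewrite ger0_norm ?subr_ge0 // lerBlDr lerDl.
- by rewrite ger0_norm ?expR_ge0 // expR_le1 oppr_le0.
- have e1 := expRN_le w0; have e2 := expR_ge1Dx (- w).
  rewrite ler0_norm; last lra.
  have -> : z ^+ 2 / n.+1%:R = n.+1%:R * w ^+ 2.
    have aux (N : R) : N != 0 -> z ^+ 2 / N = N * (z / N) ^+ 2 by move=> N0; field.
    by rewrite /w aux // pnatr_eq0.
  by rewrite ler_pM2l ?ltr0n //; lra.
Qed.

Lemma bernoulli_le (h : R) n : 0 <= h -> 1 + n%:R * h <= (1 + h) ^+ n.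
Proof.
move=> h0; elim: n => [|n IH]; first by rewrite mul0r addr0 expr0.
rewrite exprS; apply: (@le_trans _ _ ((1 + h) * (1 + n%:R * h))).
  rewrite -addn1 natrD; have : 0 <= n%:R * h * h by rewrite !mulr_ge0.
  by nra.
by rewrite ler_wpM2l //; lra.
Qed.

(** Writing w = 1 / (1 + h), Bernoulli's inequality bounds (n + 1) w^(n+1) by 1 / h; the second
    factor w^(n+1) tends to 0. *)
Lemma cvg_natrM_expr (w : R) : 0 <= w -> w < 1 ->
  n.+1%:R * w ^+ (2 * n.+1) @[n --> \oo] --> 0.
Proof.
move=> w0 w1; have [->|wn0] := eqVneq w 0.
  under eq_fun do rewrite mulnS exprS mul0r mulr0.
  exact: cvg_cst.
have wp : 0 < w by rewrite lt_def wn0.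
pose h := w^-1 - 1.
have hp : 0 < h by rewrite subr_gt0 invf_gt1.
apply: (@squeeze_cvgn _ _ (fun n => h^-1 * w ^+ n.+1)) => [n|]; last first.
  have -> : (fun n => h^-1 * w ^+ n.+1) = fun n => h^-1 * w * w ^+ n.
    by apply/funext => n; rewrite exprS mulrA.
  rewrite -[X in _ --> X](mulr0 (h^-1 * w)); apply: cvgMr.
  by apply: cvg_expr; rewrite ger0_norm.
rewrite subr0 ger0_norm ?mulr_ge0 ?exprn_ge0 //.
rewrite mulnC exprM expr2 mulrA ler_wpM2r ?exprn_ge0 //.
have := bernoulli_le n.+1 (ltW hp).
have -> : 1 + h = w^-1 by rewrite /h; ring.
rewrite exprVn => b.
have wn : 0 < w ^+ n.+1 by rewrite exprn_gt0.
rewrite -ler_pdivlMr // -[_ / _]/(h^-1 * _) -ler_pdivrMl ?invr_gt0 // invrK.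
by rewrite mulrC; lra.
Qed.

(* smooth even functions tending to the indicator of ]-1, 1[; the factor and
   the even exponent make the limit 0 also at the endpoints *)
Definition bump1 n (z : R) : R := expR (- (n.+1%:R * z ^+ (4 * n.+1))).

Lemma bump1_ge0 n z : 0 <= bump1 n z.
Proof. exact: expR_ge0. Qed.

Lemma expr4_ge0 n (z : R) : 0 <= z ^+ (4 * n).
Proof. by rewrite mulnC exprM exprn_even_ge0. Qed.

Lemma bump1_le1 n z : bump1 n z <= 1.
Proof. by rewrite expR_le1 oppr_le0 mulr_ge0 // expr4_ge0. Qed.

Lemma cvg_bump1_in (z : R) : `|z| < 1 -> bump1 n z @[n --> \oo] --> (1 : R).
Proof.
move=> z1; rewrite -expR0; apply: continuous_cvg; first exact: continuous_expR.
rewrite -oppr0; apply: cvgN.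
have -> : (fun n => n.+1%:R * z ^+ (4 * n.+1)) =
    fun n => n.+1%:R * (z ^+ 2) ^+ (2 * n.+1).
  by apply/funext => n; rewrite -exprM mulnA.
apply: cvg_natrM_expr; first exact: sqr_ge0.
by rewrite -real_normK ?num_real // exprn_ilt1.
Qed.

Lemma cvg_bump1_out (z : R) : 1 <= `|z| -> bump1 n z @[n --> \oo] --> (0 : R).
Proof.
move=> z1; apply: (@squeeze_cvgn _ _ harmonic) => [n|]; last exact: cvg_harmonic.
rewrite subr0 ger0_norm ?expR_ge0 // /bump1 /harmonic expRN lef_pV2 ?posrE ?expR_gt0 //.
apply: le_trans (expR_ge1Dx _).
have : (1 : R) <= z ^+ (4 * n.+1).
  have -> : z ^+ (4 * n.+1) = `|z| ^+ (4 * n.+1).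
    by rewrite -normrX ger0_norm // expr4_ge0.
  exact: exprn_ege1.
have : (0 : R) < n.+1%:R by rewrite ltr0n.
by nra.
Qed.

(** With k = 4 (n + 1), the derivative is controlled through |z|^(k-1) <= 1 + z^k and
    [bump1 n z * z ^+ k <= 1], whence the factor 2. The constant may depend on [n], which stays
    fixed in the limits where it serves. *)
Lemma bump1_lipschitz n : exists L : R, forall x y : R, `|bump1 n x - bump1 n y| <= L * `|x - y|.
Proof.
pose k := (4 * n.+1)%N.
exists (n.+1%:R * k%:R * 2); apply: (lipschitz_derive
  (df := fun z => bump1 n z * (- (n.+1%:R * (k%:R * z ^+ k.-1))))) => z.
  apply: is_derive1_comp; apply: is_deriveN.
  have h : is_derive z 1 (fun x : R => x ^+ k) (k%:R * z ^+ k.-1).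
    by apply: DeriveDef; [exact: exprn_derivable|rewrite exp_derive scaler1].
  exact: is_deriveZ.
rewrite normrM normrN [`|bump1 _ _|]ger0_norm ?bump1_ge0 //.
have -> : `|n.+1%:R * (k%:R * z ^+ k.-1)| = n.+1%:R * k%:R * `|z ^+ k.-1|.
  by rewrite !normrM !normr_nat mulrA.
rewrite mulrCA ler_wpM2l ?mulr_ge0 //.
have e1 : `|z ^+ k.-1| <= 1 + z ^+ k.
  rewrite normrX; have [z1|z1] := leP `|z| 1.
    by rewrite (@le_trans _ _ 1) ?exprn_ile1 // lerDl expr4_ge0.
  have -> : z ^+ k = `|z| ^+ k by rewrite -normrX ger0_norm // expr4_ge0.
  rewrite (@le_trans _ _ (`|z| ^+ k)) ?lerDr //.
  by rewrite ler_weXn2l ?leq_pred // ltW.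
have e2 : bump1 n z * z ^+ k <= 1.
  rewrite /bump1 expRN mulrC ler_pdivrMr ?expR_gt0 // mul1r.
  apply: le_trans (expR_ge1Dx _); have := expr4_ge0 n.+1 z; rewrite -/k.
  have : (1 : R) <= n.+1%:R by rewrite ler1n.
  by nra.
have := bump1_le1 n z; have := bump1_ge0 n z => b0 b1.
by apply: le_trans (ler_wpM2l b0 e1) _; lra.
Qed.

End calculus.

(** * Trigonometric approximation and uniqueness of laws *)

Section trigonometric_closure.
Context {R : realType} {d : nat}.
Local Notation V := 'rV[R]_d.

(* The smallest class of functions containing the characters and closed under
   linear combinations and limits that are dominated together with their
   Lipschitz constants. *)
Inductive tcl : (V -> R) -> Prop :=
| tcl_cos xi (th : R) : tcl (fun x => cos (dotv x xi + th))
| tcl_add f g : tcl f -> tcl g -> tcl (fun x => f x + g x)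
| tcl_scale (a : R) f : tcl f -> tcl (fun x => a * f x)
| tcl_lim (F : nat -> V -> R) f (M : R) : (forall n, tcl (F n)) ->
    (forall n x, `|F n x| <= M) ->
    (forall n x y, `|F n x - F n y| <= M * enorm (x - y)) ->
    (forall x, F n x @[n --> \oo] --> f x) -> tcl f.

(** Both bounds are needed to dominate increments against the Levy measure: the supremum handles
    large jumps, the Lipschitz constant small ones. *)
Lemma tcl_bounded_lipschitz f : tcl f ->
  exists M : R, (forall x, `|f x| <= M) /\
            (forall x y, `|f x - f y| <= M * enorm (x - y)).
Proof.
elim => {f} [xi th|f g _ [M [b1 l1]] _ [N [b2 l2]]|a f _ [M [b l]]|F f M _ _ b l c].
- exists (1 + enorm xi); split => x.
    by rewrite (le_trans (cos_max _)) // lerDl enorm_ge0.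
  move=> y; rewrite (le_trans (cos_lipschitz _ _)) //.
  rewrite opprD addrACA subrr addr0 -dotvNl -dotvDl.
  rewrite (le_trans (dotv_le_enorm _ _)) // mulrC ler_wpM2r ?enorm_ge0 //.
  by rewrite lerDr.
- exists (M + N); split => x.
    by rewrite (le_trans (ler_normD _ _)) // lerD.
  move=> y; rewrite opprD addrACA (le_trans (ler_normD _ _)) // mulrDl.
  by rewrite lerD.
- exists (`|a| * M); split => x; first by rewrite normrM ler_wpM2l.
  by move=> y; rewrite -mulrBr normrM -mulrA ler_wpM2l.
- exists M; split => x.
    by apply: (cvgr_to_le (cvg_norm (c x))); apply: nearW => n.
  move=> y; apply: (cvgr_to_le (cvg_norm (cvgB (c x) (c y)))).
  by apply: nearW => n; exact: l.
Qed.

Lemma tcl_continuous f : tcl f -> continuous f.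
Proof.
move=> /tcl_bounded_lipschitz[M [_ l]] x.
apply/(@cvgrPdist_le _ _ _ (nbhs x) (@nbhs_filter _ x)) => e e0.
(* The topology comes from the sup norm, which costs a factor [d]. Since a <= a^2 + 1, [K] exceeds
   [M * d%:R], and it is positive in all cases. *)
pose K := (M * d%:R) ^+ 2 + 1.
have K0 : 0 < K by rewrite ltr_pwDr // sqr_ge0.
have : \forall t \near x, `|x - t| <= e / K.
  have := @nbhsx_ballx _ _ x (e / K) (divr_gt0 e0 K0).
  by apply: filterS => t; rewrite -ball_normE => /ltW.
apply: filterS => t xt; rewrite (le_trans (l _ _)) //.
have h : enorm (x - t) <= d%:R * `|x - t|.
  rewrite (le_trans (enorm_le_sum _)) //.
  rewrite (le_trans (ler_sum _ (G := fun=> `|x - t|) _)) //; last first.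
    by rewrite sumr_const card_ord mulr_natl.
  move=> i _; rewrite /Num.norm /= mx_normrE.
  by apply/bigmax_geP; right; exists (0, i).
have [M0|M0] := leP M 0.
  by rewrite (le_trans _ (ltW e0)) // mulr_le0_ge0 // enorm_ge0.
rewrite (le_trans (ler_wpM2l (ltW M0) h)) // mulrA.
rewrite (le_trans (ler_wpM2l _ xt)) ?mulr_ge0 ?(ltW M0) //.
rewrite mulrCA ger_pMr // ler_pdivrMr // mul1r /K.
by nra.
Qed.

Lemma tcl_measurable f : tcl f -> measurable_fun setT f.
Proof. by move=> /tcl_continuous; exact: continuous_measurable_rV. Qed.

Lemma tcl_ext f g : f =1 g -> tcl f -> tcl g.
Proof. by move=> /funext ->. Qed.

Lemma tcl_cst (c : R) : tcl (fun=> c).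
Proof.
apply: (tcl_ext _ (tcl_scale c (tcl_cos 0 0))) => x.
by rewrite dotv0r addr0 cos0 mulr1.
Qed.

Lemma tcl_opp f : tcl f -> tcl (fun x => - f x).
Proof. by move=> /(tcl_scale (-1)); apply: tcl_ext => x; rewrite mulN1r. Qed.

Lemma tcl_sin xi th : tcl (fun x => sin (dotv x xi + th)).
Proof.
apply: (tcl_ext _ (tcl_cos xi (th - pi / 2))) => x.
by rewrite addrA cosBpihalf.
Qed.

(** A nested induction whose base case is the product formula for two cosines. In a limit case the
    fixed factor is bounded and Lipschitz, so the products keep common bounds, with constant
    [2 * (N * M)]. *)
Lemma tcl_mul f g : tcl f -> tcl g -> tcl (fun x => f x * g x).
Proof.
move=> tf tg; elim: tf => {f} [xi th|f1 f2 _ h1 _ h2|a f _ h|F f M tF h b l c].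
- elim: tg => {g} [xi' th'|g1 g2 _ h1 _ h2|a g _ h|F g M tF h b l c].
  + apply: (tcl_ext _ (tcl_scale 2^-1 (tcl_add (tcl_cos (xi + xi') (th + th'))
      (tcl_cos (xi - xi') (th - th'))))) => x.
    have -> : dotv x (xi + xi') + (th + th') =
        (dotv x xi + th) + (dotv x xi' + th') by rewrite dotvDr; ring.
    have -> : dotv x (xi - xi') + (th - th') =
        (dotv x xi + th) - (dotv x xi' + th') by rewrite dotvDr dotvNr; ring.
    by rewrite cosD cosB; lra.
  + by apply: (tcl_ext _ (tcl_add h1 h2)) => x; rewrite mulrDr.
  + by apply: (tcl_ext _ (tcl_scale a h)) => x; rewrite mulrCA.
  + have [N [bN lN]] := tcl_bounded_lipschitz (tcl_cos xi th).
    have M0 : 0 <= M by exact: le_trans (normr_ge0 _) (b 0%N 0).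
    have N0 : 0 <= N by exact: le_trans (normr_ge0 _) (bN 0).
    apply: (@tcl_lim _ _ (2 * (N * M)) h).
    * move=> n x; rewrite normrM (le_trans (ler_pM _ _ (bN x) (b n x))) //.
      by have := mulr_ge0 N0 M0; lra.
    * move=> n x y; set u := cos _; set v := cos _.
      have -> : u * F n x - v * F n y = (u - v) * F n x + v * (F n x - F n y) by ring.
      rewrite (le_trans (ler_normD _ _)) // !normrM.
      have e1 := ler_pM (normr_ge0 _) (normr_ge0 _) (lN x y) (b n x).
      have e2 := ler_pM (normr_ge0 _) (normr_ge0 _) (bN y) (l n x y).
      by rewrite (le_trans (lerD e1 e2)) //; lra.
    * by move=> x; apply: cvgMr; exact: c.
- by apply: (tcl_ext _ (tcl_add h1 h2)) => x; rewrite mulrDl.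
- by apply: (tcl_ext _ (tcl_scale a h)) => x; rewrite mulrA.
- have [N [bN lN]] := tcl_bounded_lipschitz tg.
  have M0 : 0 <= M by exact: le_trans (normr_ge0 _) (b 0%N 0).
  have N0 : 0 <= N by exact: le_trans (normr_ge0 _) (bN 0).
  apply: (@tcl_lim _ _ (2 * (N * M)) h).
  + move=> n x; rewrite normrM mulrC (le_trans (ler_pM _ _ (bN x) (b n x))) //.
    by have := mulr_ge0 N0 M0; lra.
  + move=> n x y.
    have -> : F n x * g x - F n y * g y = (g x - g y) * F n x + g y * (F n x - F n y) by ring.
    rewrite (le_trans (ler_normD _ _)) // !normrM.
    have e1 := ler_pM (normr_ge0 _) (normr_ge0 _) (lN x y) (b n x).
    have e2 := ler_pM (normr_ge0 _) (normr_ge0 _) (bN y) (l n x y).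
    by rewrite (le_trans (lerD e1 e2)) //; lra.
  + by move=> x; apply: cvgMl; exact: c.
Qed.

Lemma tcl_exp f n : tcl f -> tcl (fun x => f x ^+ n).
Proof.
move=> tf; elim: n => [|n IH]; first exact: tcl_cst.
by apply: (tcl_ext _ (tcl_mul tf IH)) => x; rewrite exprS.
Qed.

Lemma tcl_prod (I : Type) (s : seq I) (F : I -> V -> R) :
  (forall i, tcl (F i)) -> tcl (fun x => \prod_(i <- s) F i x).
Proof.
move=> tF; elim: s => [|i s IH].
  by apply: (tcl_ext _ (tcl_cst 1)) => x; rewrite big_nil.
by apply: (tcl_ext _ (tcl_mul (tF i) IH)) => x; rewrite big_cons.
Qed.

(* exp (- f) is the limit of (1 - f / n) ^ n *)
Lemma tcl_expN f : tcl f -> (forall x, 0 <= f x) ->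
  tcl (fun x => expR (- f x)).
Proof.
move=> tf f0; have [M [bM lM]] := tcl_bounded_lipschitz tf.
have M0 : 0 <= M by exact: le_trans (normr_ge0 _) (bM 0).
(* Starting the index above the bound of [f] keeps 1 - f / n in [0, 1]; its n-th powers then stay
   bounded by 1 and inherit the Lipschitz constant of [f]. *)
pose N := Num.bound M.
have MN n : M <= (N + n.+1)%:R.
  rewrite (le_trans (ltW (archi_boundP M0))) // ler_nat leq_addr //.
have N0 n : (0 : R) < (N + n.+1)%:R by rewrite ltr0n addnS.
pose F n x := (1 - f x / (N + n.+1)%:R) ^+ (N + n.+1).
have fN n x : f x <= (N + n.+1)%:R.
  exact: le_trans (ler_norm _) (le_trans (bM x) (MN n)).
have F1 n x : `|1 - f x / (N + n.+1)%:R| <= 1.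
  rewrite ger0_norm ?subr_ge0 ?lerBlDr ?lerDl ?divr_ge0 //.
  by rewrite ler_pdivrMr // mul1r.
apply: (@tcl_lim F _ (1 + M)).
- move=> n; apply: tcl_exp; apply: tcl_add; first exact: tcl_cst.
  by apply: tcl_opp; apply: (tcl_ext _ (tcl_scale (N + n.+1)%:R^-1 tf)) => x;
    rewrite mulrC.
- move=> n x; rewrite normrX (@le_trans _ _ 1) ?lerDl //; exact: exprn_ile1.
- move=> n x y; rewrite (le_trans (normrXB_le _ _ _)) //.
  have -> : 1 - f x / (N + n.+1)%:R - (1 - f y / (N + n.+1)%:R) =
      (f y - f x) / (N + n.+1)%:R by ring.
  rewrite normrM [`|_^-1|]ger0_norm ?invr_ge0 ?(ltW (N0 n)) // mulrCA divff ?gt_eqF // mulr1.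
  rewrite distrC (le_trans (lM _ _)) // ler_wpM2r ?enorm_ge0 // lerDr //.
- move=> x; apply: (@squeeze_cvgn _ _ (fun n => M ^+ 2 * harmonic n)); last first.
    by rewrite -[X in _ --> X](mulr0 (M ^+ 2)); apply: cvgMr; exact: cvg_harmonic.
  move=> n; rewrite (le_trans (norm_expRN_pow _ _)) //.
  apply: ler_pM => //; first exact: sqr_ge0.
  + by rewrite ler_pXn2r ?nnegrE // (le_trans (ler_norm _)).
  + by rewrite /harmonic lef_pV2 ?posrE // ler_nat leq_addl.
Qed.

(** A coordinate is unbounded, hence not in [tcl]. It is replaced by N sin (w / N), which has a
    Lipschitz constant uniform in N, and the limit is taken after composing with the bounded
    Lipschitz function [bump1 n]. *)
Lemma tcl_bump1 n i (a s : R) : 0 < s -> tcl (fun x : V => bump1 n ((x 0 i - a) / s)).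
Proof.
move=> s0; have [L lL] := @bump1_lipschitz R n.
have L0 : 0 <= L.
  have := lL 1 0; rewrite subr0 normr1 mulr1; exact: le_trans.
pose z (N : nat) (x : V) := N.+1%:R * sin ((x 0 i - a) / s / N.+1%:R).
have zs N x : z N x = N.+1%:R *
    sin (dotv x ((s^-1 / N.+1%:R) *: delta_mx 0 i) - a / s / N.+1%:R).
  by rewrite /z dotvZr dotv_delta; congr (_ * sin _); ring.
have tz N : tcl (z N).
  by apply: (tcl_ext _ (tcl_scale N.+1%:R (tcl_sin _ _))) => x; rewrite zs.
apply: (@tcl_lim (fun N x => bump1 n (z N x)) _ (1 + L / s)).
- move=> N; apply: tcl_expN => [|x]; last by rewrite mulr_ge0 // expr4_ge0.
  by apply: tcl_scale; exact: tcl_exp.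
- move=> N x; rewrite ger0_norm ?bump1_ge0 // (le_trans (bump1_le1 _ _)) //.
  by rewrite lerDl divr_ge0 // ltW.
- move=> N x y; rewrite (le_trans (lL _ _)) //.
  have : `|z N x - z N y| <= s^-1 * enorm (x - y).
    rewrite -mulrBr normrM ger0_norm //.
    rewrite (le_trans (ler_wpM2l _ (sin_lipschitz _ _))) //.
    have -> : (x 0 i - a) / s / N.+1%:R - (y 0 i - a) / s / N.+1%:R =
      s^-1 * ((x - y) 0 i) / N.+1%:R by rewrite !mxE; ring.
    rewrite normrM [`|N.+1%:R^-1|]ger0_norm // mulrCA divff ?pnatr_eq0 // mulr1.
    by rewrite normrM ger0_norm ?invr_ge0 ?(ltW s0) // ler_wpM2l ?invr_ge0 ?(ltW s0) // coord_le_enorm.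
  move=> h; rewrite (le_trans (ler_wpM2l L0 h)) // mulrA ler_wpM2r ?enorm_ge0 //.
  by rewrite lerDr.
- move=> x; set w := (x 0 i - a) / s.
  apply: (@squeeze_cvgn _ _ (fun N => (L * w ^+ 2) * harmonic N)); last first.
    by rewrite -[X in _ --> X](mulr0 (L * w ^+ 2)); apply: cvgMr; exact: cvg_harmonic.
  move=> N; rewrite (le_trans (lL _ _)) // -mulrA ler_wpM2l // /z -/w.
  have aux (k : R) : 0 < k -> `|k * sin (w / k) - w| <= w ^+ 2 / k.
    move=> k0; have -> : k * sin (w / k) - w = k * (sin (w / k) - w / k).
      by field; rewrite gt_eqF.
    rewrite normrM ger0_norm ?(ltW k0) //.
    rewrite (le_trans (ler_wpM2l (ltW k0) (norm_sinB_id _))) //.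
    by rewrite le_eqVlt; apply/orP; left; apply/eqP; field; rewrite gt_eqF.
  by apply: aux; rewrite ltr0n.
Qed.

Definition box_bump (l u : V) n (x : V) : R :=
  \prod_i bump1 n ((x 0 i - (l 0 i + u 0 i) / 2) / ((u 0 i - l 0 i) / 2)).

Lemma tcl_bump (l u : V) n : (forall i, l 0 i < u 0 i) -> tcl (box_bump l u n).
Proof.
by move=> lu; apply: tcl_prod => i; apply: tcl_bump1; rewrite divr_gt0 // subr_gt0.
Qed.

Lemma bump_ge0 l u n x : 0 <= box_bump l u n x.
Proof. by apply: prodr_ge0 => i _; exact: bump1_ge0. Qed.

Lemma bump_le1 l u n x : box_bump l u n x <= 1.
Proof. by apply: prodr_ile1 => i _; rewrite bump1_ge0 bump1_le1. Qed.

(** The limit holds at every point, faces of the box included, so that no exceptional set has to be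
    negligible for the measures at hand. *)
Lemma cvg_bump (l u x : V) : (forall i, l 0 i < u 0 i) ->
  box_bump l u n x @[n --> \oo] --> (\1_(open_box l u) x : R).
Proof.
move=> lu; pose z i := (x 0 i - (l 0 i + u 0 i) / 2) / ((u 0 i - l 0 i) / 2).
have zP i : (l 0 i < x 0 i < u 0 i) = (`|z i| < 1).
  have h : 0 < (u 0 i - l 0 i) / 2 by rewrite divr_gt0 // subr_gt0.
  rewrite /z normrM [`|_^-1|]ger0_norm ?invr_ge0 ?ltW // ltr_pdivrMr // mul1r.
  by rewrite ltr_norml; apply/idP/idP => /andP[h1 h2]; apply/andP; split; lra.
have c i : bump1 n (z i) @[n --> \oo] --> (if `|z i| < 1 then 1 else 0 : R).
  by case: ifPn => zi; [exact: cvg_bump1_in|apply: cvg_bump1_out; rewrite leNgt].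
have -> : (\1_(open_box l u) x : R) = \prod_i (if `|z i| < 1 then 1 else 0).
  rewrite indicE; have [/set_mem xb|xb] := boolP (x \in _).
    by rewrite big1 // => i _; rewrite -zP xb.
  have [j zj] : exists j, ~~ (`|z j| < 1).
    apply/not_existsP => h; move/negP: xb; apply; rewrite inE => i.
    by rewrite zP; apply/negPn/negP; exact: h.
  by rewrite (bigD1 j) //= (negbTE zj) mul0r.
rewrite /box_bump -/(z _); elim: (index_enum _) => [|i s IH].
  by rewrite big_nil; under eq_fun do rewrite big_nil; exact: cvg_cst.
rewrite big_cons; under eq_fun do rewrite big_cons.
by apply: cvgM => //; exact: c.
Qed.

End trigonometric_closure.

(** * Laws with the same characteristic function *)

Section law_uniqueness.
Context {R : realType} {d : nat}.
Local Notation V := 'rV[R]_d.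
Context d1 (T1 : measurableType d1) (m1 : probability T1 R) (g1 : T1 -> V)
        d2 (T2 : measurableType d2) (m2 : probability T2 R) (g2 : T2 -> V).
Hypothesis mg1 : measurable_fun setT g1.
Hypothesis mg2 : measurable_fun setT g2.
Hypothesis eq_cos : forall xi,
  \int[m1]_t cos (dotv (g1 t) xi) = \int[m2]_t cos (dotv (g2 t) xi).
Hypothesis eq_sin : forall xi,
  \int[m1]_t sin (dotv (g1 t) xi) = \int[m2]_t sin (dotv (g2 t) xi).

Let mtrig (h : R -> R) dT (T : measurableType dT) (g : T -> V) xi :
  measurable_fun setT h -> measurable_fun setT g ->
  measurable_fun setT (fun t => h (dotv (g t) xi)).
Proof.
move=> mh mg; apply: (measurableT_comp mh).
exact: (measurableT_comp (measurable_dotv xi) mg).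
Qed.

Let int_cosD dT (T : measurableType dT) (m : probability T R) (g : T -> V) xi th :
  measurable_fun setT g ->
  \int[m]_t cos (dotv (g t) xi + th) =
  \int[m]_t cos (dotv (g t) xi) * cos th - \int[m]_t sin (dotv (g t) xi) * sin th.
Proof.
move=> mg.
have ic : m.-integrable setT (EFin \o (fun t => cos (dotv (g t) xi))).
  apply: (@bounded_integrable _ _ _ _ _ 1) => [|x]; last exact: cos_max.
  by apply: mtrig => //; apply: continuous_measurable_fun; exact: continuous_cos.
have ins : m.-integrable setT (EFin \o (fun t => sin (dotv (g t) xi))).
  apply: (@bounded_integrable _ _ _ _ _ 1) => [|x]; last exact: sin_max.
  by apply: mtrig => //; apply: continuous_measurable_fun; exact: continuous_sin.
under eq_Rintegral do rewrite cosD.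
rewrite RintegralB //.
- by rewrite !RintegralZr.
- have := integrableZl measurableT (cos th) ic; apply: eq_integrable => // x _ /=.
  by rewrite EFinM muleC.
- have := integrableZl measurableT (sin th) ins; apply: eq_integrable => // x _ /=.
  by rewrite EFinM muleC.
Qed.

(** Equality on characters passes through linear combinations, and through the limits of [tcl] by
    bounded convergence. *)
Lemma tcl_eq_law f : tcl f -> \int[m1]_t f (g1 t) = \int[m2]_t f (g2 t).
Proof.
have itcl dT (T : measurableType dT) (m : probability T R) (g : T -> V) h :
    measurable_fun setT g -> tcl h -> m.-integrable setT (EFin \o (fun t => h (g t))).
  move=> mg th; have [M [bM _]] := tcl_bounded_lipschitz th.
  apply: (@bounded_integrable _ _ _ _ _ M) => //.
  exact: (measurableT_comp (tcl_measurable th) mg).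
elim => {f} [xi th|f g tf hf tg hg|a f tf hf|F f M tF hF b _ c].
- by rewrite !int_cosD // eq_cos eq_sin.
- by rewrite !RintegralD ?hf ?hg //; exact: itcl.
- by rewrite !RintegralZl ?hf //; exact: itcl.
- have mF dT (T : measurableType dT) (g : T -> V) n : measurable_fun setT g ->
      measurable_fun setT (fun t => F n (g t)).
    by move=> mg; exact: (measurableT_comp (tcl_measurable (tF n)) mg).
  have h1 : \int[m1]_t F n (g1 t) @[n --> \oo] --> \int[m1]_t f (g1 t).
    by apply: (@cvg_Rintegral_bounded _ _ _ _ _ _ M) => // n; exact: mF.
  have h2 : \int[m2]_t F n (g2 t) @[n --> \oo] --> \int[m2]_t f (g2 t).
    by apply: (@cvg_Rintegral_bounded _ _ _ _ _ _ M) => // n; exact: mF.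
  have e : (fun n => \int[m1]_t F n (g1 t)) = fun n => \int[m2]_t F n (g2 t).
    by apply/funext.
  by rewrite e in h1; exact: (cvg_unique _ h1 h2).
Qed.

Let indic_law dT (T : measurableType dT) (m : probability T R) (g : T -> V) A :
  measurable_fun setT g -> measurable A ->
  \int[m]_t (\1_A (g t) : R) = fine (m (g @^-1` A)).
Proof.
move=> mg mA; rewrite /Rintegral.
have mgA : measurable (g @^-1` A).
  by rewrite -[X in measurable X]setTI; exact: mg.
by have := @integral_indic _ _ _ m setT measurableT _ mgA; rewrite setIT => <-.
Qed.

Lemma eq_law_box l u :
  m1 (g1 @^-1` (open_box l u)) = m2 (g2 @^-1` (open_box l u)).
Proof.
have fin dT (T : measurableType dT) (m : probability T R) (g : T -> V) :
    measurable_fun setT g -> m (g @^-1` open_box l u) \is a fin_num.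
  move=> mg; apply: fin_num_measure; rewrite -[X in measurable X]setTI.
  exact: mg (measurable_open_box l u).
have [lu|] := pselect (forall i, l 0 i < u 0 i); last first.
  move=> /existsNP[i /negP]; rewrite -leNgt => ul.
  have -> : open_box l u = set0.
    apply/seteqP; split => x // /(_ i) /andP[h1 h2].
    by have := lt_trans h1 h2; rewrite ltNge ul.
  by rewrite !preimage_set0 !measure0.
rewrite -(fineK (fin _ _ m1 _ mg1)) -(fineK (fin _ _ m2 _ mg2)); congr (_%:E).
have mb := measurable_open_box l u.
rewrite -!indic_law //.
have c dT (T : measurableType dT) (m : probability T R) (g : T -> V) :
    measurable_fun setT g ->
    \int[m]_t box_bump l u n (g t) @[n --> \oo] --> \int[m]_t (\1_(open_box l u) (g t) : R).
  move=> mg; apply: (@cvg_Rintegral_bounded _ _ _ _ _ _ 1).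
  - move=> n; exact: (measurableT_comp (tcl_measurable (tcl_bump n lu)) mg).
  - by move=> x; exact: cvg_bump.
  - by move=> n x; rewrite ger0_norm ?bump_ge0 ?bump_le1.
apply: (cvg_unique _ (c _ _ m1 _ mg1)) => //=.
have -> : (fun n => \int[m1]_t box_bump l u n (g1 t)) = fun n => \int[m2]_t box_bump l u n (g2 t).
  by apply/funext => n; apply: tcl_eq_law; exact: tcl_bump.
exact: c.
Qed.

(** Boxes form a pi-system exhausting the space. The laws are images under maps on two different
    probability spaces, because the result serves for a combination of two independent copies of mu
    and for a linear form compared with a multiple of [Y]. *)
Lemma eq_law A : measurable A -> m1 (g1 @^-1` A) = m2 (g2 @^-1` A).
Proof.
pose n1' : {measure set V -> \bar R} := pushforward m1 g1.
pose n2' : {measure set V -> \bar R} := pushforward m2 g2.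
pose n1 := n1' mg1; pose n2 := n2' mg2.
move=> mA; change (n1 A = n2 A); move: A mA.
apply: (@measure_unique _ R V [set B | exists l u, B = open_box l u]
  (fun k => open_box (const_mx (- k%:R)) (const_mx k%:R)) measurable_rV_boxes _ _ _
  n1 n2).
- by move=> _ _ [l [u ->]] [l' [u' ->]]; exact: open_boxI.
- by move=> k; eexists; eexists.
- apply/seteqP; split => // x _; exists (Num.bound (enorm x)) => // i.
  rewrite !mxE -ltr_norml (le_lt_trans (coord_le_enorm x i)) //.
  by apply: archi_boundP; exact: enorm_ge0.
- by move=> _ [l [u ->]]; exact: eq_law_box.
- move=> k; rewrite /n1 /= /pushforward ltey_eq fin_num_measure //.
  rewrite -[X in measurable X]setTI.
  exact: mg1 (measurable_open_box _ _).
Qed.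

(** The value +oo is allowed, so moments can be transferred between laws before they are known to be
    finite. *)
Lemma eq_law_ge0_integral (h : V -> \bar R) : measurable_fun setT h ->
  (forall x, 0 <= h x)%E ->
  (\int[m1]_t h (g1 t) = \int[m2]_t h (g2 t))%E.
Proof.
move=> mh h0.
have e1 := @ge0_integral_pushforward _ _ _ _ _ _ mg1 m1 setT h measurableT mh (fun x _ => h0 x).
have e2 := @ge0_integral_pushforward _ _ _ _ _ _ mg2 m2 setT h measurableT mh (fun x _ => h0 x).
rewrite !preimage_setT in e1 e2; rewrite /comp in e1 e2; rewrite -e1 -e2.
by apply: eq_measure_integral => A mA _; exact: eq_law.
Qed.

Lemma eq_law_Rintegral (h : V -> R) M : measurable_fun setT h ->
  (forall x, `|h x| <= M) ->
  \int[m1]_t h (g1 t) = \int[m2]_t h (g2 t).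
Proof.
move=> mh hM; rewrite /Rintegral; congr fine.
have int dT (T : measurableType dT) (m : probability T R) (g : T -> V) :
    measurable_fun setT g -> m.-integrable setT (EFin \o h \o g).
  move=> mg; apply: (@bounded_integrable _ _ _ _ _ M) => //.
  exact: (measurableT_comp mh mg).
have mh' : measurable_fun setT (EFin \o h) by exact/measurable_EFinP.
have e1 := @integral_pushforward _ _ _ _ _ _ mg1 m1 setT _ mh' (int _ _ _ _ mg1) measurableT.
have e2 := @integral_pushforward _ _ _ _ _ _ mg2 m2 setT _ mh' (int _ _ _ _ mg2) measurableT.
rewrite !preimage_setT in e1 e2; rewrite /comp in e1 e2; rewrite -e1 -e2.
by apply: eq_measure_integral => A mA _; exact: eq_law.
Qed.

End law_uniqueness.

(** * Schwartz test functions and density *)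

Section schwartz_functions.
Context {R : realType} {d : nat}.
Local Notation V := 'rV[R]_d.
Implicit Types (P Q f g : V -> R) (x : V).

(** Polynomial functions, described by closure rules: what is used of them is stability under
    derivation and polynomial growth, both obtained by induction. *)
Inductive pfun : (V -> R) -> Prop :=
| pfun_cst (c : R) : pfun (fun=> c)
| pfun_coord i : pfun (fun x => x 0 i)
| pfun_add P Q : pfun P -> pfun Q -> pfun (fun x => P x + Q x)
| pfun_mul P Q : pfun P -> pfun Q -> pfun (fun x => P x * Q x).

Lemma pfun_ext P Q : P =1 Q -> pfun P -> pfun Q.
Proof. by move=> /funext ->. Qed.

Lemma pfun_exp P n : pfun P -> pfun (fun x => P x ^+ n).
Proof.
move=> pP; elim: n => [|n IH]; first exact: pfun_cst.
by apply: (pfun_ext _ (pfun_mul pP IH)) => x; rewrite exprS.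
Qed.

Lemma pfun_sum (I : Type) (s : seq I) (F : I -> V -> R) :
  (forall i, pfun (F i)) -> pfun (fun x => \sum_(i <- s) F i x).
Proof.
move=> pF; elim: s => [|i s IH].
  by apply: (pfun_ext _ (pfun_cst 0)) => x; rewrite big_nil.
by apply: (pfun_ext _ (pfun_add (pF i) IH)) => x; rewrite big_cons.
Qed.

Lemma pfun_differentiable P x : pfun P -> differentiable P x.
Proof.
elim => {P} [c|i|P Q _ dP _ dQ|P Q _ dP _ dQ].
- exact: differentiable_cst.
- exact: differentiable_coord.
- exact: differentiableD.
- exact: differentiableM.
Qed.

Lemma derive_coord (v : V) i x : 'D_v (fun y : V => y 0 i : R) x = v 0 i.
Proof.
rewrite deriveE; last exact: differentiable_coord.
(* The coordinate is packaged as a linear map, which is its own differential. *)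
have @f : {linear V -> R}.
  by exists (fun N : V => N 0 i); do 2![eexists]; do ?[constructor];
     rewrite ?mxE// => ? *; rewrite ?mxE//; move=> ?; rewrite !mxE.
rewrite (_ : (fun _ => _) = f) // diff_lin //.
exact: coord_continuous.
Qed.

Lemma pfun_derive P (v : V) : pfun P -> pfun ('D_v P).
Proof.
move=> pP; elim: pP => {P} [c|i|P Q pP dP pQ dQ|P Q pP dP pQ dQ].
- by apply: (pfun_ext _ (pfun_cst 0)) => x; rewrite derive_cst.
- by apply: (pfun_ext _ (pfun_cst (v 0 i))) => x; rewrite derive_coord.
- apply: (pfun_ext _ (pfun_add dP dQ)) => x.
  by rewrite deriveD //; apply: diff_derivable; exact: pfun_differentiable.
- apply: (pfun_ext _ (pfun_add (pfun_mul pP dQ) (pfun_mul pQ dP))) => x.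
  by rewrite deriveM //; apply: diff_derivable; exact: pfun_differentiable.
Qed.

Lemma pfun_growth P : pfun P -> exists (C : R) n, 0 <= C /\
  forall x, `|P x| <= C * (1 + enorm x) ^+ n.
Proof.
have e1 x n : 1 <= (1 + enorm x) ^+ n.
  by apply: exprn_ege1; rewrite lerDl enorm_ge0.
elim => {P} [c|i|P Q _ [C [n [C0 hP]]] _ [D [m [D0 hQ]]]|P Q _ [C [n [C0 hP]]] _ [D [m [D0 hQ]]]].
- by exists `|c|, 0%N; split => // x; rewrite expr0 mulr1.
- exists 1, 1%N; split => // x; rewrite mul1r expr1.
  by rewrite (le_trans (coord_le_enorm _ _)) // lerDr.
- exists (C + D), (n + m)%N; split => [|x]; first exact: addr_ge0.
  rewrite (le_trans (ler_normD _ _)) // mulrDl lerD //.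
    rewrite (le_trans (hP x)) // ler_wpM2l // exprD ler_peMr //.
    by rewrite (le_trans _ (e1 x n)).
  rewrite (le_trans (hQ x)) // ler_wpM2l // exprD ler_peMl //.
  by rewrite (le_trans _ (e1 x m)).
- exists (C * D), (n + m)%N; split => [|x]; first exact: mulr_ge0.
  by rewrite normrM exprD mulrACA ler_pM.
Qed.

Lemma differentiable_expRN Q x : differentiable Q x ->
  differentiable (fun y => expR (- Q y)) x.
Proof.
move=> dQ; apply: (@differentiable_comp _ _ _ _ (fun y => - Q y) expR).
  exact: differentiableN.
by apply/derivable1_diffP; exact: derivable_expR.
Qed.

Lemma derive_expRN Q (v : V) x : differentiable Q x ->
  'D_v (fun y => expR (- Q y)) x = - (expR (- Q x) * 'D_v Q x).
Proof.
move=> dQ; have dN : differentiable (- Q) x by exact: differentiableN.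
have dE : differentiable (@expR R) ((- Q) x).
  by apply/derivable1_diffP; exact: derivable_expR.
rewrite deriveE; last exact: differentiable_expRN.
rewrite [LHS](_ : _ = 'd expR ((- Q) x) ('d (- Q) x v)); last first.
  exact: (congr1 (fun F : V -> R => F v) (diff_comp dN dE)).
have <- : 'D_v (- Q) x = 'd (- Q) x v by rewrite deriveE.
rewrite deriveN; last exact: diff_derivable.
have -> (w : R) : 'd expR ((- Q) x) w = w * expR (- Q x).
  rewrite -[w in LHS]mulr1 [LHS]linearZ /=; congr (_ * _).
  by rewrite -derive1E' // derive1E derive_val.
by rewrite mulNr mulrC.
Qed.

(** A derivative of P exp(-Q) has the same form, with P replaced by its derivative minus P times
    that of Q. *)
Lemma iter_partial_pexp P Q (s : seq 'I_d) : pfun P -> pfun Q ->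
  exists2 P', pfun P' &
    iter_partial s (fun x => P x * expR (- Q x)) = fun x => P' x * expR (- Q x).
Proof.
move=> pP pQ; elim: s => [|i s [P' pP' IH]]; first by exists P.
pose v : V := delta_mx 0 i.
exists (fun x => 'D_v P' x + (-1) * (P' x * 'D_v Q x)).
  apply: pfun_add; first exact: pfun_derive.
  by apply: pfun_mul; [exact: pfun_cst|apply: pfun_mul => //; exact: pfun_derive].
rewrite /= IH; apply/funext => x.
have dQ := pfun_differentiable x pQ; have dP := pfun_differentiable x pP'.
rewrite [LHS](@deriveM _ _ P' (fun y => expR (- Q y))) ?derive_expRN //.
- transitivity (P' x * - (expR (- Q x) * 'D_v Q x) + expR (- Q x) * 'D_v P' x) => //.
  by ring.
- exact: diff_derivable.
- by apply: diff_derivable; exact: differentiable_expRN.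
Qed.

(** The value of [k] makes 1 + t at most k (1 + c t / (n + 1)), and (1 + c t / (n + 1))^(n+1) is at
    most exp(c t). Dividing by [n.+1] covers [n = 0]. *)
Lemma polyexp_bounded n (c : R) : 0 < c ->
  exists M : R, forall t, 0 <= t -> (1 + t) ^+ n * expR (- (c * t)) <= M.
Proof.
move=> c0; pose k := (n.+1%:R / c) + 1.
have k1 : 1 <= k by rewrite lerDr divr_ge0 // ltW.
exists (k ^+ n * expR 1) => t t0.
have h : 1 + t <= k * (1 + c * t / n.+1%:R).
  rewrite /k mulrDl mul1r mulrDr mulr1.
  have -> : n.+1%:R / c * (c * t / n.+1%:R) = t.
    have aux (N : R) : N != 0 -> N / c * (c * t / N) = t.
      by move=> N0; field; rewrite N0 gt_eqF.
    by rewrite aux // pnatr_eq0.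
  have : 0 <= n.+1%:R / c by rewrite divr_ge0 // ltW.
  have : 0 <= c * t / n.+1%:R by rewrite divr_ge0 // mulr_ge0 // ltW.
  by move: (_ / c) (_ / n.+1%:R) => A B; lra.
have e : (1 + c * t / n.+1%:R) ^+ n <= expR (c * t).
  set w := c * t / n.+1%:R.
  have w0 : 0 <= w by rewrite divr_ge0 // mulr_ge0 // ltW.
  have -> : c * t = n.+1%:R * w by rewrite [RHS]mulrC divfK // pnatr_eq0.
  rewrite expRM_natl (@le_trans _ _ ((1 + w) ^+ n.+1)) //.
    by rewrite ler_weXn2l // lerDl.
  rewrite lerXn2r ?nnegrE ?expR_ge0 ?addr_ge0 //.
  exact: expR_ge1Dx.
rewrite expRN ler_pdivrMr ?expR_gt0 //.
have k0 : 0 <= k by exact: le_trans k1.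
have t1 : 0 <= 1 + t by rewrite addr_ge0.
have := lerXn2r n t1 (le_trans t1 h) h; rewrite exprMn => /le_trans; apply.
rewrite -[leRHS]mulrA ler_wpM2l ?exprn_ge0 //.
apply: le_trans e _; rewrite ler_peMl ?expR_ge0 //.
by rewrite (le_trans _ (expR_ge1Dx 1)) // lerDl.
Qed.

(** Linear growth of Q suffices: exp(-c |x|) absorbs the weight of the Schwartz norm and the
    polynomial factor of every derivative. *)
Lemma schwartz_pexp P Q (c C : R) : pfun P -> pfun Q -> 0 < c ->
  (forall x, c * enorm x - C <= Q x) ->
  schwartz (fun x => P x * expR (- Q x)).
Proof.
move=> pP pQ c0 hQ s; have [P' pP' ->] := iter_partial_pexp s pP pQ; split => [x|k].
  apply: differentiableM; first exact: pfun_differentiable.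
  by apply: differentiable_expRN; exact: pfun_differentiable.
have [D [n [D0 hD]]] := pfun_growth pP'.
have [M hM] := polyexp_bounded (k + n) c0.
exists (D * M * expR C) => x; rewrite normrM [`|expR _|]ger0_norm ?expR_ge0 //.
have e0 := enorm_ge0 x.
apply: (@le_trans _ _ (((1 + enorm x) ^+ k * (D * (1 + enorm x) ^+ n)) *
    expR (C - c * enorm x))).
  rewrite -!mulrA ler_wpM2l ?exprn_ge0 ?addr_ge0 //.
  rewrite mulrA ler_pM ?expR_ge0 //.
  by rewrite ler_expR; have := hQ x; lra.
rewrite expRD; have := hM _ e0; rewrite exprD => h.
have -> : (1 + enorm x) ^+ k * (D * (1 + enorm x) ^+ n) * (expR C * expR (- (c * enorm x)))
  = D * ((1 + enorm x) ^+ k * (1 + enorm x) ^+ n * expR (- (c * enorm x))) * expR C by ring.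
by rewrite ler_wpM2r ?expR_ge0 // ler_wpM2l.
Qed.

Lemma schwartz_bump (l u : V) n : (forall i, l 0 i < u 0 i) ->
  schwartz (box_bump l u n).
Proof.
move=> lu; pose a i := (l 0 i + u 0 i) / 2; pose b i := (u 0 i - l 0 i) / 2.
have b0 i : 0 < b i by rewrite divr_gt0 // subr_gt0.
pose Q x := \sum_i (n.+1%:R * ((x 0 i - a i) / b i) ^+ (4 * n.+1)).
have -> : box_bump l u n = fun x => 1 * expR (- Q x).
  by apply/funext => x; rewrite mul1r /Q -sumrN expR_sum.
(* With this [c], each rescaled coordinate w satisfies |w| >= c (|x_i| - |a_i|). Together with
   w^(4(n+1)) >= |w| - 1, summation over i gives a linear lower bound for [Q]. *)
pose c := \big[Num.min/1]_i (b i)^-1.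
have c0 : 0 < c by apply/bigmin_gtP; split => // i _; rewrite invr_gt0.
apply: (@schwartz_pexp _ Q c (\sum_i (c * `|a i| + n.+1%:R))) => //.
- exact: pfun_cst.
- apply: pfun_sum => i; apply: pfun_mul; first exact: pfun_cst.
  apply: pfun_exp; apply: pfun_mul; last exact: pfun_cst.
  by apply: pfun_add; [exact: pfun_coord|exact: pfun_cst].
- move=> x; apply: (@le_trans _ _ (\sum_i (c * `|x 0 i| - (c * `|a i| + n.+1%:R)))).
    by rewrite sumrB lerD2r -mulr_sumr ler_wpM2l ?(ltW c0) // enorm_le_sum.
  apply: ler_sum => i _; set w := (x 0 i - a i) / b i.
  have cw : c * (`|x 0 i| - `|a i|) <= `|w|.
    have -> : `|w| = `|x 0 i - a i| / b i.
      by rewrite /w normrM [`|_^-1|]ger0_norm ?invr_ge0 ?(ltW (b0 i)).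
    rewrite mulrC.
    apply: (@le_trans _ _ (`|x 0 i - a i| * c)).
      by rewrite ler_wpM2r ?(ltW c0) // lerB_dist.
    by rewrite ler_wpM2l // /c (bigD1 i) //= ge_min lexx.
  have w1 : `|w| - 1 <= w ^+ (4 * n.+1).
    have -> : w ^+ (4 * n.+1) = `|w| ^+ (4 * n.+1).
      by rewrite -normrX ger0_norm // expr4_ge0.
    have [w1|w1] := leP `|w| 1.
      by rewrite (@le_trans _ _ 0) ?subr_le0 // exprn_ge0.
    rewrite (@le_trans _ _ `|w|) ?lerBlDr ?lerDl //.
    by rewrite -[leLHS]expr1 ler_weXn2l // ltW.
  have := expr4_ge0 n.+1 w; have : (1 : R) <= n.+1%:R by rewrite ler1n.
  by nra.
Qed.

Lemma iter_partialD f g s : schwartz f -> schwartz g ->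
  iter_partial s (fun x => f x + g x) =
  fun x => iter_partial s f x + iter_partial s g x.
Proof.
move=> sf sg; elim: s => //= i s ->; apply/funext => x.
by rewrite [LHS]deriveD //; apply: diff_derivable; [exact: (sf s).1|exact: (sg s).1].
Qed.

Lemma schwartzD f g : schwartz f -> schwartz g -> schwartz (fun x => f x + g x).
Proof.
move=> sf sg s; rewrite iter_partialD //; split => [x|k].
  by apply: differentiableD; [exact: (sf s).1|exact: (sg s).1].
have [M hM] := (sf s).2 k; have [N hN] := (sg s).2 k.
exists (M + N) => x; rewrite (le_trans _ (lerD (hM x) (hN x))) //.
by rewrite -mulrDr ler_wpM2l ?ler_normD // exprn_ge0 // addr_ge0 // enorm_ge0.
Qed.

Lemma iter_partialZ (a : R) f s : schwartz f ->
  iter_partial s (fun x => a * f x) = fun x => a * iter_partial s f x.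
Proof.
move=> sf; elim: s => //= i s ->; apply/funext => x.
by rewrite [LHS]deriveZ //; apply: diff_derivable; exact: (sf s).1.
Qed.

Lemma schwartzZ (a : R) f : schwartz f -> schwartz (fun x => a * f x).
Proof.
move=> sf s; rewrite iter_partialZ //; split => [x|k].
  by apply: differentiableZ; exact: (sf s).1.
have [M hM] := (sf s).2 k.
by exists (`|a| * M) => x; rewrite normrM mulrCA ler_wpM2l.
Qed.

(* Schwartz functions for which the formula for D P_t f will be available; they
   form a class that is still dense in L^p. *)
Definition stest f := schwartz f /\ tcl f.

Lemma stest_bump (l u : V) n : (forall i, l 0 i < u 0 i) -> stest (box_bump l u n).
Proof. by move=> lu; split; [exact: schwartz_bump|exact: tcl_bump]. Qed.

Lemma stestD f g : stest f -> stest g -> stest (fun x => f x + g x).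
Proof. by move=> [a b] [c e]; split; [exact: schwartzD|exact: tcl_add]. Qed.

Lemma stestZ (a : R) f : stest f -> stest (fun x => a * f x).
Proof. by move=> [b c]; split; [exact: schwartzZ|exact: tcl_scale]. Qed.

End schwartz_functions.

Lemma cvg_powR (R : realType) (a : R) (a_ : nat -> R) (x : R) : 0 < a ->
  (forall n, 0 < a_ n) -> a_ n @[n --> \oo] --> a -> a_ n `^ x @[n --> \oo] --> a `^ x.
Proof.
move=> a0 an ca.
have e (b : R) : 0 < b -> b `^ x = expR (x * ln b) by move=> b0; rewrite /powR (gt_eqF b0).
rewrite e //; under eq_fun do rewrite e //.
apply: continuous_cvg; first exact: continuous_expR.
by apply: cvgMr; apply: continuous_cvg => //; exact: continuous_ln.
Qed.

(** The power is exp (p ln) away from 0; the limit 0 is treated apart, through the threshold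
    r^(1/p). *)
Lemma cvg_normr_powR (R : realType) (p : R) (a_ : nat -> R) (a : R) : 0 < p ->
  a_ n @[n --> \oo] --> a -> `|a_ n| `^ p @[n --> \oo] --> `|a| `^ p.
Proof.
move=> p0 ca; have {}ca : `|a_ n| @[n --> \oo] --> `|a| by exact: cvg_norm.
have [a0|a0] := eqVneq a 0.
  rewrite a0 normr0 in ca; rewrite a0 normr0 powR0 ?gt_eqF //.
  apply/cvgrPdist_le => r r0; have rp : 0 < r `^ p^-1 by exact: powR_gt0.
  have /cvgrPdist_le/(_ _ rp) := ca; apply: filterS => n.
  rewrite !sub0r !normrN normr_id => h; rewrite ger0_norm ?powR_ge0 //.
  have -> : r = (r `^ p^-1) `^ p by rewrite -powRrM mulVf ?gt_eqF // powRr1 // ltW.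
  by apply: ge0_ler_powR => //; rewrite ?nnegrE ?powR_ge0 // ltW.
have a1 : 0 < `|a| by rewrite normr_gt0.
(* Terms that vanish are replaced by the limit, so that the sequence is positive throughout; only
   finitely many terms change. *)
pose b n : R := if 0 < `|a_ n| then `|a_ n| else `|a|.
have eb : \forall n \near \oo, b n = `|a_ n|.
  near=> n; have an : 0 < `|a_ n| by near: n; exact: (cvgr_gt _ ca).
  by rewrite /b an.
have cb : b n @[n --> \oo] --> `|a|.
  by apply: cvg_trans ca; apply: near_eq_cvg; apply: filterS eb => n ->.
have b0 n : 0 < b n by rewrite /b; case: ifP.
have h := cvg_powR (x := p) a1 b0 cb.
by apply: cvg_trans h; apply: near_eq_cvg; apply: filterS eb => n ->.
Unshelve. all: by end_near. Qed.

(** * The norm of L^p *)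

Section Lnorm_lemmas.
Context dT (T : measurableType dT) (R : realType) (mu : {measure set T -> \bar R}).
Variable p : R.
Hypothesis p_gt0 : 0 < p.
Local Notation N f := ('N[mu]_p%:E [EFin \o f%R])%E.
Implicit Types f g h : T -> R.

Lemma cvge_0P (I : Type) (F : set_system I) (FF : Filter F) (u : I -> \bar R) :
  (forall i, 0 <= u i)%E ->
  u @ F --> 0%E <-> forall e : R, 0 < e -> \forall i \near F, (u i <= e%:E)%E.
Proof.
move=> u0; split => [/fine_cvgP[ufin /cvgrPdist_le h] e e0|h].
  near=> i.
  have uf : u i \is a fin_num by near: i.
  have : `|0 - (fine \o u) i| <= e by near: i; exact: h.
  rewrite sub0r normrN /= ger0_norm ?fine_ge0 // => ue.
  by rewrite -(fineK uf) lee_fin.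
apply/fine_cvgP; split.
  have := h 1 ltr01; apply: filterS => i ui; rewrite ge0_fin_numE //.
  exact: le_lt_trans ui (ltry _).
apply/cvgrPdist_le => e e0; have := h e e0; apply: filterS => i ui.
have uf : u i \is a fin_num.
  by rewrite ge0_fin_numE // (le_lt_trans ui) // ltry.
by rewrite sub0r normrN /= ger0_norm ?fine_ge0 // -lee_fin fineK.
Unshelve. all: by end_near. Qed.

Lemma Lnorm_pow f : (N f `^ p = \int[mu]_x (`|f x| `^ p)%:E)%E.
Proof. by rewrite poweR_Lnorm ?gt_eqF // -?eq_integral. Qed.

Lemma LnormX f : (N f = (\int[mu]_x (`|f x| `^ p)%:E) `^ p^-1)%E.
Proof. by rewrite -Lnorm_pow -poweRrM mulfV ?gt_eqF // poweRe1 // Lnorm_ge0. Qed.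

Lemma le_Lnorm_integral f g (C : R) : 0 <= C ->
  (\int[mu]_x (`|f x| `^ p)%:E <= (C `^ p)%:E * \int[mu]_x (`|g x| `^ p)%:E)%E ->
  (N f <= C%:E * N g)%E.
Proof.
move=> C0 h; rewrite !LnormX.
have -> : C%:E = ((C `^ p)%:E `^ p^-1)%E.
  by rewrite poweR_EFin -powRrM mulfV ?gt_eqF // powRr1.
have I0 f' : (0 <= \int[mu]_x (`|f' x| `^ p)%:E)%E.
  by apply: integral_ge0 => y _; rewrite lee_fin powR_ge0.
rewrite -poweRM ?lee_fin ?powR_ge0 //; apply: gt0_ler_poweR => //.
- by rewrite invr_ge0 ltW.
- by rewrite in_itv /= leey I0.
- by rewrite in_itv /= leey mule_ge0 ?lee_fin ?powR_ge0.
Qed.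

Lemma Lnorm_le f (e : R) : 0 <= e ->
  (N f <= e%:E)%E <-> (\int[mu]_x (`|f x| `^ p)%:E <= (e `^ p)%:E)%E.
Proof.
move=> e0; rewrite -Lnorm_pow; split => h.
  rewrite -poweR_EFin; apply: gt0_ler_poweR => //; first exact: ltW.
    by rewrite in_itv /= leey Lnorm_ge0.
  by rewrite in_itv /= leey lee_fin e0.
rewrite LnormX -[e](powRr1 e0) -(@mulfV _ p) ?gt_eqF // powRrM -[leRHS]poweR_EFin -Lnorm_pow.
apply: gt0_ler_poweR => //.
- by rewrite invr_ge0 ltW.
- by rewrite in_itv /= leey poweR_ge0.
- by rewrite in_itv /= leey lee_fin powR_ge0.
Qed.

Lemma measurable_normrX_powR f : measurable_fun setT f ->
  measurable_fun setT (fun x => `|f x| `^ p).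
Proof.
move=> mf; apply: (measurableT_comp (measurable_powR p)).
exact: (measurableT_comp (@normr_measurable R setT)).
Qed.

Lemma ae_le_Lnorm f g : measurable_fun setT f -> measurable_fun setT g ->
  {ae mu, forall x, `|f x| <= `|g x|} -> (N f <= N g)%E.
Proof.
move=> mf mg fg.
rewrite -[leRHS]mul1e; apply: le_Lnorm_integral => //; rewrite powR1 mul1e.
apply: ae_ge0_le_integral => //.
- by apply/measurable_EFinP; exact: measurable_normrX_powR.
- by apply/measurable_EFinP; exact: measurable_normrX_powR.
- apply: filterS fg => x fgx _; rewrite lee_fin.
  by apply: ge0_ler_powR => //; rewrite ?nnegrE // ltW.
Qed.

Lemma le_Lnorm f g : measurable_fun setT f -> measurable_fun setT g ->
  (forall x, `|f x| <= `|g x|) -> (N f <= N g)%E.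
Proof. by move=> mf mg fg; apply: ae_le_Lnorm => //; exact: aeW. Qed.

Lemma ae_eq_Lnorm f g : measurable_fun setT f -> measurable_fun setT g ->
  {ae mu, forall x, f x = g x} -> N f = N g.
Proof.
move=> mf mg fg; apply/eqP; rewrite eq_le; apply/andP; split;
  by apply: ae_le_Lnorm => //; apply: filterS fg => x ->.
Qed.

Lemma Lnorm_normr f : N (fun x => `|f x|) = N f.
Proof. by rewrite -[RHS]Lnorm_abse. Qed.

Lemma Lnorm_distC f g : N (fun x => f x - g x) = N (fun x => g x - f x).
Proof.
rewrite -[LHS]Lnorm_normr -[RHS]Lnorm_normr; apply: eq_Lnorm => x /=.
by rewrite distrC.
Qed.

Lemma Lnorm_scale (a : R) f : measurable_fun setT f ->
  (N (fun x => a * f x) = `|a|%:E * N f)%E.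
Proof.
move=> mf.
have e : (N (fun x => (a * f x)%R) `^ p = (`|a|%:E * N f) `^ p)%E.
  rewrite poweRM ?Lnorm_ge0 ?lee_fin // !Lnorm_pow poweR_EFin.
  rewrite -ge0_integralZl //.
  - by apply: eq_integral => x _; rewrite normrM powRM.
  - by apply/measurable_EFinP; exact: measurable_normrX_powR.
have := congr1 (fun z => (z `^ p^-1)%E) e.
by rewrite -!poweRrM mulfV ?gt_eqF // !poweRe1 ?mule_ge0 ?Lnorm_ge0 ?lee_fin.
Qed.

Lemma Lnorm_triangle f g h : 1 <= p -> measurable_fun setT f -> measurable_fun setT g ->
  measurable_fun setT h ->
  (N (fun x => f x - h x) <= N (fun x => f x - g x) + N (fun x => g x - h x))%E.
Proof.
move=> p1 mf mg mh.
have -> : (fun x => f x - h x) = (fun x => f x - g x) \+ (fun x => g x - h x).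
  by apply/funext => x /=; ring.
by apply: minkowski_EFin => //; exact: measurable_funB.
Qed.

Lemma cvg_Lnorm_dominated (F : nat -> T -> R) f g :
  (forall n, measurable_fun setT (F n)) -> measurable_fun setT f ->
  measurable_fun setT g ->
  (forall x, F n x @[n --> \oo] --> f x) -> (forall n x, `|F n x| <= g x) ->
  (N g < +oo)%E -> (fun n => N (fun x => F n x - f x)) @ \oo --> 0%E.
Proof.
move=> mF mf mg Ff Fg gy.
have fg x : `|f x| <= g x.
  by apply: (cvgr_to_le (cvg_norm (Ff x))); apply: nearW => n; exact: Fg.
have g0 x : 0 <= g x by exact: le_trans (normr_ge0 _) (fg x).
apply/cvge_0P => [n|e e0]; first exact: Lnorm_ge0.
have c : (\int[mu]_x (`|F n x - f x| `^ p)%:E)%E @[n --> \oo] --> 0%E.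
  rewrite -(integral0 mu setT).
  apply: (@dominated_cvg _ _ _ mu setT measurableT
    (fun n x => (`|F n x - f x| `^ p)%:E) (fun=> 0%E)
    (fun x => (`|2 * g x| `^ p)%:E)) => //.
  - move=> n; apply/measurable_EFinP; apply: measurable_normrX_powR.
    exact: measurable_funB.
  - move=> x _; apply: cvg_EFin; first exact: nearW.
    rewrite -(@powR0 R p) ?gt_eqF // -(normr0 R) -(subrr (f x)).
    by apply: (cvg_normr_powR p_gt0 (a_ := fun n => F n x - f x)); apply: cvgB; [exact: Ff|exact: cvg_cst].
  - apply/integrableP; split.
      apply/measurable_EFinP; apply: measurable_normrX_powR.
      exact: measurable_funM.
    under eq_integral do rewrite gee0_abs ?lee_fin ?powR_ge0 //.
    rewrite -(@Lnorm_pow (fun x => 2 * g x)) Lnorm_scale // poweR_lty //.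
    by rewrite lte_mul_pinfty ?lee_fin.
  - move=> n x _; rewrite gee0_abs ?lee_fin ?powR_ge0 //.
    apply: ge0_ler_powR; rewrite ?nnegrE //; first exact: ltW.
    rewrite (ger0_norm (mulr_ge0 _ (g0 x))) // (le_trans (ler_normB _ _)) //.
    by have := Fg n x; have := fg x; lra.
have /cvge_0P/(_ (e `^ p)) := c => h.
have i0 n : (0 <= \int[mu]_x (`|F n x - f x| `^ p)%:E)%E.
  by apply: integral_ge0 => x _; rewrite lee_fin powR_ge0.
have {}h := h i0 (powR_gt0 p e0).
by apply: filterS h => n h; apply/Lnorm_le => //; exact: ltW.
Qed.

End Lnorm_lemmas.

Lemma Lfun_mem dT (T : measurableType dT) (R : realType)
    (mu : {measure set T -> \bar R}) (p : \bar R) (f : T -> R) :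
  f \in Lfun mu p <-> measurable_fun setT f /\ ('N[mu]_p [EFin \o f] < +oo)%E.
Proof.
split => [|[mf fy]].
  rewrite inE => /andP[mf ff]; split.
    by move: mf => /[!inE].
  by move: ff => /[!inE].
by apply/andP; split; rewrite inE.
Qed.

(** * Density of the test functions in L^p *)

Section density.
Import HBSimple HBNNSimple.
Context {R : realType} {d : nat}.
Local Notation V := 'rV[R]_d.
Variables (mu : probability V R) (p : R).
Hypothesis p1 : 1 <= p.
Local Notation N f := ('N[mu]_p%:E [EFin \o f%R])%E.

Let p0 : 0 < p. Proof. exact: lt_le_trans p1. Qed.

Let cl (f : V -> R) := measurable_fun setT f /\
  forall e : R, 0 < e -> exists2 u, stest u & (N (fun x => u x - f x) <= e%:E)%E.

Lemma stest_measurable (u : V -> R) : stest u -> measurable_fun setT u.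
Proof. by move=> [_]; exact: tcl_measurable. Qed.

Lemma Lnorm_cst_lty (c : R) : (N (cst c) < +oo)%E.
Proof. by have /Lfun_mem[] := @Lfun_cst _ _ _ mu c p. Qed.

Let clD f g : cl f -> cl g -> cl (fun x => f x + g x).
Proof.
move=> [mf hf] [mg hg]; split; first exact: measurable_funD.
move=> e e0; have e2 : 0 < e / 2 by rewrite divr_gt0.
have [u su uf] := hf _ e2; have [v sv vg] := hg _ e2.
exists (fun x => u x + v x); first exact: stestD.
have -> : (fun x => u x + v x - (f x + g x)) =
    (fun x => u x - f x) \+ (fun x => v x - g x) by apply/funext => x /=; ring.
apply: (le_trans (minkowski_EFin _ _ _ _)) => //.
- by apply: measurable_funB => //; exact: stest_measurable.
- by apply: measurable_funB => //; exact: stest_measurable.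
- by rewrite [e]splitr EFinD; apply: leeD.
Qed.

Let clZ (a : R) f : cl f -> cl (fun x => a * f x).
Proof.
move=> [mf hf]; split; first exact: measurable_funM.
move=> e e0; have a1 : 0 < `|a| + 1 by rewrite ltr_pwDr.
have [u su uf] := hf _ (divr_gt0 e0 a1).
exists (fun x => a * u x); first exact: stestZ.
have -> : (fun x => a * u x - a * f x) = fun x => a * (u x - f x).
  by apply/funext => x; rewrite mulrBr.
rewrite Lnorm_scale //; last by apply: measurable_funB => //; exact: stest_measurable.
apply: (@le_trans _ _ (`|a|%:E * (e / (`|a| + 1))%:E)%E).
  by apply: lee_wpmul2l.
rewrite -EFinM lee_fin mulrCA ger_pMr // ler_pdivrMr // mul1r.
by rewrite lerDl.
Qed.

Let cl_lim (F : nat -> V -> R) f g : (forall n, cl (F n)) ->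
  measurable_fun setT g -> (N g < +oo)%E ->
  (forall n x, `|F n x| <= g x) -> (forall x, F n x @[n --> \oo] --> f x) -> cl f.
Proof.
move=> cF mg gy Fg Ff.
have mf : measurable_fun setT f.
  by apply: (measurable_fun_cvg (fun n => (cF n).1)) => x _; exact: Ff.
split => // e e0; have e2 : 0 < e / 2 by rewrite divr_gt0.
have /cvge_0P h := cvg_Lnorm_dominated p0 (fun n => (cF n).1) mf mg Ff Fg gy.
have [n _ /(_ n (leqnn n)) hn] := h (fun n => Lnorm_ge0 _ _ _) _ e2.
have [u su un] := (cF n).2 _ e2; exists u => //.
have := @Lnorm_triangle _ _ _ mu _ _ _ _ p1 (stest_measurable su) (cF n).1 mf.
move=> /le_trans; apply.
by rewrite [e]splitr EFinD; apply: leeD.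
Qed.

Let cl_stest u : stest u -> cl u.
Proof.
move=> su; split; first exact: stest_measurable.
move=> e e0; exists u => //.
have -> : (fun x => u x - u x) = cst 0 by apply/funext => x; rewrite subrr.
by apply/(Lnorm_le _ p0 _ (ltW e0)); rewrite integral0_eq ?lee_fin ?powR_ge0 // => x _;
  rewrite normr0 powR0 // gt_eqF.
Qed.

Let cl0 : cl (fun=> 0).
Proof.
have [u su] : exists u : V -> R, stest u.
  by exists (box_bump 0 (const_mx 1) 0); apply: stest_bump => i; rewrite !mxE.
have := clZ 0 (cl_stest su).
by have -> : (fun x => 0 * u x) = fun=> 0 by apply/funext => x; rewrite mul0r.
Qed.

Let cl_box l u : cl (\1_(open_box l u) : V -> R).
Proof.
have [lu|] := pselect (forall i, l 0 i < u 0 i); last first.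
  move=> /existsNP[i /negP]; rewrite -leNgt => ul.
  have -> : open_box l u = set0.
    apply/seteqP; split => x // /(_ i) /andP[h1 h2].
    by have := lt_trans h1 h2; rewrite ltNge ul.
  by rewrite indic0.
apply: (@cl_lim (box_bump l u) _ (cst 1)) => //.
- by move=> n; apply: cl_stest; exact: stest_bump.
- exact: Lnorm_cst_lty.
- by move=> n x; rewrite ger0_norm ?bump_ge0 ?bump_le1.
- by move=> x; exact: cvg_bump.
Qed.

Let cl_setT : cl (\1_[set: V] : V -> R).
Proof.
apply: (@cl_lim (fun k => \1_(open_box (const_mx (- k%:R)) (const_mx k%:R))) _ (cst 1)) => //.
- exact: Lnorm_cst_lty.
- by move=> n x; rewrite indicE; case: (_ \in _); rewrite /= ?normr1 ?normr0.
- move=> x; apply: cvg_near_cst; exists (Num.bound (enorm x)) => // n /= hn.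
  rewrite !indicE; congr (nat_of_bool _)%:R; rewrite in_setT; apply/mem_set => i.
  rewrite !mxE -ltr_norml (le_lt_trans (coord_le_enorm x i)) //.
  by rewrite (lt_le_trans (archi_boundP (enorm_ge0 x))) // ler_nat.
Qed.

Let cl_indic A : measurable A -> cl (\1_A : V -> R).
Proof.
move=> mA; have : <<s [set B | exists l u, B = @open_box R d l u] >> A.
  by rewrite -measurable_rV_boxes.
move: A {mA}; apply: (@dynkin_induction _ V _ (fun A => cl (\1_A)) measurable_rV_boxes).
- move=> _ _ [l [u ->]] [l' [u' ->]]; exact: open_boxI.
- exact: cl_setT.
- by move=> _ [l [u ->]]; exact: cl_box.
- move=> A mA cA; have := clD cl_setT (clZ (-1) cA).
  have -> // : (fun x => \1_setT x + -1 * \1_A x) = \1_(~` A) :> (V -> R).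
  apply/funext => x; rewrite !indicE in_setT in_setC mulN1r.
  by case: (x \in A) => /=; rewrite ?subrr ?subr0.
(* Disjointness makes the indicator of a finite union a sum of indicators, to which linearity
   applies. *)
- move=> F mF tF cF.
  apply: (@cl_lim (fun n => \1_(\big[setU/set0]_(i < n) F i)) _ (cst 1)) => //.
  + elim => [|n IH]; first by rewrite big_ord0 indic0.
    rewrite big_ord_recr /=; have := clD IH (cF n).
    have -> // : (fun x => \1_(\big[setU/set0]_(i < n) F i) x + \1_(F n) x) =
      \1_(\big[setU/set0]_(i < n) F i `|` F n) :> (V -> R).
    apply/funext => x; rewrite !indicE in_setU.
    have [xn|xn] := boolP (x \in F n); last by rewrite orbF addr0.
    rewrite orbT; suff -> : x \in \big[setU/set0]_(i < n) F i = false by rewrite add0r.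
    apply/negbTE/negP => /set_mem; rewrite -bigcup_mkord => -[i /= i_n Fi].
    have /trivIsetP/(_ i n I I) := tF; rewrite (ltn_eqF i_n) => /(_ isT) Fin.
    have : (F i `&` F n) x by split => //; exact/set_mem.
    by rewrite Fin.
  + exact: Lnorm_cst_lty.
  + by move=> n x; rewrite indicE; case: (_ \in _); rewrite /= ?normr1 ?normr0.
  + move=> x; have [[i _ Fi]|nF] := pselect ((\bigcup_k F k) x).
      apply: cvg_near_cst; exists i.+1 => // n /= hn.
      rewrite !indicE; congr (nat_of_bool _)%:R.
      transitivity true; last by apply/esym/mem_set; exists i.
      by apply/mem_set; rewrite -bigcup_mkord; exists i.
    apply: cvg_near_cst; apply: nearW => n; rewrite !indicE; congr (nat_of_bool _)%:R.
    transitivity false; last by apply/esym/negbTE/negP => /set_mem.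
    by apply/negbTE/negP => /set_mem; rewrite -bigcup_mkord => -[i _ Fi]; apply: nF; exists i.
Qed.

Let cl_sum (I : Type) (s : seq I) (F : I -> V -> R) : (forall i, cl (F i)) ->
  cl (fun x => \sum_(i <- s) F i x).
Proof.
move=> cF; elim: s => [|i s IH].
  by have -> : (fun x => \sum_(i <- [::]) F i x) = fun=> 0
    by apply/funext => x; rewrite big_nil.
have := clD (cF i) IH.
by have -> // : (fun x => F i x + \sum_(j <- s) F j x) = fun x => \sum_(j <- i :: s) F j x
  by apply/funext => x; rewrite big_cons.
Qed.

Let cl_ge0 f : measurable_fun setT f -> (N f < +oo)%E -> (forall x, 0 <= f x) -> cl f.
Proof.
move=> mf fy f0.
have mf' : measurable_fun setT (EFin \o f) by exact/measurable_EFinP.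
pose g := nnsfun_approx measurableT mf'.
have gf x : (g n x)%:E @[n --> \oo] --> (f x)%:E.
  by apply: (cvg_nnsfun_approx measurableT mf') => // y _; rewrite lee_fin.
have gf' x : g n x @[n --> \oo] --> f x by have /fine_cvgP[_] := gf x.
apply: (@cl_lim (fun n => g n) _ f) => //.
- move=> n; have : cl (fun x => \sum_(y <- finmap.enum_fset (fset_set (range (g n)))) (y * \1_(g n @^-1` [set y]) x)).
    by apply: cl_sum => y; apply: clZ; exact: cl_indic.
  have -> // : (fun x => \sum_(y <- finmap.enum_fset (fset_set (range (g n)))) (y * \1_(g n @^-1` [set y]) x)) = g n.
  by apply/funext => x; rewrite [RHS]fimfunE fsbig_finite //=; exact: fimfunP.
- move=> n x; rewrite ger0_norm //.
  have nd : nondecreasing_seq (fun m => g m x).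
    by move=> a b ab; have /lefP := nd_nnsfun_approx measurableT mf' ab; apply.
  have := nondecreasing_cvgn_le nd (cvgP _ (gf' x)) n.
  by rewrite (cvg_lim _ (gf' x)).
Qed.

(** The closure [cl] contains indicators of boxes as limits of bumps, indicators of Borel sets by a
    Dynkin argument, nonnegative functions as increasing limits of simple ones, and finally
    differences of positive and negative parts. *)
Lemma stest_dense f : f \in Lfun mu p%:E ->
  forall e : R, 0 < e -> exists2 u, stest u & (N (fun x => u x - f x) <= e%:E)%E.
Proof.
move=> /Lfun_mem[mf fy].
suff : cl f by case.
have mp := measurable_funrpos mf; have mn := measurable_funrneg mf.
have clp : cl f^\+.
  apply: cl_ge0 => //; apply: le_lt_trans fy.
  apply: le_Lnorm => // x; rewrite [leLHS]ger0_norm ?funrpos_ge0 //.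
  by rewrite /funrpos ge_max ler_norm normr_ge0.
have cln : cl f^\-.
  apply: cl_ge0 => //; apply: le_lt_trans fy.
  apply: le_Lnorm => // x; rewrite [leLHS]ger0_norm ?funrneg_ge0 //.
  by rewrite /funrneg ge_max -[X in _ <= X]normrN ler_norm normr_ge0.
have := clD clp (clZ (-1) cln).
have -> // : (fun x => f^\+ x + -1 * f^\- x) = f.
by rewrite -[RHS]funrposBneg; apply/funext => x /=; rewrite mulN1r.
Qed.

End density.

(** * Stable laws *)

Section geometric_bounds.
Context {R : realType}.

Lemma nneseries_geometric_le (C q : R) : 0 <= C -> 0 <= q -> q < 1 ->
  (\sum_(0 <= k <oo) (C * q ^+ k)%:E <= (C / (1 - q))%:E)%E.
Proof.
move=> C0 q0 q1; apply: lime_le.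
  by apply: is_cvg_nneseries => k _ _; rewrite lee_fin mulr_ge0 ?exprn_ge0.
apply: nearW => n; rewrite sumEFin lee_fin ler_pdivlMr ?subr_gt0 //.
have -> : (\sum_(0 <= k < n) C * q ^+ k) * (1 - q) = C * (1 - q ^+ n).
  elim: n => [|n IH]; first by rewrite big_nil expr0 subrr mul0r mulr0.
  by rewrite big_nat_recr //= mulrDl IH exprS; ring.
by rewrite ler_piMr // lerBlDr lerDl exprn_ge0.
Qed.

(** Each point lies in a shell where one of the [F k] dominates [X], hence the sum of the [F k]
    dominates everywhere and its integral is at most a geometric series. It serves for large jumps,
    for moments, and for the gamma integrand at 0 and at infinity. *)
Lemma integral_lty_geometric dT (T : measurableType dT)
    (m : {measure set T -> \bar R}) (D : set T) (X : T -> \bar R)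
    (F : nat -> T -> \bar R) (C q : R) :
  measurable D -> measurable_fun D X -> (forall k, measurable_fun D (F k)) ->
  (forall x, D x -> 0 <= X x)%E -> (forall k x, D x -> 0 <= F k x)%E ->
  (forall x, D x -> exists k, X x <= F k x)%E ->
  0 <= C -> 0 <= q -> q < 1 ->
  (forall k, \int[m]_(x in D) F k x <= (C * q ^+ k)%:E)%E ->
  (\int[m]_(x in D) X x < +oo)%E.
Proof.
move=> mD mX mF X0 F0 XF C0 q0 q1 Fb.
apply: (@le_lt_trans _ _ (\int[m]_(x in D) (\sum_(0 <= k <oo) F k x))%E).
  apply: ge0_le_integral => //.
  - apply: ge0_emeasurable_sum => // k x Dx _; exact: F0.
  - move=> x Dx; have [k Xk] := XF x Dx; apply: (le_trans Xk).
    apply: (le_trans _ (nneseries_lim_ge k.+1 _)) => [|j _ _]; last exact: F0.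
    rewrite big_nat_recr //= leeDr // sume_ge0 // => j _; exact: F0.
rewrite integral_nneseries //.
apply: (@le_lt_trans _ _ (\sum_(0 <= k <oo) (C * q ^+ k)%:E)%E).
  by apply: lee_nneseries => // k _ _; apply: integral_ge0 => x Dx; exact: F0.
exact: le_lt_trans (nneseries_geometric_le C0 q0 q1) (ltry _).
Qed.

Lemma dyadic_scale (x : R) : 1 <= x -> exists k, 2 ^+ k <= x < 2 ^+ k.+1.
Proof.
move=> x1.
have h : exists n, x < 2 ^+ n.
  exists (Num.bound x); apply: lt_le_trans (archi_boundP (le_trans ler01 x1)) _.
  rewrite -natrX ler_nat; exact: ltnW (ltn_expl _ _).
have [[|k] xk kmin] := ex_minnP h; first by move: xk; rewrite expr0 ltNge x1.
exists k; rewrite xk andbT leNgt; apply/negP => /kmin.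
by rewrite ltnn.
Qed.

Lemma powR2_lt1 (s : R) : s < 0 -> 2 `^ s < 1.
Proof.
by move=> s0; rewrite /powR pnatr_eq0 /= expR_lt1 nmulr_rlt0 // ln_gt0 // ltr1n.
Qed.

Lemma one_sub_cos (z : R) : 1 - cos z = 2 * sin (z / 2) ^+ 2.
Proof.
have {1}-> : z = (z / 2) *+ 2 by rewrite -mulr_natr divfK // pnatr_eq0.
by rewrite cos_mulr2n; have := cos2Dsin2 (z / 2); rewrite -mulr_natr; lra.
Qed.

Lemma one_sub_cos_ge0 (z : R) : 0 <= 1 - cos z.
Proof. by rewrite subr_ge0 cos_le1. Qed.

Lemma one_sub_cos_le2 (z : R) : 1 - cos z <= 2.
Proof. by have := cos_max z; rewrite ler_norml => /andP[]; lra. Qed.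

Lemma one_sub_cos_le (z : R) : 1 - cos z <= z ^+ 2.
Proof.
rewrite one_sub_cos; have := norm_sin_le (z / 2).
rewrite -(@ler_pXn2r _ 2) ?nnegrE ?normr_ge0 // !real_normK ?num_real //.
by rewrite exprMn => h; have := sqr_ge0 z; nra.
Qed.

(** Here z / 2 lies in [1/8, 1/4], so sin (z / 2) >= z / 2 - (z / 2)^2 >= 3/32, and 2 (3/32)^2 >
    1/64. *)
Lemma one_sub_cos_ge (z : R) : 4^-1 <= z -> z <= 2^-1 -> 64^-1 <= 1 - cos z.
Proof.
move=> z1 z2; rewrite one_sub_cos.
have := norm_sinB_id (z / 2); rewrite ler_norml => /andP[h _].
have : 3 / 32 <= sin (z / 2) by nra.
by nra.
Qed.

End geometric_bounds.

(** * Jumps of the stable Levy measure *)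

Section stable_levy.
Context {R : realType} {d : nat}.
Local Notation V := 'rV[R]_d.
Variables (alpha : R) (nu : {measure set V -> \bar R}).
Hypothesis alpha12 : 1 < alpha < 2.
Hypothesis nu_stable : stable_levy_measure alpha nu.

Let levy_min : (\int[nu]_u (Num.min 1 (enorm u ^+ 2))%:E < +oo)%E.
Proof. by case: nu_stable => -[]. Qed.

Let mmin2 : measurable_fun setT (fun u : V => Num.min 1 (enorm u ^+ 2)).
Proof.
apply: measurable_minr => //; apply: measurable_funX; exact: measurable_enorm.
Qed.

Lemma integrable_min_sqr : nu.-integrable setT (fun u => (Num.min 1 (enorm u ^+ 2))%:E).
Proof.
apply/integrableP; split; first exact/measurable_EFinP.
by under eq_integral do rewrite gee0_abs ?lee_fin ?le_min ?ler01 ?sqr_ge0 //.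
Qed.

Let mge (c : R) : measurable [set u : V | c <= enorm u].
Proof.
have -> : [set u : V | c <= enorm u] = (@enorm R d) @^-1` `[c, +oo[.
  by apply/seteqP; split => u /=; rewrite in_itv /= andbT.
by rewrite -[X in measurable X]setTI; exact: measurable_enorm.
Qed.

Lemma levy_tail k : (nu [set u : V | (2 ^+ k <= enorm u)%R]
  = ((2 `^ (- alpha)) ^+ k)%:E * nu [set u : V | (1 <= enorm u)%R])%E.
Proof.
have c0 : (0 : R) < 2 ^+ k by exact: exprn_gt0.
rewrite -(nu_stable.2 (2 ^+ k) _ c0 (mge _)) /=.
have -> : [set u : V | 2 ^+ k <= enorm (2 ^+ k *: u)] = [set u | 1 <= enorm u].
  apply/seteqP; split => u /=; rewrite enormZ ger0_norm ?(ltW c0) //.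
    by rewrite -[leLHS]mulr1 ler_pM2l.
  by rewrite -[X in _ -> X <= _]mulr1 ler_pM2l.
congr (_%:E * _)%E; rewrite -powR_mulrn // -powRrM mulrC powRrM powR_mulrn //.
Qed.

Let tail_lty : (nu [set u : V | (1 <= enorm u)%R] < +oo)%E.
Proof.
apply: le_lt_trans levy_min.
have -> : nu [set u : V | 1 <= enorm u] =
    (\int[nu]_u (\1_[set u : V | 1 <= enorm u] u)%:E)%E.
  by rewrite integral_indic // setIT.
apply: ge0_le_integral => //.
- by apply/measurable_EFinP; exact: measurable_indic.
- exact/measurable_EFinP.
- move=> u _; rewrite lee_fin indicE.
  have [/set_mem /= u1|_] := boolP (u \in _); last by rewrite le_min ler01 sqr_ge0.
  by rewrite le_min lexx /= exprn_ege1.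
Qed.

(** The size of (g(x + u) - g(x)) u for a bounded Lipschitz function g, up to a constant: quadratic
    for small jumps, linear for large ones. *)
Definition levy_weight (u : V) : R := Num.min 1 (enorm u) * enorm u.

Lemma levy_weight_ge0 u : 0 <= levy_weight u.
Proof. by rewrite mulr_ge0 ?le_min ?ler01 ?enorm_ge0. Qed.

Lemma measurable_levy_weight : measurable_fun setT levy_weight.
Proof.
apply: measurable_funM; last exact: measurable_enorm.
by apply: measurable_minr => //; exact: measurable_enorm.
Qed.

(** On the shell 2^k <= |u| < 2^(k+1) the weight is at most 2^(k+1), while the tail has mass of
    order 2^(-alpha k). The ratio 2^(1-alpha) is below 1 because alpha > 1. Small jumps are covered
    by the Levy condition. *)
Lemma integrable_levy_weight : nu.-integrable setT (EFin \o levy_weight).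
Proof.
have [a1 a2] := andP alpha12.
pose D := [set u : V | 1 <= enorm u]; have mD : measurable D by exact: mge.
pose X (u : V) := enorm u * \1_D u.
have mX : measurable_fun setT X.
  by apply: measurable_funM; [exact: measurable_enorm|exact: measurable_indic].
have X0 u : 0 <= X u by rewrite mulr_ge0 ?enorm_ge0.
have iX : nu.-integrable setT (EFin \o X).
  apply/integrableP; split; first exact/measurable_EFinP.
  under eq_integral do rewrite gee0_abs ?lee_fin //.
  pose A k := [set u : V | 2 ^+ k <= enorm u].
  have nD : nu D \is a fin_num by rewrite ge0_fin_numE; [exact: tail_lty|exact: measure_ge0].
  apply: (@integral_lty_geometric _ _ _ _ _ _
    (fun k u => (2 ^+ k.+1 * \1_(A k) u)%:E) (2 * fine (nu D)) (2 `^ (1 - alpha))) => //.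
  - exact/measurable_EFinP.
  - move=> k; apply/measurable_EFinP; apply: measurable_funM => //.
    by apply: measurable_indic; exact: mge.
  - by move=> u _; rewrite lee_fin.
  - move=> u _; have [u1|u1] := leP 1 (enorm u); last first.
      exists 0%N; rewrite lee_fin /X indicE memNset ?mulr0 ?mulr_ge0 //=.
      by apply/negP; rewrite -ltNge.
    have [k /andP[k1 k2]] := dyadic_scale u1; exists k.
    by rewrite lee_fin /X !indicE !mem_set //= !mulr1 ltW.
  - by rewrite powR2_lt1 // subr_lt0.
  - move=> k; under eq_integral do rewrite EFinM.
    rewrite ge0_integralZl ?lee_fin ?exprn_ge0 //; last first.
      by apply/measurable_EFinP; apply: measurable_indic; exact: mge.
    rewrite integral_indic ?setIT //; last exact: mge.
    rewrite levy_tail -/D -(fineK nD) -!EFinM lee_fin exprS.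
    rewrite powRD; last by rewrite pnatr_eq0 implybT.
    by rewrite powRr1 // exprMn le_eqVlt; apply/orP; left; apply/eqP; ring.
have iM : nu.-integrable setT (fun u => (Num.min 1 (enorm u ^+ 2) + X u)%:E).
  by under eq_fun do rewrite EFinD; apply: integrableD => //; exact: integrable_min_sqr.
apply: (le_integrable measurableT _ _ iM).
  by apply/measurable_EFinP; exact: measurable_levy_weight.
move=> u _; rewrite /= lee_fin ger0_norm ?levy_weight_ge0 // (le_trans _ (ler_norm _)) //.
rewrite /levy_weight /X; have [u1|u1] := leP 1 (enorm u).
  by rewrite mul1r indicE mem_set // mulr1 lerDr le_min ler01 sqr_ge0.
apply: (@le_trans _ _ (Num.min 1 (enorm u ^+ 2))); last by rewrite lerDl; exact: X0.
rewrite -expr2.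
by rewrite le_min lexx andbT exprn_ile1 ?enorm_ge0 // ltW.
Qed.

End stable_levy.

Lemma Rintegral_cst_prob dT (T : measurableType dT) (R : realType)
  (m : probability T R) (c : R) : \int[m]_x c = c.
Proof.
transitivity (c * fine (m setT)); first exact: Rintegral_cst.
by rewrite probability_setT mulr1.
Qed.

(** The imaginary part y is known only through its sine and cosine: sin y = 0, and comparing squares
    removes the sign of cos y. *)
Lemma cexp_eq_real (R : realType) (a : R) (z : R[i]%C) :
  ((expR a)%:C)%C = cexp z -> expR a = expR (complex.Re z).
Proof.
case: z => x y h.
have e1 : expR a = expR x * cos y.
  by have := congr1 (@complex.Re R) h; rewrite /= mul0r subr0.
have e2 : 0 = expR x * sin y.
  by have := congr1 (@complex.Im R) h; rewrite /= mul0r addr0.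
apply/eqP; rewrite -(@eqrXn2 _ 2) ?expR_ge0 //; apply/eqP.
have := cos2Dsin2 y.
have -> : sin y = 0.
  by move/esym/eqP: e2; rewrite mulf_eq0 gt_eqF ?expR_gt0 //= => /eqP.
by rewrite expr0n addr0 e1 exprMn => ->; rewrite mulr1.
Qed.

(** * The characteristic exponent and the moments of the stable law *)

Section characteristic_function.
Context {R : realType} {d : nat}.
Local Notation V := 'rV[R]_d.
Local Open Scope complex_scope.
Variables (alpha : R) (mu : probability V R) (lambda : {finite_measure set V -> \bar R}).
Hypothesis alpha12 : 1 < alpha < 2.
Hypothesis mu_char : forall xi : V, char_fun mu xi =
  (expR (- \int[lambda]_(y in usphere) (`|dotv y xi| `^ alpha)))%:C.

Let a0 : 0 < alpha. Proof. by case/andP: alpha12 => h _; exact: lt_trans h. Qed.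

Definition stable_exponent (xi : V) : R :=
  \int[lambda]_(y in usphere) (`|dotv y xi| `^ alpha).
Local Notation Lam := stable_exponent.

Lemma measurable_usphere : measurable (usphere : set V).
Proof.
have -> : (usphere : set V) = (@enorm R d) @^-1` [set 1] by apply/seteqP; split.
by rewrite -[X in measurable X]setTI; exact: measurable_enorm.
Qed.

Lemma measurable_abs_dotv (xi : V) (a : R) D :
  measurable_fun D (fun y : V => `|dotv y xi| `^ a).
Proof.
apply: measurable_funTS; apply: (measurableT_comp (measurable_powR a)).
apply: (measurableT_comp (@normr_measurable R setT)); exact: measurable_dotv.
Qed.

Lemma integrable_abs_dotv_sphere (xi : V) :
  lambda.-integrable usphere (EFin \o (fun y => `|dotv y xi| `^ alpha)).
Proof.
have mS := measurable_usphere.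
apply: (@le_integrable _ _ _ _ _ mS _ (EFin \o cst (enorm xi `^ alpha))).
- by apply/measurable_EFinP; exact: measurable_abs_dotv.
- move=> y /= y1; rewrite lee_fin [leLHS]ger0_norm ?powR_ge0 //.
  rewrite [leRHS]ger0_norm ?powR_ge0 //.
  apply: ge0_ler_powR; rewrite ?nnegrE ?enorm_ge0 ?(ltW a0) //.
  by rewrite (le_trans (dotv_le_enorm _ _)) // y1 mul1r.
- exact: finite_measure_integrable_cst.
Qed.

Lemma stable_exponent_ge0 xi : 0 <= Lam xi.
Proof. by apply: Rintegral_ge0 => y _; exact: powR_ge0. Qed.

Lemma stable_exponentZ (c : R) xi : Lam (c *: xi) = `|c| `^ alpha * Lam xi.
Proof.
rewrite -RintegralZl //; [|exact: measurable_usphere|exact: integrable_abs_dotv_sphere].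
by apply: eq_Rintegral => y _; rewrite dotvZr normrM powRM.
Qed.

Lemma integral_cos_stable xi : \int[mu]_u cos (dotv u xi) = expR (- Lam xi).
Proof. exact: (congr1 (@complex.Re R) (mu_char xi)). Qed.

Lemma integral_sin_stable xi : \int[mu]_u sin (dotv u xi) = 0.
Proof. exact: (congr1 (@complex.Im R) (mu_char xi)). Qed.

(** The link between two forms of the exponent: the spectral one shows homogeneity, the Levy one is
    differentiated under the integral. *)
Lemma stable_exponent_levy (nu : {measure set V -> \bar R}) : stable_law nu mu ->
  forall xi, Lam xi = - \int[nu]_u (cos (dotv u xi) - 1).
Proof.
move=> mu_nu xi; have := mu_nu xi; rewrite mu_char -/(Lam xi).
set z := cintegral nu _ => h.
have e3 := cexp_eq_real h.
have := expR_inj e3 => /eqP; rewrite eqr_oppLR => /eqP ->.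
congr (- _); rewrite /z /cintegral /=.
by apply: eq_Rintegral => u _ /=; ring.
Qed.

(* With a = <u, z>, on 2^k <= |a| < 2^(k+1) the power |a|^q is at most
   64 2^(q (k+1)) (1 - cos (a / (4 2^k))), and the last factor has expectation
   at most C 2^(-k alpha). *)
Lemma moment_dotv_lty (z : V) (q : R) : 0 < q -> q < alpha ->
  (\int[mu]_u (`|dotv u z| `^ q)%:E < +oo)%E.
Proof.
move=> q0 qa.
pose X (u : V) : R := \1_[set u | 1 <= `|dotv u z|] u * `|dotv u z| `^ q.
have mA : measurable [set u : V | 1 <= `|dotv u z|].
  have -> : [set u : V | 1 <= `|dotv u z|] = (fun u => `|dotv u z|) @^-1` `[1, +oo[.
    by apply/seteqP; split => u /=; rewrite in_itv /= andbT.
  rewrite -[X in measurable X]setTI.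
  apply: (measurableT_comp (@normr_measurable R setT) (measurable_dotv z)) => //.
have mX : measurable_fun setT X.
  by apply: measurable_funM; [exact: measurable_indic|exact: measurable_abs_dotv].
have X0 u : 0 <= X u by rewrite mulr_ge0 ?powR_ge0.
have mcos k : measurable_fun setT (fun u : V => 1 - cos (dotv u z / (4 * 2 ^+ k))).
  apply: measurable_funB => //.
  apply: (measurableT_comp (continuous_measurable_fun (@continuous_cos R))).
  by apply: measurable_funM => //; exact: measurable_dotv.
have hX : (\int[mu]_u (X u)%:E < +oo)%E.
  apply: (@integral_lty_geometric _ _ _ _ _ _
    (fun k u => (64 * 2 `^ q * (2 `^ q) ^+ k * (1 - cos (dotv u z / (4 * 2 ^+ k))))%:E)
    (64 * 2 `^ q * (4^-1 `^ alpha * Lam z)) (2 `^ (q - alpha))) => //.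
  - exact/measurable_EFinP.
  - by move=> k; apply/measurable_EFinP; exact: measurable_funM.
  - by move=> u _; rewrite lee_fin.
  - move=> u _; have [u1|u1] := leP 1 `|dotv u z|; last first.
      exists 0%N; rewrite lee_fin /X indicE memNset ?mul0r /=; last by apply/negP; rewrite -ltNge.
      by rewrite mulr_ge0 ?one_sub_cos_ge0 // !mulr_ge0 ?exprn_ge0 ?powR_ge0.
    have [k /andP[k1 k2]] := dyadic_scale u1; exists k.
    rewrite lee_fin /X indicE mem_set //= mul1r.
    have k0 : (0 : R) < 2 ^+ k by exact: exprn_gt0.
    have h : 64^-1 <= 1 - cos (dotv u z / (4 * 2 ^+ k)).
      have -> : cos (dotv u z / (4 * 2 ^+ k)) = cos (`|dotv u z| / (4 * 2 ^+ k)).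
        have [h|h] := leP 0 (dotv u z); first by rewrite (ger0_norm h).
        by rewrite (ltr0_norm h) mulNr cosN.
      have k40 : (0 : R) < 4 * 2 ^+ k by rewrite mulr_gt0.
      apply: one_sub_cos_ge.
        by rewrite ler_pdivlMr //; lra.
      by rewrite ler_pdivrMr //; move: k2; rewrite exprS; lra.
    have h2 : `|dotv u z| `^ q <= 2 `^ q * (2 `^ q) ^+ k.
      rewrite -powR_mulrn ?powR_ge0 // -powRrM -powRD; last by rewrite pnatr_eq0 implybT.
      have -> : q + q * k%:R = k.+1%:R * q by rewrite -natr1; ring.
      rewrite powRrM powR_mulrn //.
      by apply: ge0_ler_powR; rewrite ?nnegrE ?exprn_ge0 ?(ltW q0) ?(ltW k2).
    have p0 : 0 <= 2 `^ q * (2 `^ q) ^+ k by rewrite mulr_ge0 ?exprn_ge0 ?powR_ge0.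
    apply: (le_trans h2).
    set c := 1 - _ in h *.
    have -> : 64 * 2 `^ q * (2 `^ q) ^+ k * c = 2 `^ q * (2 `^ q) ^+ k * (64 * c) by ring.
    by rewrite ler_peMr //; lra.
  - by rewrite !mulr_ge0 ?powR_ge0 ?stable_exponent_ge0.
  - by rewrite powR2_lt1 // subr_lt0.
  - move=> k; have k0 : (0 : R) < 4 * 2 ^+ k by rewrite mulr_gt0 ?exprn_gt0.
    under eq_integral do rewrite EFinM.
    rewrite ge0_integralZl ?lee_fin ?mulr_ge0 ?exprn_ge0 ?powR_ge0 //; last exact/measurable_EFinP.
    have ic : mu.-integrable setT (EFin \o (fun u => cos (dotv u ((4 * 2 ^+ k)^-1 *: z)))).
      apply: (@bounded_integrable _ _ _ _ _ 1) => [|u]; last exact: cos_max.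
      apply: (measurableT_comp (continuous_measurable_fun (@continuous_cos R))).
      exact: measurable_dotv.
    have e : \int[mu]_u (1 - cos (dotv u z / (4 * 2 ^+ k))) =
        1 - expR (- Lam ((4 * 2 ^+ k)^-1 *: z)).
      rewrite -integral_cos_stable.
      under eq_Rintegral do rewrite mulrC -dotvZr.
      rewrite RintegralB //; last exact: finite_measure_integrable_cst.
      by rewrite Rintegral_cst_prob.
    have -> : (\int[mu]_u (1 - cos (dotv u z / (4 * 2 ^+ k)))%:E)%E =
        (1 - expR (- Lam ((4 * 2 ^+ k)^-1 *: z)))%:E.
      rewrite -e /Rintegral fineK //; apply: integrable_fin_num => //.
      apply: (@bounded_integrable _ _ _ _ _ 2) => // u.
      by rewrite ger0_norm ?one_sub_cos_ge0 ?one_sub_cos_le2.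
    rewrite -EFinM lee_fin -!mulrA !ler_wpM2l ?powR_ge0 //.
    have e1 : 1 - expR (- Lam ((4 * 2 ^+ k)^-1 *: z)) <= Lam ((4 * 2 ^+ k)^-1 *: z).
      by have := expR_ge1Dx (- Lam ((4 * 2 ^+ k)^-1 *: z)); lra.
    apply: (le_trans (ler_wpM2l _ e1)); first by rewrite exprn_ge0 ?powR_ge0.
    rewrite stable_exponentZ ger0_norm ?invr_ge0 ?(ltW k0) // invfM.
    rewrite powRM ?invr_ge0 ?exprn_ge0 //.
    have -> : (2 ^+ k)^-1 `^ alpha = (2 `^ (- alpha)) ^+ k.
      rewrite -powR_mulrn ?powR_ge0 // -powRrM -powR_inv1 ?exprn_ge0 // -powRrM.
      by rewrite -powR_mulrn // -powRrM; congr (_ `^ _); ring.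
    rewrite powRD; last by rewrite pnatr_eq0 implybT.
    by rewrite exprMn le_eqVlt; apply/orP; left; apply/eqP; ring.
(* Where |<u, z>| < 1 the power is at most 1, so the moment exceeds the integral of [X] by at most
   the total mass. *)
apply: (@le_lt_trans _ _ (\int[mu]_u (1 + X u)%:E)%E).
  apply: ge0_le_integral => //.
  - by apply/measurable_EFinP; exact: measurable_abs_dotv.
  - by apply/measurable_EFinP; exact: measurable_funD.
  - move=> u _; rewrite lee_fin /X indicE; have [u1|u1] := leP 1 `|dotv u z|.
      by rewrite mem_set //= mul1r lerDr.
    rewrite memNset /=; last by apply/negP; rewrite -ltNge.
    have e1 : 1 `^ q = 1 :> R by rewrite powR1.
    rewrite mul0r addr0 -[leRHS]e1.
    by apply: ge0_ler_powR; rewrite ?nnegrE ?(ltW q0) ?(ltW u1).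
under eq_integral do rewrite EFinD.
rewrite ge0_integralD //; last 2 first.
- by move=> u _; rewrite lee_fin.
- exact/measurable_EFinP.
rewrite lte_add_pinfty // integral_cst // mul1e.
exact: le_lt_trans (probability_le1 mu measurableT) (ltry _).
Qed.

Lemma integrable_dotv (z : V) : mu.-integrable setT (EFin \o (fun u => dotv u z)).
Proof.
apply/integrableP; split; first by apply/measurable_EFinP; exact: measurable_dotv.
have [a1 _] := andP alpha12.
have := moment_dotv_lty z ltr01 a1.
by under eq_integral do rewrite powRr1 //.
Qed.

Lemma integrable_coord i : mu.-integrable setT (EFin \o (fun u : V => u 0 i)).
Proof.
by have := integrable_dotv (delta_mx 0 i); under [X in EFin \o X]eq_fun do rewrite dotv_delta.
Qed.

End characteristic_function.

Section derivatives.
Context {R : realType}.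

Lemma is_derive_cos_affine (a b h : R) :
  is_derive h 1 (fun h : R => cos (a + h * b)) (- sin (a + h * b) * b).
Proof.
have e : is_derive h 1 (fun h : R => a + h * b) b.
  have -> : (fun h : R => a + h * b) = cst a + ( *%R^~ b).
    by [].
  rewrite -[X in is_derive _ _ _ X](add0r b); apply: is_deriveD.
  have := @is_deriveM _ _ id (cst b) h 1 1 0 (is_derive_id _ _) (is_derive_cst _ _ _).
  by rewrite scaler0 add0r [_ *: _]mulr1.
exact: is_derive1_comp.
Qed.

Lemma is_derive_sin_affine (a b h : R) :
  is_derive h 1 (fun h : R => sin (a + h * b)) (cos (a + h * b) * b).
Proof.
have -> : (fun h : R => sin (a + h * b)) = (fun h => cos ((a - pi / 2) + h * b)).
  by apply/funext => t; rewrite -cosBpihalf; congr cos; ring.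
apply: is_derive_eq (is_derive_cos_affine _ _ _) _.
have -> : a - pi / 2 + h * b = (a + h * b) - pi / 2 by ring.
by rewrite sinBpihalf opprK.
Qed.

(** Derivatives are only taken at 0 along coordinate lines, so a bound uniform over |h| < 1 is
    enough. *)
Lemma is_derive_integral0 dT (T : measurableType dT) (m : {measure set T -> \bar R})
    (f df : R -> T -> R) (G : T -> R) :
  (forall h, `|h| < 1 -> m.-integrable setT (EFin \o f h)) ->
  (forall (h : R) y, is_derive h 1 (f ^~ y) (df h y)) ->
  (forall y, 0 <= G y) -> m.-integrable setT (EFin \o G) ->
  (forall h y, `|h| < 1 -> `|df h y| <= G y) ->
  is_derive (0 : R) 1 (fun h => \int[m]_y f h y) (\int[m]_y df 0 y).
Proof.
move=> fi fd G0 iG dfG.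
have I0 : `](-1), 1[%classic (0 : R) by rewrite /= in_itv /= ltrN10 ltr01.
have I1 (h : R) : `](-1), 1[%classic h -> `|h| < 1.
  by rewrite /= in_itv /= ltr_norml.
have dE h y : partial1of2 f h y = df h y.
  by rewrite partial1of2E; exact: derive_val.
have c1 h (Ih : `](-1), 1[%classic h) := fi h (I1 h Ih).
have c2 h y (_ : `](-1), 1[%classic h) (_ : setT y) : derivable (f ^~ y) h 1.
  exact: ex_derive.
have c3 h y (Ih : `](-1), 1[%classic h) (_ : setT y) : `|partial1of2 f h y| <= G y.
  by rewrite dE; apply: dfG; exact: I1.
apply: DeriveDef; first exact: (derivable_under_integral measurableT I0 c1 c2 G0 iG c3).
rewrite -derive1E (differentiation_under_integral measurableT I0 c1 c2 G0 iG c3).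
by apply: eq_Rintegral => y _; exact: dE.
Qed.

End derivatives.

(** * Gradient of the characteristic exponent *)

Section stable_gradient.
Context {R : realType} {d : nat}.
Local Notation V := 'rV[R]_d.
Variables (alpha : R) (nu : {measure set V -> \bar R}) (mu : probability V R)
  (lambda : {finite_measure set V -> \bar R}).
Hypothesis alpha12 : 1 < alpha < 2.
Hypothesis nu_stable : stable_levy_measure alpha nu.
Hypothesis mu_nu : stable_law nu mu.
Hypothesis mu_char : forall xi : V, char_fun mu xi =
  ((expR (- \int[lambda]_(y in usphere) (`|dotv y xi| `^ alpha)))%:C)%C.
Local Notation Lam := (stable_exponent alpha lambda).

(** The partial derivative of [stable_exponent], read off its Levy form; it is also what the
    fractional gradient produces on a character. *)
Definition stable_grad i (xi : V) : R := \int[nu]_u (u 0 i * sin (dotv u xi)).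
Local Notation psi := stable_grad.

Let a0 : 0 < alpha. Proof. by case/andP: alpha12 => h _; exact: lt_trans h. Qed.

Let dotv_shift (u xi : V) (h : R) i :
  dotv u (xi + h *: delta_mx 0 i) = dotv u xi + h * u 0 i.
Proof. by rewrite dotvDr dotvZr dotv_delta. Qed.

Lemma levy_weight_sin (u : V) (z M : R) : 0 <= M -> `|z| <= M * enorm u ->
  `|sin z| * enorm u <= (1 + M) * levy_weight u.
Proof.
move=> M0 zM; rewrite /levy_weight mulrA ler_wpM2r ?enorm_ge0 //.
have s1 := sin_max z; have s2 := le_trans (norm_sin_le z) zM.
have e0 := enorm_ge0 u.
by case: (leP 1 (enorm u)) => h; nra.
Qed.

Let integrable_one_sub_cos xi :
  nu.-integrable setT (EFin \o (fun u : V => 1 - cos (dotv u xi))).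
Proof.
(* The constant 2 covers large jumps, [enorm xi ^+ 2] small ones. *)
pose K := 2 + enorm xi ^+ 2.
have iK : nu.-integrable setT (fun u => (K%:E * (Num.min 1 (enorm u ^+ 2))%:E)%E).
  by apply: integrableZl => //; exact: integrable_min_sqr nu_stable.
apply: (le_integrable measurableT _ _ iK).
  apply/measurable_EFinP; apply: measurable_funB => //.
  apply: (measurableT_comp (continuous_measurable_fun (@continuous_cos R))).
  exact: measurable_dotv.
move=> u _; rewrite /= lee_fin ger0_norm ?one_sub_cos_ge0 //.
rewrite (le_trans _ (ler_norm _)) // /K.
have := one_sub_cos_le2 (dotv u xi); have := one_sub_cos_le (dotv u xi).
have : dotv u xi ^+ 2 <= enorm u ^+ 2 * enorm xi ^+ 2.
  rewrite -exprMn -[leLHS]real_normK ?num_real // ler_pXn2r ?nnegrE ?mulr_ge0 ?enorm_ge0 //.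
  exact: dotv_le_enorm.
have := sqr_ge0 (enorm u); have := sqr_ge0 (enorm xi).
by case: (leP 1 (enorm u ^+ 2)) => h; nra.
Qed.

Lemma integrable_stable_grad i xi :
  nu.-integrable setT (EFin \o (fun u : V => u 0 i * sin (dotv u xi))).
Proof.
have iG : nu.-integrable setT (EFin \o (fun u => (1 + enorm xi) * levy_weight u)).
  have := integrableZl measurableT (1 + enorm xi) (integrable_levy_weight alpha12 nu_stable).
  exact.
apply: (le_integrable measurableT _ _ iG).
  apply/measurable_EFinP; apply: measurable_funM; first exact: measurable_coord.
  apply: (measurableT_comp (continuous_measurable_fun (@continuous_sin R))).
  exact: measurable_dotv.
move=> u _; rewrite /= lee_fin (le_trans _ (ler_norm _)) // normrM.
apply: (@le_trans _ _ (`|sin (dotv u xi)| * enorm u)).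
  by rewrite mulrC ler_wpM2l // coord_le_enorm.
by apply: levy_weight_sin; rewrite ?enorm_ge0 // mulrC dotv_le_enorm.
Qed.

(** The Levy form is differentiated under the integral. For |h| < 1 the frequency has norm at most
    [enorm xi + 1], which gives a multiple of [levy_weight] as common majorant. *)
Lemma is_derive_stable_exponent xi i :
  is_derive (0 : R) 1 (fun h => Lam (xi + h *: delta_mx 0 i)) (psi i xi).
Proof.
have -> : (fun h => Lam (xi + h *: delta_mx 0 i)) =
    fun h => \int[nu]_u (1 - cos (dotv u xi + h * u 0 i)).
  apply/funext => h; rewrite (stable_exponent_levy mu_char mu_nu).
  have := RintegralZl (-1) measurableT (integrable_one_sub_cos (xi + h *: delta_mx 0 i)).
  rewrite mulN1r => e.
  transitivity (\int[nu]_u (1 - cos (dotv u (xi + h *: delta_mx 0 i)))).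
    rewrite -[RHS]opprK -e; congr (- _); apply: eq_Rintegral => u _; ring.
  by apply: eq_Rintegral => u _; rewrite dotv_shift.
have -> : psi i xi = \int[nu]_u (u 0 i * sin (dotv u xi + 0 * u 0 i)).
  by apply: eq_Rintegral => u _; rewrite mul0r addr0.
apply: (is_derive_integral0 (df := fun h (u : V) => u 0 i * sin (dotv u xi + h * u 0 i))
  (G := fun u => (1 + (enorm xi + 1)) * levy_weight u)).
- move=> h _; have := integrable_one_sub_cos (xi + h *: delta_mx 0 i).
  by apply: eq_integrable => // u _ /=; rewrite dotv_shift.
- move=> h u.
  have -> : (fun h : R => 1 - cos (dotv u xi + h * u 0 i)) =
      cst 1 - (fun h : R => cos (dotv u xi + h * u 0 i)) by [].
  have e := is_deriveB (is_derive_cst (1 : R) h 1) (is_derive_cos_affine (dotv u xi) (u 0 i) h).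
  by apply: is_derive_eq e _; rewrite sub0r mulNr opprK mulrC.
- by move=> u; rewrite mulr_ge0 ?levy_weight_ge0 // !addr_ge0 ?enorm_ge0.
- exact: (integrableZl measurableT (1 + (enorm xi + 1)) (integrable_levy_weight alpha12 nu_stable)).
- move=> h u h1; rewrite normrM.
  apply: (@le_trans _ _ (`|sin (dotv u xi + h * u 0 i)| * enorm u)).
    by rewrite mulrC ler_wpM2l // coord_le_enorm.
  apply: levy_weight_sin; first by rewrite addr_ge0 ?enorm_ge0.
  rewrite (le_trans (ler_normD _ _)) // mulrDl mul1r lerD //.
    by rewrite mulrC dotv_le_enorm.
  rewrite normrM -[leRHS]mul1r ler_pM //; first exact: ltW.
  exact: coord_le_enorm.
Qed.

(** The derivative of a function homogeneous of degree alpha is homogeneous of degree alpha - 1: the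
    same directional derivative at [c *: xi] is computed directly and by factoring out [c]. *)
Lemma stable_gradZ i (c : R) xi : 0 < c ->
  psi i (c *: xi) = c `^ (alpha - 1) * psi i xi.
Proof.
move=> c0.
have h1 := is_derive_stable_exponent (c *: xi) i.
have e : is_derive (0 : R) 1 (fun h : R => h * c^-1) c^-1.
  have := @is_deriveM _ _ id (cst c^-1) 0 1 1 0 (is_derive_id _ _) (is_derive_cst _ _ _).
  by rewrite scaler0 add0r [_ *: _]mulr1.
have h2 : is_derive (0 : R) 1 (fun h => Lam (xi + (h * c^-1) *: delta_mx 0 i)) (psi i xi * c^-1).
  apply: (@is_derive1_comp _ (fun h => Lam (xi + h *: delta_mx 0 i)) (fun h => h * c^-1)) => //.
  by rewrite mul0r; exact: is_derive_stable_exponent.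
have h3 : is_derive (0 : R) 1 (fun h => Lam (c *: xi + h *: delta_mx 0 i))
    (c `^ alpha * (psi i xi * c^-1)).
  have -> : (fun h => Lam (c *: xi + h *: delta_mx 0 i)) =
      c `^ alpha \*: (fun h => Lam (xi + (h * c^-1) *: delta_mx 0 i)).
    apply/funext => h /=; rewrite -[c in X in _ = X `^ _ *: _]ger0_norm ?(ltW c0) //.
    rewrite [RHS]/GRing.scale /= -(stable_exponentZ lambda alpha12).
    congr (stable_exponent _ _ _); rewrite scalerDr scalerA; congr (_ + _ *: _).
    by rewrite mulrC divfK // gt_eqF.
  exact: is_deriveZ.
rewrite -(@derive_val _ _ _ _ _ _ _ h1) (@derive_val _ _ _ _ _ _ _ h3).
have -> : c `^ (alpha - 1) = c `^ alpha / c `^ 1.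
  by rewrite powRB // (gt_eqF c0) implybT.
rewrite powRr1 ?(ltW c0) //.
by rewrite mulrA mulrAC.
Qed.

Let cos_integrable xi th :
  mu.-integrable setT (EFin \o (fun u => cos (dotv u xi + th))).
Proof.
apply: (@bounded_integrable _ _ _ _ _ 1) => [|x]; last exact: cos_max.
exact: (tcl_measurable (tcl_cos xi th)).
Qed.

Let sin_integrable xi th :
  mu.-integrable setT (EFin \o (fun u => sin (dotv u xi + th))).
Proof.
apply: (@bounded_integrable _ _ _ _ _ 1) => [|x]; last exact: sin_max.
exact: (tcl_measurable (tcl_sin xi th)).
Qed.

Lemma integrable_coordM i (g : V -> R) (M : R) : measurable_fun setT g ->
  (forall u : V, `|g u| <= M) ->
  mu.-integrable setT (EFin \o (fun u : V => u 0 i * g u)).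
Proof.
move=> mg gM; have ic := integrable_coord alpha12 mu_char i.
have M0 : 0 <= M by exact: le_trans (normr_ge0 _) (gM 0).
have iM := integrableZl measurableT M ic.
apply: (le_integrable measurableT _ _ iM).
  by apply/measurable_EFinP; apply: measurable_funM => //; exact: measurable_coord.
by move=> u _; rewrite /= lee_fin !normrM mulrC ler_wpM2r // (le_trans (gM u)) ?ler_norm.
Qed.

(** Two computations of the derivative at h = 0 of the characteristic function along
    [xi + h *: delta_mx 0 i], one through the exponent and one under the integral. *)
Lemma integral_coord_sin i xi :
  \int[mu]_u (u 0 i * sin (dotv u xi)) = expR (- Lam xi) * psi i xi.
Proof.
have h1 : is_derive (0 : R) 1 (fun h => expR (- Lam (xi + h *: delta_mx 0 i)))
    (expR (- Lam xi) * - psi i xi).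
  have := is_derive_stable_exponent xi i => e.
  apply: (@is_derive1_comp _ expR (fun h => - Lam (xi + h *: delta_mx 0 i))).
  rewrite scale0r addr0; exact: is_derive_expR.
have h2 : is_derive (0 : R) 1 (fun h => \int[mu]_u cos (dotv u xi + h * u 0 i))
    (\int[mu]_u (- sin (dotv u xi + 0 * u 0 i) * u 0 i)).
  apply: (is_derive_integral0 (df := fun h (u : V) => - sin (dotv u xi + h * u 0 i) * u 0 i)
    (G := fun u => `|u 0 i|)).
  - move=> h _; have := cos_integrable (xi + h *: delta_mx 0 i) 0.
    by apply: eq_integrable => // u _ /=; rewrite dotv_shift addr0.
  - by move=> h u; exact: is_derive_cos_affine.
  - by [].
  - have := integrable_abse (integrable_coord alpha12 mu_char i); exact.
  - by move=> h u _; rewrite normrM normrN ler_piMl // sin_max.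
have e : (fun h => \int[mu]_u cos (dotv u xi + h * u 0 i)) =
    fun h => expR (- Lam (xi + h *: delta_mx 0 i)).
  apply/funext => h; rewrite -(integral_cos_stable mu_char).
  by apply: eq_Rintegral => u _; rewrite dotv_shift.
rewrite e in h2.
have := @derive_val _ _ _ _ _ _ _ h1; rewrite (@derive_val _ _ _ _ _ _ _ h2) => {}e.
have i1 := integrable_coordM i (tcl_measurable (tcl_sin xi 0)) (fun u => sin_max _).
have := RintegralZl (-1) measurableT i1; rewrite mulN1r => e2.
rewrite -[RHS]opprK -mulrN -e -[LHS]opprK; congr (- _).
under [X in - X]eq_Rintegral do rewrite -[dotv _ _]addr0.
rewrite -e2; apply: eq_Rintegral => u _; rewrite mul0r; ring.
Qed.

Lemma integral_coord_cos i xi : \int[mu]_u (u 0 i * cos (dotv u xi)) = 0.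
Proof.
have h2 : is_derive (0 : R) 1 (fun h => \int[mu]_u sin (dotv u xi + h * u 0 i))
    (\int[mu]_u (cos (dotv u xi + 0 * u 0 i) * u 0 i)).
  apply: (is_derive_integral0 (df := fun h (u : V) => cos (dotv u xi + h * u 0 i) * u 0 i)
    (G := fun u => `|u 0 i|)).
  - move=> h _; have := sin_integrable (xi + h *: delta_mx 0 i) 0.
    by apply: eq_integrable => // u _ /=; rewrite dotv_shift addr0.
  - by move=> h u; exact: is_derive_sin_affine.
  - by [].
  - have := integrable_abse (integrable_coord alpha12 mu_char i); exact.
  - by move=> h u _; rewrite normrM ler_piMl // cos_max.
have e : (fun h => \int[mu]_u sin (dotv u xi + h * u 0 i)) = cst 0.
  apply/funext => h; rewrite -[RHS](integral_sin_stable mu_char (xi + h *: delta_mx 0 i)).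
  by apply: eq_Rintegral => u _; rewrite dotv_shift.
rewrite e in h2.
have := @derive_val _ _ _ _ _ _ _ h2; rewrite derive_cst => {}e.
by rewrite [RHS]e; apply: eq_Rintegral => u _; rewrite mul0r addr0 mulrC.
Qed.

End stable_gradient.

(** * The Ornstein-Uhlenbeck semigroup *)

Section bounded_fubini.
Context {R : realType} d1 (T1 : measurableType d1) d2 (T2 : measurableType d2)
  (m1 : probability T1 R) (m2 : probability T2 R).

Lemma integral_le_cst dT (T : measurableType dT) (m : probability T R)
    (h : T -> \bar R) (M : R) : measurable_fun setT h ->
  (forall x, 0 <= h x)%E -> (forall x, h x <= M%:E)%E ->
  (\int[m]_x h x <= M%:E)%E.
Proof.
move=> mh h0 hM; apply: (@le_trans _ _ (\int[m]_x (cst M%:E) x)%E).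
  exact: ge0_le_integral.
have -> : (\int[m]_x (cst M%:E) x = M%:E * m setT)%E by exact: integral_cst.
by rewrite probability_setT mule1.
Qed.

Lemma integrable_prod_bounded (f : T1 * T2 -> R) (M : R) :
  measurable_fun setT f -> (forall z, `|f z| <= M) ->
  (m1 \x m2)%E.-integrable setT (EFin \o f).
Proof.
move=> mf fM.
have mf' : measurable_fun setT (EFin \o f) by exact/measurable_EFinP.
have maf : measurable_fun setT (abse \o (EFin \o f)) by exact: measurableT_comp.
apply: (proj2 (@integrable12ltyP _ _ _ _ _ m1 m2 _ mf')); apply: le_lt_trans (ltry M).
apply: integral_le_cst.
- have h := @measurable_fun_fubini_tonelli_F _ _ _ _ _ m2 _ maf (fun z => abse_ge0 _).
  exact: h.
- by move=> x; exact: integral_ge0.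
- move=> x; apply: integral_le_cst => // [|y]; last by rewrite lee_fin.
  exact: (measurableT_comp maf (measurable_pair1 x)).
Qed.

Lemma measurable_Rintegral_snd (f : T1 * T2 -> R) (M : R) :
  measurable_fun setT f -> (forall z, `|f z| <= M) ->
  measurable_fun setT (fun x => \int[m2]_y f (x, y)).
Proof.
move=> mf fM.
have if_ := integrable_prod_bounded mf fM.
have h := @measurable_fubini_F _ _ _ _ _ m1 m2 _ if_.
exact: (measurableT_comp (@fine_measurable R setT measurableT) h).
Qed.

Lemma Rfubini_bounded (f : T1 * T2 -> R) (M : R) :
  measurable_fun setT f -> (forall z, `|f z| <= M) ->
  \int[(m1 \x m2)%E]_z f z = \int[m1]_x \int[m2]_y f (x, y).
Proof.
move=> mf fM.
have if_ := integrable_prod_bounded mf fM.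
rewrite {1}/Rintegral -integral12_prod_meas1 //; congr fine.
apply: eq_integral => x _; rewrite /fubini_F /Rintegral fineK //.
apply: integrable_fin_num => //; apply: (@bounded_integrable _ _ _ _ _ M) => //.
exact: (measurableT_comp mf (measurable_pair1 x)).
Qed.

End bounded_fubini.

Lemma Lnorm_cst1_prob dT (T : measurableType dT) (R : realType)
  (m : probability T R) (r : R) : ('N[m]_r%:E [EFin \o cst 1%R] = 1)%E.
Proof.
transitivity (m setT `^ r^-1)%E; first exact: Lnorm_cst1.
by rewrite probability_setT poweR1r.
Qed.

Section stable_semigroup.
Context {R : realType} {d : nat}.
Local Notation V := 'rV[R]_d.
Variables (alpha : R) (mu : probability V R)
  (lambda : {finite_measure set V -> \bar R}).
Hypothesis alpha12 : 1 < alpha < 2.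
Hypothesis mu_char : forall xi : V, char_fun mu xi =
  ((expR (- \int[lambda]_(y in usphere) (`|dotv y xi| `^ alpha)))%:C)%C.
Local Notation Lam := (stable_exponent alpha lambda).
Local Notation OU := (OU alpha mu).

Let a0 : 0 < alpha. Proof. by case/andP: alpha12 => h _; exact: lt_trans h. Qed.

Lemma integral_cos_shift xi (th : R) :
  \int[mu]_u cos (dotv u xi + th) = expR (- Lam xi) * cos th.
Proof.
have bi (f : V -> R) : tcl f -> mu.-integrable setT (EFin \o f).
  move=> tf; have [M [bM _]] := tcl_bounded_lipschitz tf.
  exact: bounded_integrable (tcl_measurable tf) bM.
have ic := bi _ (tcl_cos xi 0); have isn := bi _ (tcl_sin xi 0).
under eq_Rintegral do rewrite cosD -[dotv _ _]addr0 mulrC [X in _ - X]mulrC.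
rewrite RintegralB //; last 2 first.
- exact: (integrableZl measurableT (cos th) ic).
- exact: (integrableZl measurableT (sin th) isn).
rewrite !RintegralZl //.
under eq_Rintegral do rewrite addr0.
under [X in _ - _ * X]eq_Rintegral do rewrite addr0.
by rewrite (integral_cos_stable mu_char) (integral_sin_stable mu_char) mulr0 subr0 mulrC.
Qed.

Lemma integral_sin_shift xi (th : R) :
  \int[mu]_u sin (dotv u xi + th) = expR (- Lam xi) * sin th.
Proof.
rewrite -cosBpihalf -integral_cos_shift.
by apply: eq_Rintegral => u _; rewrite addrA cosBpihalf.
Qed.

Section stable_sum.
Variables a b : R.
Hypothesis a_ge0 : 0 <= a.
Hypothesis b_ge0 : 0 <= b.
Hypothesis ab1 : a `^ alpha + b `^ alpha = 1.

Let comb (z : V * V) : V := a *: z.1 + b *: z.2.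

Let mcomb : measurable_fun setT comb.
Proof. exact: measurable_lincomb. Qed.

Let dot_comb z xi : dotv (comb z) xi = dotv z.2 (b *: xi) + dotv z.1 (a *: xi).
Proof. by rewrite dotvDl !dotvZl !dotvZr addrC. Qed.

Let Lam_ab xi : Lam (a *: xi) + Lam (b *: xi) = Lam xi.
Proof.
by rewrite !(stable_exponentZ lambda alpha12) !ger0_norm // -mulrDl ab1 mul1r.
Qed.

Let expR_aux (x y z : R) : x + y = z ->
  expR (- y) * (expR (- x) * cos 0) = expR (- z).
Proof. by move=> <-; rewrite cos0 mulr1 -expRD opprD addrC. Qed.

Let sin_aux (x y : R) : x * (y * sin 0) = 0.
Proof. by rewrite sin0 !mulr0. Qed.

Let eqcos xi : \int[(mu \x mu)%E]_z cos (dotv (comb z) xi) = \int[mu]_u cos (dotv u xi).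
Proof.
rewrite [RHS](integral_cos_stable mu_char).
rewrite (@Rfubini_bounded _ _ _ _ _ mu mu _ 1); last first.
- by move=> z; exact: cos_max.
- apply: (measurableT_comp (continuous_measurable_fun (@continuous_cos R))).
  exact: (measurableT_comp (measurable_dotv xi) mcomb).
under eq_Rintegral do under eq_Rintegral do rewrite dot_comb /=.
under eq_Rintegral do rewrite integral_cos_shift -[dotv _ _]addr0.
rewrite RintegralZl //; last first.
  apply: (@bounded_integrable _ _ _ _ _ 1) => [|x]; last exact: cos_max.
  exact: (tcl_measurable (tcl_cos (a *: xi) 0)).
transitivity (expR (- Lam (b *: xi)) * (expR (- Lam (a *: xi)) * cos 0)).
  congr (_ * _); exact: integral_cos_shift.
exact: (expR_aux (Lam_ab xi)).
Qed.

Let eqsin xi : \int[(mu \x mu)%E]_z sin (dotv (comb z) xi) = \int[mu]_u sin (dotv u xi).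
Proof.
rewrite [RHS](integral_sin_stable mu_char).
rewrite (@Rfubini_bounded _ _ _ _ _ mu mu _ 1); last first.
- by move=> z; exact: sin_max.
- apply: (measurableT_comp (continuous_measurable_fun (@continuous_sin R))).
  exact: (measurableT_comp (measurable_dotv xi) mcomb).
under eq_Rintegral do under eq_Rintegral do rewrite dot_comb /=.
under eq_Rintegral do rewrite integral_sin_shift -[dotv _ _]addr0.
rewrite RintegralZl //; last first.
  apply: (@bounded_integrable _ _ _ _ _ 1) => [|x]; last exact: sin_max.
  exact: (tcl_measurable (tcl_sin (a *: xi) 0)).
transitivity (expR (- Lam (b *: xi)) * (expR (- Lam (a *: xi)) * sin 0)).
  congr (_ * _); exact: integral_sin_shift.
exact: sin_aux.
Qed.

(** Stability of the law: by homogeneity the exponents of a X and b X', with X and X' independent,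
    add up to that of X when a^alpha + b^alpha = 1. *)
Lemma stable_sum_ge0_integral (h : V -> \bar R) : measurable_fun setT h ->
  (forall x, 0 <= h x)%E ->
  (\int[mu]_x \int[mu]_y h (a *: x + b *: y)%R = \int[mu]_u h u)%E.
Proof.
move=> mh h0.
rewrite -(@eq_law_ge0_integral _ _ _ _ (mu \x mu)%E comb _ _ mu id mcomb
  (@measurable_id _ _ setT) eqcos eqsin h mh h0).
by rewrite fubini_tonelli1 //=; exact: (measurableT_comp mh mcomb).
Qed.

Lemma stable_sum_Rintegral (h : V -> R) (M : R) : measurable_fun setT h ->
  (forall x, `|h x| <= M) ->
  \int[mu]_x \int[mu]_y h (a *: x + b *: y) = \int[mu]_u h u.
Proof.
move=> mh hM.
rewrite -(@eq_law_Rintegral _ _ _ _ (mu \x mu)%E comb _ _ mu id mcomb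
  (@measurable_id _ _ setT) eqcos eqsin h M mh hM).
by rewrite (@Rfubini_bounded _ _ _ _ _ mu mu _ M) //; exact: (measurableT_comp mh mcomb).
Qed.

End stable_sum.

Definition ou_scale (t : R) : R := (1 - expR (- (alpha * t))) `^ alpha^-1.

Lemma ou_scale_ge0 t : 0 <= ou_scale t. Proof. exact: powR_ge0. Qed.

Lemma expRN_powR t : expR (- t) `^ alpha = expR (- (alpha * t)).
Proof. by rewrite -expRM mulNr mulrC. Qed.

Lemma ou_scale_powR t : 0 <= t -> ou_scale t `^ alpha = 1 - expR (- (alpha * t)).
Proof.
move=> t0; rewrite /ou_scale -powRrM mulVf ?gt_eqF // powRr1 //.
by rewrite subr_ge0 expR_le1 oppr_le0 mulr_ge0 // ltW.
Qed.

Lemma ou_scale_gt0 t : 0 < t -> 0 < ou_scale t.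
Proof. by move=> t0; rewrite powR_gt0 // subr_gt0 expR_lt1 oppr_lt0 mulr_gt0. Qed.

Lemma ou_scale_sum t : 0 <= t -> expR (- t) `^ alpha + ou_scale t `^ alpha = 1.
Proof. by move=> t0; rewrite expRN_powR ou_scale_powR //; ring. Qed.

Lemma OU_E t (f : V -> R) x :
  OU t f x = \int[mu]_y f (expR (- t) *: x + ou_scale t *: y).
Proof. by []. Qed.

Lemma measurable_mehler t (f : V -> R) x : measurable_fun setT f ->
  measurable_fun setT (fun y : V => f (expR (- t) *: x + ou_scale t *: y)).
Proof. by move=> mf; exact: (measurableT_comp mf (measurable_affine _ _)). Qed.

Lemma OU_bounded t (f : V -> R) (M : R) x : measurable_fun setT f ->
  (forall y, `|f y| <= M) -> `|OU t f x| <= M.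
Proof.
move=> mf fM.
have mfx := measurable_mehler t x mf.
have i1 : mu.-integrable setT (EFin \o (fun y : V => f (expR (- t) *: x + ou_scale t *: y))).
  by apply: (bounded_integrable mu mfx) => y; exact: fM.
rewrite OU_E (le_trans (le_normr_Rintegral measurableT i1)) //.
rewrite -[leRHS](Rintegral_cst_prob mu); apply: le_Rintegral => //.
- exact: (integrable_abse i1).
- exact: finite_measure_integrable_cst.
Qed.

Lemma OU_measurable t (f : V -> R) (M : R) : measurable_fun setT f ->
  (forall y, `|f y| <= M) -> measurable_fun setT (OU t f).
Proof.
move=> mf fM.
apply: (@measurable_Rintegral_snd _ _ _ _ _ mu mu
  (fun z => f (expR (- t) *: z.1 + ou_scale t *: z.2)) M) => //.
exact: (measurableT_comp mf (measurable_lincomb _ _)).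
Qed.

Lemma mehler_invariant t (h : V -> \bar R) : 0 <= t -> measurable_fun setT h ->
  (forall x, 0 <= h x)%E ->
  (\int[mu]_x \int[mu]_y h (expR (- t) *: x + ou_scale t *: y)%R = \int[mu]_u h u)%E.
Proof.
move=> t0 mh h0.
exact: (stable_sum_ge0_integral (expR_ge0 _) (ou_scale_ge0 t) (ou_scale_sum t0) mh h0).
Qed.

(** Two steps bring the noises e^-t c_s y and c_t z. Divided by c_(s+t), their coefficients [a] and
    [b] satisfy a^alpha + b^alpha = 1, so stability merges them into a single noise. *)
Lemma OU_semigroup s t (f : V -> R) (M : R) x : 0 < s -> 0 < t -> measurable_fun setT f ->
  (forall y, `|f y| <= M) -> OU s (OU t f) x = OU (s + t) f x.
Proof.
move=> s0 t0 mf fM; have st0 : 0 < s + t by exact: addr_gt0.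
have c0 := ou_scale_gt0 st0.
pose h (w : V) := f (expR (- (s + t)) *: x + ou_scale (s + t) *: w).
pose a := expR (- t) * ou_scale s / ou_scale (s + t).
pose b := ou_scale t / ou_scale (s + t).
have a0' : 0 <= a by rewrite divr_ge0 ?mulr_ge0 ?expR_ge0 ?ou_scale_ge0.
have b0' : 0 <= b by rewrite divr_ge0 ?ou_scale_ge0.
have ab : a `^ alpha + b `^ alpha = 1.
  have inv : (ou_scale (s + t))^-1 `^ alpha = (1 - expR (- (alpha * (s + t))))^-1.
    rewrite -powR_inv1 ?ou_scale_ge0 // -powRrM mulN1r powRN.
    by congr (_ ^-1); exact: ou_scale_powR (ltW st0).
  have -> : a `^ alpha = expR (- (alpha * t)) * (1 - expR (- (alpha * s))) /
      (1 - expR (- (alpha * (s + t)))).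
    rewrite !powRM ?mulr_ge0 ?invr_ge0 ?expR_ge0 ?ou_scale_ge0 //.
    congr (_ * _ * _); [exact: expRN_powR|exact: ou_scale_powR (ltW s0)|exact: inv].
  have -> : b `^ alpha = (1 - expR (- (alpha * t))) / (1 - expR (- (alpha * (s + t)))).
    rewrite powRM ?invr_ge0 ?ou_scale_ge0 //.
    by congr (_ * _); [exact: ou_scale_powR (ltW t0)|exact: inv].
  have e : expR (- (alpha * (s + t))) = expR (- (alpha * s)) * expR (- (alpha * t)).
    by rewrite mulrDr opprD expRD.
  have : 1 - expR (- (alpha * (s + t))) != 0.
    by rewrite gt_eqF // subr_gt0 expR_lt1 oppr_lt0 mulr_gt0.
  rewrite e; move: (expR (- (alpha * t))) (expR (- (alpha * s))) => u v n0.
  by field.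
rewrite [RHS]OU_E -(stable_sum_Rintegral a0' b0' ab (measurable_mehler (s + t) x mf)
  (fun y => fM _)).
rewrite OU_E; apply: eq_Rintegral => y _; rewrite OU_E.
apply: eq_Rintegral => z _; congr f.
apply/rowP => j; rewrite !mxE opprD expRD /a /b.
move: c0; move: (ou_scale (s + t)) (ou_scale s) (ou_scale t) (expR (- s))
  (expR (- t)) => c1 c2 c3 e1 e2 c0.
by field; rewrite gt_eqF.
Qed.

(** Jensen's inequality, obtained from Hoelder's inequality against the constant 1, which has norm 1
    under a probability. *)
Lemma le_Lnorm_Rintegral (f : V -> R) (q M : R) : 1 < q -> measurable_fun setT f ->
  (forall x, `|f x| <= M) ->
  ((`|\int[mu]_x f x| `^ q)%:E <= \int[mu]_x (`|f x| `^ q)%:E)%E.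
Proof.
move=> q1 mf fM; have q0 : 0 < q by exact: lt_trans q1.
have i1 := bounded_integrable mu mf fM.
have p0 : 0 < q / (q - 1) by rewrite divr_gt0 // subr_gt0.
have qp : q^-1 + (q / (q - 1))^-1 = 1.
  by rewrite invf_div; field; rewrite gt_eqF.
have h := hoelder mu mf (@measurable_cst _ _ _ _ setT (1 : R)) q0 p0 qp.
rewrite Lnorm1 in h.
have e1 : ((`|\int[mu]_x f x|)%:E <= 'N[mu]_q%:E [EFin \o f])%E.
  apply: (@le_trans _ _ ('N[mu]_q%:E [EFin \o f] *
    'N[mu]_(q / (q - 1))%:E [EFin \o cst 1%R])%E).
    apply: le_trans h.
    rewrite (le_trans _ (le_abse_integral mu measurableT _)) //; last first.
    - by apply/measurable_EFinP; apply: measurable_funM.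
    rewrite /Rintegral -abse_EFin fineK.
      by under [X in (_ <= `|X|)%E]eq_integral do rewrite /= mulr1.
    exact: integrable_fin_num.
  by rewrite Lnorm_cst1_prob mule1.
have e2 : ((`|\int[mu]_x f x|%:E) `^ q <= 'N[mu]_q%:E [EFin \o f] `^ q)%E.
  apply: gt0_ler_poweR => //; first exact: ltW.
    by rewrite in_itv /= leey lee_fin normr_ge0.
  by rewrite in_itv /= leey Lnorm_ge0.
by rewrite poweR_EFin Lnorm_pow in e2.
Qed.

(** Jensen's inequality at each point, then invariance of mu. Used at the conjugate exponent, it
    makes the dual semigroup a contraction. *)
Lemma OU_Lnorm_le t (f : V -> R) (q M : R) : 0 <= t -> 1 < q -> measurable_fun setT f ->
  (forall y, `|f y| <= M) ->
  ('N[mu]_q%:E [EFin \o OU t f] <= 'N[mu]_q%:E [EFin \o f])%E.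
Proof.
move=> t0 q1 mf fM; have q0 : 0 < q by exact: lt_trans q1.
have mq := measurable_normrX_powR q mf.
have h : (\int[mu]_x (`|OU t f x| `^ q)%:E <= \int[mu]_x (`|f x| `^ q)%:E)%E.
  rewrite -(@mehler_invariant t (fun u => (`|f u| `^ q)%:E)) //; last first.
    exact/measurable_EFinP.
  apply: ge0_le_integral => //.
  - by apply/measurable_EFinP; apply: measurable_normrX_powR; exact: OU_measurable fM.
  - have mz : measurable_fun setT (fun z : V * V =>
        (`|f (expR (- t) *: z.1 + ou_scale t *: z.2)| `^ q)%:E).
      apply/measurable_EFinP; exact: (measurableT_comp mq (measurable_lincomb _ _)).
    exact: (@measurable_fun_fubini_tonelli_F _ _ _ _ _ mu _ mz).
  - move=> x _; rewrite OU_E.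
    by apply: (@le_Lnorm_Rintegral _ _ M) => //; exact: measurable_mehler.
rewrite -[leRHS]mul1e; apply: le_Lnorm_integral => //.
by rewrite powR1 mul1e.
Qed.

End stable_semigroup.

(** * Fractional gradient of the semigroup *)

Section fractional_gradient_semigroup.
Context {R : realType} {d : nat}.
Local Notation V := 'rV[R]_d.
Variables (alpha : R) (nu : {measure set V -> \bar R}) (mu : probability V R)
  (lambda : {finite_measure set V -> \bar R}).
Hypothesis alpha12 : 1 < alpha < 2.
Hypothesis nu_stable : stable_levy_measure alpha nu.
Hypothesis mu_nu : stable_law nu mu.
Hypothesis mu_char : forall xi : V, char_fun mu xi =
  ((expR (- \int[lambda]_(y in usphere) (`|dotv y xi| `^ alpha)))%:C)%C.
Local Notation Lam := (stable_exponent alpha lambda).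
Local Notation OU := (OU alpha mu).
Local Notation c_ := (ou_scale alpha).
Local Notation psi := (stable_grad nu).

Lemma levy_weight_bound (u : V) (z w M : R) : 0 <= M -> `|z| <= 2 * M ->
  `|z| <= 2 * M * enorm u -> `|w| <= enorm u -> `|z * w| <= 2 * M * levy_weight u.
Proof.
move=> M0 z1 z2 wu; rewrite normrM /levy_weight mulrA.
apply: ler_pM => //.
by case: (leP 1 (enorm u)) => h; rewrite ?mulr1.
Qed.

Lemma integrable_increment (g : V -> R) (h : V -> V) (M : R) i x :
  measurable_fun setT g -> measurable_fun setT h ->
  (forall y, `|g y| <= M) -> (forall y z, `|g y - g z| <= M * enorm (y - z)) ->
  (forall u, enorm (h u - x) <= 2 * enorm u) ->
  nu.-integrable setT (EFin \o (fun u : V => (g (h u) - g x) * u 0 i)).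
Proof.
move=> mg mh gM gL hx.
have M0 : 0 <= M by exact: le_trans (normr_ge0 _) (gM 0).
have iM := integrableZl measurableT (2 * M) (integrable_levy_weight alpha12 nu_stable).
apply: (le_integrable measurableT _ _ iM).
  apply/measurable_EFinP; apply: measurable_funM; last exact: measurable_coord.
  apply: measurable_funB => //; exact: (measurableT_comp mg mh).
move=> u _; rewrite /= lee_fin [leRHS]ger0_norm; last first.
  by rewrite mulr_ge0 ?levy_weight_ge0 // mulr_ge0.
apply: levy_weight_bound => //; last exact: coord_le_enorm.
  by rewrite (le_trans (ler_normB _ _)) // mulr2n mulrDl mul1r lerD.
by rewrite (le_trans (gL _ _)) // -mulrA mulrCA ler_wpM2l.
Qed.

(** Each one-sided integral converges absolutely thanks to [levy_weight], and the value [g x]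
    cancels in their difference. *)
Lemma frac_grad_symE (g : V -> R) (M : R) x i : measurable_fun setT g ->
  (forall y, `|g y| <= M) -> (forall y z, `|g y - g z| <= M * enorm (y - z)) ->
  frac_grad_sym nu g x 0 i =
    2^-1 * \int[nu]_u ((g (x + u) - g (x - u)) * u 0 i).
Proof.
move=> mg gM gL; rewrite !mxE; congr (_ * _).
have m1 (a : R) : measurable_fun setT (fun u : V => x + a *: u).
  have := measurable_affine x a; exact.
rewrite -RintegralB //.
- by apply: eq_Rintegral => u _; ring.
- apply: (@integrable_increment _ (fun u => x + u) M) => //.
    by have := m1 1; under eq_fun do rewrite scale1r.
  by move=> u; rewrite addrAC subrr add0r ler_peMl ?enorm_ge0 // ler1n.
- apply: (@integrable_increment _ (fun u => x - u) M) => //.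
    by have := m1 (-1); under eq_fun do rewrite scaleN1r.
  by move=> u; rewrite addrAC subrr add0r enormN ler_peMl ?enorm_ge0 // ler1n.
Qed.

Lemma integrable_increment2 (g : V -> R) (M : R) i x : measurable_fun setT g ->
  (forall y, `|g y| <= M) -> (forall y z, `|g y - g z| <= M * enorm (y - z)) ->
  nu.-integrable setT (EFin \o (fun u : V => (g (x + u) - g (x - u)) * u 0 i)).
Proof.
move=> mg gM gL.
have m1 (a : R) : measurable_fun setT (fun u : V => x + a *: u).
  have := measurable_affine x a; exact.
have i1 : nu.-integrable setT (EFin \o (fun u : V => (g (x + u) - g x) * u 0 i)).
  apply: (@integrable_increment _ (fun u => x + u) M) => //.
    by have := m1 1; under eq_fun do rewrite scale1r.
  by move=> u; rewrite addrAC subrr add0r ler_peMl ?enorm_ge0 // ler1n.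
have i2 : nu.-integrable setT (EFin \o (fun u : V => (g (x - u) - g x) * u 0 i)).
  apply: (@integrable_increment _ (fun u => x - u) M) => //.
    by have := m1 (-1); under eq_fun do rewrite scaleN1r.
  by move=> u; rewrite addrAC subrr add0r enormN ler_peMl ?enorm_ge0 // ler1n.
apply: eq_integrable (integrableB measurableT i1 i2) => // u _ /=.
by rewrite -EFinB; congr EFin; ring.
Qed.

Lemma increment2_bound (g : V -> R) (M : R) i x (u : V) :
  (forall y, `|g y| <= M) -> (forall y z, `|g y - g z| <= M * enorm (y - z)) ->
  `|(g (x + u) - g (x - u)) * u 0 i| <= 2 * M * levy_weight u.
Proof.
move=> gM gL; have M0 : 0 <= M by exact: le_trans (normr_ge0 _) (gM 0).
apply: levy_weight_bound => //; last exact: coord_le_enorm.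
  by rewrite (le_trans (ler_normB _ _)) // mulr2n mulrDl mul1r lerD.
rewrite (le_trans (gL _ _)) // [X in enorm X](_ : _ = 2 *: u); last first.
  by apply/rowP => j; rewrite !mxE; ring.
by rewrite enormZ ger0_norm // -mulrA mulrCA.
Qed.

Lemma OU_lipschitz t (f : V -> R) (M : R) y z : 0 <= t -> measurable_fun setT f ->
  (forall y, `|f y| <= M) -> (forall y z, `|f y - f z| <= M * enorm (y - z)) ->
  `|OU t f y - OU t f z| <= M * enorm (y - z).
Proof.
move=> t0 mf fM fL.
have M0 : 0 <= M by exact: le_trans (normr_ge0 _) (fM 0).
have i1 w := @bounded_integrable _ _ _ mu _ M (measurable_mehler alpha t w mf)
  (fun y => fM _).
rewrite !OU_E -RintegralB //.
rewrite (le_trans (le_normr_Rintegral measurableT _)) //.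
  have h := integrableB measurableT (i1 y) (i1 z).
  by apply: eq_integrable h.
rewrite -[leRHS](Rintegral_cst_prob mu); apply: le_Rintegral => //.
- have h := integrable_abse (integrableB measurableT (i1 y) (i1 z)).
  by apply: eq_integrable h.
- exact: finite_measure_integrable_cst.
- move=> w _; rewrite (le_trans (fL _ _)) // ler_wpM2l //.
  rewrite opprD addrACA subrr addr0 -scalerBr enormZ ger0_norm ?expR_ge0 //.
  by rewrite ler_piMl ?enorm_ge0 // expR_le1 oppr_le0.
Qed.

(** The quotient of two homogeneity factors: [psi i (expR (- t) *: xi)] equals [ou_kappa t] times
    [psi i (c_ t *: xi)]. *)
Definition ou_kappa (t : R) : R := expR (- ((alpha - 1) * t)) / c_ t `^ (alpha - 1).

Lemma ou_kappa_ge0 t : 0 <= ou_kappa t.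
Proof. by rewrite divr_ge0 ?expR_ge0 ?powR_ge0. Qed.

Section bismut.
Variables (t : R) (i : 'I_d).
Hypothesis t0 : 0 < t.
Local Notation e_ := (expR (- t)).

Let sE : e_ `^ (alpha - 1) = expR (- ((alpha - 1) * t)).
Proof. by rewrite -expRM mulNr mulrC. Qed.

Lemma OU_cos xi (th : R) x : OU t (fun x => cos (dotv x xi + th)) x =
  expR (- Lam (c_ t *: xi)) * cos (dotv x (e_ *: xi) + th).
Proof.
rewrite OU_E -(integral_cos_shift mu_char); apply: eq_Rintegral => y _.
by congr cos; rewrite dotvDl !dotvZl !dotvZr; ring.
Qed.

(** Both sides are multiples of exp(-Lam(c_t xi)) sin a, where a is the phase at x. The left one
    carries the gradient of the exponent at e^-t xi, the right one at c_t xi, and homogeneity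
    exchanges them. *)
Lemma bismut_cos xi (th : R) x :
  \int[nu]_u ((OU t (fun x => cos (dotv x xi + th)) (x + u) -
    OU t (fun x => cos (dotv x xi + th)) (x - u)) * u 0 i) =
  2 * (ou_kappa t * \int[mu]_y (y 0 i * cos (dotv (e_ *: x + c_ t *: y) xi + th))).
Proof.
pose a := dotv x (e_ *: xi) + th; pose E := expR (- Lam (c_ t *: xi)).
transitivity (- (2 * E * sin a) * psi i (e_ *: xi)).
  rewrite /stable_grad -RintegralZl //; last exact: integrable_stable_grad alpha12 nu_stable _ _.
  apply: eq_Rintegral => u _; rewrite !OU_cos -/E.
  have -> : dotv (x + u) (e_ *: xi) + th = a + dotv u (e_ *: xi).
    by rewrite dotvDl /a addrAC.
  have -> : dotv (x - u) (e_ *: xi) + th = a - dotv u (e_ *: xi).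
    by rewrite dotvDl dotvNl /a addrAC.
  rewrite cosB cosD; move: (cos a) (sin a) (cos _) (sin _) E => p q r s E.
  by ring.
have -> : \int[mu]_y (y 0 i * cos (dotv (e_ *: x + c_ t *: y) xi + th)) =
    - sin a * (E * psi i (c_ t *: xi)).
  have i1 := integrable_coordM alpha12 mu_char i (tcl_measurable (tcl_cos (c_ t *: xi) 0))
    (fun u => cos_max _).
  have i2 := integrable_coordM alpha12 mu_char i (tcl_measurable (tcl_sin (c_ t *: xi) 0))
    (fun u => sin_max _).
  rewrite -(integral_coord_sin alpha12 nu_stable mu_nu mu_char).
  transitivity (\int[mu]_y (cos a * (y 0 i * cos (dotv y (c_ t *: xi) + 0)) -
      sin a * (y 0 i * sin (dotv y (c_ t *: xi) + 0)))).
    apply: eq_Rintegral => y _; rewrite !addr0.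
    have -> : dotv (e_ *: x + c_ t *: y) xi + th = a + dotv y (c_ t *: xi).
      by rewrite dotvDl !dotvZl /a !dotvZr addrAC.
    by rewrite cosD; ring.
  rewrite RintegralB //; last 2 first.
  - exact: (integrableZl measurableT (cos a) i1).
  - exact: (integrableZl measurableT (sin a) i2).
  rewrite !RintegralZl //.
  under eq_Rintegral do rewrite addr0.
  rewrite (integral_coord_cos alpha12 mu_char) mulr0 sub0r mulNr; congr (- (_ * _)).
  by apply: eq_Rintegral => y _; rewrite addr0.
have c0 := ou_scale_gt0 alpha12 t0.
rewrite (stable_gradZ alpha12 nu_stable mu_nu mu_char i xi (expR_gt0 (- t))).
rewrite (stable_gradZ alpha12 nu_stable mu_nu mu_char i xi c0) sE /ou_kappa.
have : c_ t `^ (alpha - 1) != 0 by rewrite (gt_eqF (powR_gt0 _ c0)).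
move: (c_ t `^ (alpha - 1)) (expR (- ((alpha - 1) * t))) (psi i xi) E (sin a) => p q s E a' p0.
by field.
Qed.

Lemma bismut_tcl (f : V -> R) x : tcl f ->
  \int[nu]_u ((OU t f (x + u) - OU t f (x - u)) * u 0 i) =
  2 * (ou_kappa t * \int[mu]_y (y 0 i * f (e_ *: x + c_ t *: y))).
Proof.
have inu g : tcl g -> nu.-integrable setT
    (EFin \o (fun u : V => (OU t g (x + u) - OU t g (x - u)) * u 0 i)).
  move=> tg; have [M [gM gL]] := tcl_bounded_lipschitz tg.
  have mg := tcl_measurable tg.
  apply: (@integrable_increment2 _ M); first exact: OU_measurable gM.
    by move=> y; exact: OU_bounded.
  by move=> y z; apply: OU_lipschitz => //; exact: ltW.
have imu g : tcl g -> mu.-integrable setT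
    (EFin \o (fun y : V => y 0 i * g (e_ *: x + c_ t *: y))).
  move=> tg; have [M [gM gL]] := tcl_bounded_lipschitz tg.
  apply: (integrable_coordM alpha12 mu_char i (measurable_mehler alpha t x (tcl_measurable tg))).
  by move=> u; exact: gM.
have iOU g w : tcl g -> mu.-integrable setT
    (EFin \o (fun y : V => g (e_ *: w + c_ t *: y))).
  move=> tg; have [M [gM gL]] := tcl_bounded_lipschitz tg.
  by apply: (bounded_integrable mu (measurable_mehler alpha t w (tcl_measurable tg))) => u; exact: gM.
elim => {f} [xi th|f g tf hf tg hg|a f tf hf|F f M tF hF bF lF cF].
- exact: bismut_cos.
- have e w : OU t (fun x => f x + g x) w = OU t f w + OU t g w.
    by rewrite !OU_E -RintegralD //; exact: iOU.
  transitivity (2 * (ou_kappa t * (\int[mu]_y (y 0 i * f (e_ *: x + c_ t *: y)) +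
      \int[mu]_y (y 0 i * g (e_ *: x + c_ t *: y))))); last first.
    rewrite -RintegralD //; [|exact: imu|exact: imu].
    by congr (_ * (_ * _)); apply: eq_Rintegral => y _; rewrite mulrDr.
  rewrite !mulrDr -hf -hg -RintegralD //; [|exact: inu|exact: inu].
  by apply: eq_Rintegral => u _; rewrite !e; ring.
- have e w : OU t (fun x => a * f x) w = a * OU t f w.
    by rewrite !OU_E -RintegralZl //; exact: iOU.
  transitivity (2 * (ou_kappa t * (a * \int[mu]_y (y 0 i * f (e_ *: x + c_ t *: y))))); last first.
    rewrite -RintegralZl //; last exact: imu.
    by congr (_ * (_ * _)); apply: eq_Rintegral => y _; rewrite mulrCA.
  transitivity (a * (\int[nu]_u ((OU t f (x + u) - OU t f (x - u)) * u 0 i))).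
    rewrite -RintegralZl //; last exact: inu.
    by apply: eq_Rintegral => u _; rewrite !e; ring.
  by rewrite hf; ring.
(* The limit is dominated by [levy_weight] under nu, which uses the common Lipschitz constant
   required in [tcl_lim], and by a multiple of |y_i| under mu. *)
- have mF n := tcl_measurable (tF n).
  have t0' := ltW t0.
  have mO n := OU_measurable alpha mu t (mF n) (bF n).
  have bO n y : `|OU t (F n) y| <= M by exact: OU_bounded.
  have lO n y z : `|OU t (F n) y - OU t (F n) z| <= M * enorm (y - z).
    exact: OU_lipschitz.
  have cO w : OU t (F n) w @[n --> \oo] --> OU t f w.
    apply: (@cvg_Rintegral_bounded _ _ _ mu _ _ M) => //.
      by move=> n; exact: measurable_mehler.
  have L : \int[nu]_u ((OU t (F n) (x + u) - OU t (F n) (x - u)) * u 0 i) @[n --> \oo] -->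
      \int[nu]_u ((OU t f (x + u) - OU t f (x - u)) * u 0 i).
    apply: (@cvg_Rintegral_dominated _ _ _ nu _ _ _ (fun u => 2 * M * levy_weight u)) => //.
    + move=> n; have := inu _ (tF n); by move=> /integrableP[/measurable_EFinP].
    + by move=> u _; apply: cvgM; [apply: cvgB; exact: cO|exact: cvg_cst].
    + exact: (integrableZl measurableT (2 * M) (integrable_levy_weight alpha12 nu_stable)).
    + by move=> n u _; exact: increment2_bound.
  have M0 : 0 <= M by exact: le_trans (normr_ge0 _) (bF 0%N 0).
  have Rr : 2 * (ou_kappa t * \int[mu]_y (y 0 i * F n (e_ *: x + c_ t *: y))) @[n --> \oo] -->
      2 * (ou_kappa t * \int[mu]_y (y 0 i * f (e_ *: x + c_ t *: y))).
    apply: cvgZr; apply: cvgZr.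
    apply: (@cvg_Rintegral_dominated _ _ _ mu _ _ _ (fun u => M * `|u 0 i|)) => //.
    + move=> n; have := imu _ (tF n); by move=> /integrableP[/measurable_EFinP].
    + by move=> u _; apply: cvgM; [exact: cvg_cst|exact: cF].
    + have h := integrableZl measurableT M
        (integrable_abse (integrable_coord alpha12 mu_char i)).
      by apply: eq_integrable h.
    + by move=> n u _; rewrite normrM mulrC ler_wpM2r.
  have e : (fun n => \int[nu]_u ((OU t (F n) (x + u) - OU t (F n) (x - u)) * u 0 i)) =
      fun n => 2 * (ou_kappa t * \int[mu]_y (y 0 i * F n (e_ *: x + c_ t *: y))).
    by apply/funext => n; exact: hF.
  rewrite e in L; exact: (cvg_unique _ L Rr).
Qed.

Lemma bismut (f : V -> R) x : tcl f ->
  frac_grad_sym nu (OU t f) x 0 i =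
  ou_kappa t * \int[mu]_y (y 0 i * f (e_ *: x + c_ t *: y)).
Proof.
move=> tf; have [M [fM fL]] := tcl_bounded_lipschitz tf.
have mf := tcl_measurable tf.
rewrite (@frac_grad_symE _ M) //; last 3 first.
- exact: OU_measurable fM.
- by move=> y; exact: OU_bounded.
- by move=> y z; apply: OU_lipschitz => //; exact: ltW.
by rewrite bismut_tcl // mulKf.
Qed.

End bismut.
End fractional_gradient_semigroup.

Lemma Rintegral_sum dT (T : measurableType dT) (R : realType)
    (m : {measure set T -> \bar R}) (I : Type) (s : seq I) (F : I -> T -> R) :
  (forall i, m.-integrable setT (EFin \o F i)) ->
  \int[m]_x \sum_(i <- s) F i x = \sum_(i <- s) \int[m]_x F i x.
Proof.
move=> iF; elim: s => [|i s ih].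
  under eq_Rintegral do rewrite big_nil.
  by rewrite big_nil Rintegral_cst // mul0r.
under eq_Rintegral do rewrite big_cons.
rewrite big_cons RintegralD ?ih //.
have := @integrable_sum _ _ _ m setT measurableT _ s xpredT _ (fun j _ => iF j).
by apply: eq_integrable => // x _ /=; rewrite sumEFin.
Qed.

(** * Moments and the gradient bound on test functions *)

Section gradient_bound.
Context {R : realType} {d : nat}.
Local Notation V := 'rV[R]_d.
Variables (alpha : R) (nu : {measure set V -> \bar R}) (mu : probability V R)
  (lambda : {finite_measure set V -> \bar R}).
Hypothesis alpha12 : 1 < alpha < 2.
Hypothesis nu_stable : stable_levy_measure alpha nu.
Hypothesis mu_nu : stable_law nu mu.
Hypothesis mu_char : forall xi : V, char_fun mu xi =
  ((expR (- \int[lambda]_(y in usphere) (`|dotv y xi| `^ alpha)))%:C)%C.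
Variables (dO : measure_display) (Omega : measurableType dO)
  (P : probability Omega R) (Y : {RV P >-> R}).
Hypothesis Y_stable : sym_stable_rv alpha Y.
Local Notation Lam := (stable_exponent alpha lambda).
Local Notation OU := (OU alpha mu).
Local Notation c_ := (ou_scale alpha).

Let a0 : 0 < alpha. Proof. by case/andP: alpha12 => h _; exact: lt_trans h. Qed.

Lemma dotv_const1 (a : R) (xi : 'rV[R]_1) : dotv (const_mx a) xi = a * xi 0 0.
Proof. by rewrite /dotv big_ord1 !mxE. Qed.

Lemma dotv_moment (z : V) (q : R) : 0 < q ->
  (\int[mu]_u (`|dotv u z| `^ q)%:E =
    (Lam z `^ (q / alpha))%:E * 'E_P[(fun w => `|Y w| `^ q)%R])%E.
Proof.
move=> q0; pose s := Lam z `^ alpha^-1.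
have L0 := stable_exponent_ge0 alpha lambda z.
have s0 : 0 <= s by exact: powR_ge0.
have sa : s `^ alpha = Lam z by rewrite -powRrM mulVf ?(gt_eqF a0) // powRr1.
have sq : s `^ q = Lam z `^ (q / alpha) by rewrite -powRrM mulrC.
(* Real variables are viewed as rows of length 1, so that uniqueness of laws for row vectors
   applies. *)
pose g1 (u : V) : 'rV[R]_1 := const_mx (dotv u z).
pose g2 w : 'rV[R]_1 := const_mx (s * Y w).
have mg1 : measurable_fun setT g1.
  apply: measurable_fun_rV => j; rewrite /g1; under eq_fun do rewrite mxE.
  exact: measurable_dotv.
have mg2 : measurable_fun setT g2.
  apply: measurable_fun_rV => j; rewrite /g2; under eq_fun do rewrite mxE.
  exact: measurable_funM.
have d1 xi u : dotv (g1 u) xi = dotv u (xi 0 0 *: z).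
  by rewrite dotv_const1 dotvZr mulrC.
have d2 xi w : dotv (g2 w) xi = (xi 0 0 * s) * Y w.
  by rewrite dotv_const1; ring.
have L xi : Lam (xi *: z) = `|xi * s| `^ alpha.
  rewrite (stable_exponentZ lambda alpha12) normrM powRM // (ger0_norm s0).
  by congr (_ * _); rewrite sa.
have eqcos xi : \int[mu]_u cos (dotv (g1 u) xi) = \int[P]_w cos (dotv (g2 w) xi).
  have h := congr1 (@complex.Re R) (Y_stable (xi 0 0 * s)).
  under eq_Rintegral do rewrite d1.
  under [RHS]eq_Rintegral do rewrite d2.
  rewrite (integral_cos_stable mu_char) L; exact: (esym h).
have eqsin xi : \int[mu]_u sin (dotv (g1 u) xi) = \int[P]_w sin (dotv (g2 w) xi).
  have h := congr1 (@complex.Im R) (Y_stable (xi 0 0 * s)).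
  under eq_Rintegral do rewrite d1.
  under [RHS]eq_Rintegral do rewrite d2.
  rewrite (integral_sin_stable mu_char); exact: (esym h).
pose h (x : 'rV[R]_1) := (`|x 0 0| `^ q)%:E.
have mh : measurable_fun setT h.
  apply/measurable_EFinP; apply: measurable_normrX_powR; exact: measurable_coord.
have h0 x : (0 <= h x)%E by rewrite lee_fin powR_ge0.
have e := eq_law_ge0_integral mg1 mg2 eqcos eqsin mh h0.
transitivity (\int[mu]_u h (g1 u))%E.
  by apply: eq_integral => u _; rewrite /h mxE.
rewrite e unlock -sq -ge0_integralZl ?lee_fin ?powR_ge0 //.
- by apply: eq_integral => w _; rewrite /h mxE normrM powRM // ger0_norm.
- by apply/measurable_EFinP; exact: measurable_normrX_powR.
Qed.

Hypothesis nondeg : nondegenerate_spectral alpha lambda.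
Hypothesis d_gt0 : (0 < d)%N.

Lemma stable_exponent_EFin (z : V) :
  ((Lam z)%:E = \int[lambda]_(y in usphere) (`|dotv z y| `^ alpha)%:E)%E.
Proof.
rewrite /stable_exponent /Rintegral fineK; last first.
  by apply: integrable_fin_num => //; [exact: measurable_usphere|exact: integrable_abs_dotv_sphere].
by apply: eq_integral => y _; rewrite dotvC.
Qed.

(** If the exponent vanished on the sphere, the infimum in the nondegeneracy condition would be that
    of {0}; [d_gt0] keeps the sphere, hence this set, nonempty. *)
Lemma exists_stable_exponent_gt0 : exists2 z : V, usphere z & 0 < Lam z.
Proof.
apply: contrapT => h; have /eqP := nondeg; apply.
have -> : [set (\int[lambda]_(x in usphere) (`|dotv y x| `^ alpha)%:E)%E | y in usphere]
    = [set 0%E].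
  apply/seteqP; split => [_ [y uy <-]|_ ->] /=.
    rewrite -stable_exponent_EFin; congr EFin; apply/eqP/contraT => Ly; exfalso; apply: h.
    by exists y => //; rewrite lt_neqAle eq_sym Ly stable_exponent_ge0.
  exists (delta_mx 0 (Ordinal d_gt0)); first exact: enorm_delta.
  rewrite -stable_exponent_EFin; congr EFin; apply/eqP/contraT => Ly; exfalso; apply: h.
  exists (delta_mx 0 (Ordinal d_gt0)); first exact: enorm_delta.
  by rewrite lt_neqAle eq_sym Ly stable_exponent_ge0.
by rewrite ereal_inf1.
Qed.

(** In a direction of positive exponent, [Y] has the law of a finite multiple of a linear form under
    mu, whose moments are already bounded. *)
Lemma moment_stable_lty (q : R) : 0 < q -> q < alpha ->
  ('E_P[(fun w => `|Y w| `^ q)%R] < +oo)%E.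
Proof.
move=> q0 qa; have [z _ Lz] := exists_stable_exponent_gt0.
have := moment_dotv_lty alpha12 mu_char z q0 qa; rewrite dotv_moment //.
have Lq : 0 < Lam z `^ (q / alpha) by rewrite powR_gt0.
have : (0 <= 'E_P[(fun w => `|Y w| `^ q)%R])%E.
  by rewrite unlock; apply: integral_ge0 => w _; rewrite lee_fin powR_ge0.
by case: ('E_P[_])%E => [x||] //=; rewrite ?ltry // gt0_muley ?lte_fin.
Qed.

(** The extended constant is replaced by a real number with the one property used of it, a moment
    bound in unit directions. The supremum is finite because the exponent is at most the mass of
    [lambda] on the sphere. *)
Lemma gamma_const_spec (q : R) : 0 < q -> q < alpha -> exists c : R,
  [/\ 0 <= c, gamma_const alpha lambda Y q = c%:E &
    forall z : V, enorm z = 1 -> (\int[mu]_u (`|dotv u z| `^ q)%:E <= (c `^ q)%:E)%E].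
Proof.
move=> q0 qa; have Ey := moment_stable_lty q0 qa.
have E0 : (0 <= 'E_P[(fun w => `|Y w| `^ q)%R])%E.
  by rewrite unlock; apply: integral_ge0 => w _; rewrite lee_fin powR_ge0.
have : ('E_P[(fun w => `|Y w| `^ q)%R] \is a fin_num)%E by rewrite ge0_fin_numE.
rewrite /gamma_const; move: E0 {Ey}.
have hm := dotv_moment _ q0; move: hm.
case: ('E_P[_])%E => [e| |] // hm e0 _; rewrite lee_fin in e0.
set S := [set _ | _ in _].
have SE (z : V) : usphere z ->
    ((\int[lambda]_(x in usphere) (`|dotv z x| `^ alpha)%:E) `^ alpha^-1 =
     (Lam z `^ alpha^-1)%:E)%E.
  by move=> _; rewrite -stable_exponent_EFin poweR_EFin.
have mS : measurable (usphere : set V) by exact: measurable_usphere.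
pose B := fine (lambda usphere).
have B0 : 0 <= B by rewrite fine_ge0.
have LB (z : V) : usphere z -> Lam z <= B.
  move=> uz; rewrite -lee_fin stable_exponent_EFin /B fineK ?fin_num_measure //.
  have e1 : (\int[lambda]_(x in usphere) cst 1%:E x = 1%:E * lambda usphere)%E.
    exact: integral_cst.
  rewrite mul1e in e1; rewrite -[leRHS]e1; apply: ge0_le_integral => //.
  - apply/measurable_EFinP; have h := measurable_abs_dotv z alpha mS.
    by under eq_fun do rewrite dotvC.
  - move=> x ux; have -> : cst 1%E x = (1 `^ alpha)%:E :> \bar R by rewrite powR1.
    rewrite lee_fin.
    apply: ge0_ler_powR; rewrite ?nnegrE // ?(ltW a0) //.
    by rewrite (le_trans (dotv_le_enorm _ _)) // uz ux mulr1.
have Sb : (ereal_sup S <= (B `^ alpha^-1)%:E)%E.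
  apply: ge_ereal_sup => _ [z uz <-]; rewrite SE // lee_fin.
  by apply: ge0_ler_powR; rewrite ?nnegrE ?stable_exponent_ge0 ?invr_ge0 ?(ltW a0) ?LB.
have Sz (z : V) : usphere z -> ((Lam z `^ alpha^-1)%:E <= ereal_sup S)%E.
  by move=> uz; apply: ereal_sup_ubound; exists z => //; rewrite SE.
have [z0 uz0 _] := exists_stable_exponent_gt0.
have S0 : (0 <= ereal_sup S)%E by rewrite (le_trans _ (Sz _ uz0)) // lee_fin powR_ge0.
move: S0 Sb Sz; case: (ereal_sup S) => [s| |] // s0 _ Sz; rewrite lee_fin in s0.
exists (e `^ q^-1 * s); split.
- by rewrite mulr_ge0 ?powR_ge0.
- by rewrite poweR_EFin EFinM.
- move=> z uz; rewrite hm -EFinM lee_fin powRM ?powR_ge0 //.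
  rewrite -powRrM mulVf ?(gt_eqF q0) // powRr1 // mulrC ler_wpM2l //.
  have -> : q / alpha = alpha^-1 * q by rewrite mulrC.
  rewrite powRrM; apply: ge0_ler_powR; rewrite ?nnegrE ?powR_ge0 ?(ltW q0) //.
  by rewrite -lee_fin Sz.
Qed.

Section hoelder_bound.
Variables (p : R) (c : R).
Hypothesis p_gt : alpha / (alpha - 1) < p.
Let q := p / (p - 1).

Let p1 : 1 < p.
Proof.
apply: lt_trans p_gt; case/andP: alpha12 => a1 _.
by rewrite ltr_pdivlMr ?subr_gt0 // mul1r ltrBlDr ltrDl.
Qed.

Lemma conjugate_lt : 1 < q < alpha.
Proof.
have [a1 _] := andP alpha12; have p10 : 0 < p - 1 by rewrite subr_gt0.
have a10 : 0 < alpha - 1 by rewrite subr_gt0.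
rewrite /q; apply/andP; split; first by rewrite ltr_pdivlMr // mul1r ltrBlDr ltrDl.
rewrite ltr_pdivrMr //; move: p_gt; rewrite ltr_pdivrMr // => h; nra.
Qed.

Hypothesis c_ge0 : 0 <= c.
Hypothesis c_moment : forall z : V, enorm z = 1 ->
  (\int[mu]_u (`|dotv u z| `^ q)%:E <= (c `^ q)%:E)%E.

Let q0 : 0 < q. Proof. by case/andP: conjugate_lt => h _; exact: lt_trans h. Qed.
Let p0 : 0 < p. Proof. exact: lt_trans p1. Qed.

(* Hoelder's inequality tested in the direction of the integral itself *)
Lemma enorm_integral_le (g : V -> R) (M : R) : measurable_fun setT g ->
  (forall x, `|g x| <= M) ->
  ((enorm (\row_i \int[mu]_y (y 0 i * g y)) `^ p)%:E <=
    (c `^ p)%:E * \int[mu]_y (`|g y| `^ p)%:E)%E.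
Proof.
move=> mg gM; set D := \row_i _.
have [D0|D0] := eqVneq (enorm D) 0.
  rewrite D0 powR0 ?(gt_eqF p0) // mule_ge0 ?lee_fin ?powR_ge0 //.
  by apply: integral_ge0 => y _; rewrite lee_fin powR_ge0.
pose z := (enorm D)^-1 *: D.
have Dp : 0 < enorm D by rewrite lt_neqAle eq_sym D0 enorm_ge0.
have uz : enorm z = 1.
  by rewrite enormZ ger0_norm ?invr_ge0 ?enorm_ge0 // mulVf.
have Dz : enorm D = \int[mu]_y (dotv y z * g y).
  have -> : enorm D = dotv D z by rewrite dotvZr -enorm_sqr expr2 mulKf.
  rewrite /dotv.
  have ig i : mu.-integrable setT (EFin \o (fun y : V => z 0 i * (y 0 i * g y))).
    exact: (integrableZl measurableT _ (integrable_coordM alpha12 mu_char i mg gM)).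
  transitivity (\int[mu]_y \sum_i (z 0 i * (y 0 i * g y))); last first.
    apply: eq_Rintegral => y _; rewrite mulr_suml; apply: eq_bigr => i _; ring.
  rewrite Rintegral_sum //.
  apply: eq_bigr => i _; rewrite RintegralZl // ?mxE 1?mulrC //.
  exact: (integrable_coordM alpha12 mu_char i mg gM).
have mz := measurable_dotv z.
have qp : q^-1 + p^-1 = 1.
  by rewrite /q invf_div; field; rewrite gt_eqF.
have h := hoelder mu mz mg q0 p0 qp; rewrite Lnorm1 in h.
have i1 : mu.-integrable setT (EFin \o (fun y => dotv y z * g y)).
  have := integrableZl measurableT M (integrable_dotv alpha12 mu_char z).
  apply: le_integrable => //.
    by apply/measurable_EFinP; exact: measurable_funM.
  move=> y _; rewrite /= lee_fin !normrM mulrC ler_wpM2r //.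
  by rewrite (le_trans (gM y)) ?ler_norm.
have Nz : ('N[mu]_q%:E [EFin \o (fun y => dotv y z)] <= c%:E)%E.
  by apply/(Lnorm_le mu q0 _ c_ge0); exact: c_moment.
have e1 : ((enorm D)%:E <= c%:E * 'N[mu]_p%:E [EFin \o g])%E.
  apply: (@le_trans _ _ ('N[mu]_q%:E [EFin \o (fun y => dotv y z)] * 'N[mu]_p%:E [EFin \o g])%E).
    apply: le_trans h; rewrite -[enorm D]ger0_norm ?enorm_ge0 // Dz.
    rewrite (le_trans _ (le_abse_integral mu measurableT _)) //; last first.
    - by apply/measurable_EFinP; apply: measurable_funM.
    rewrite /Rintegral -abse_EFin fineK //.
    exact: integrable_fin_num.
  by rewrite lee_wpmul2r // Lnorm_ge0.
have e2 : (((enorm D)%:E) `^ p <= (c%:E * 'N[mu]_p%:E [EFin \o g]) `^ p)%E.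
  apply: gt0_ler_poweR => //; first exact: ltW.
    by rewrite in_itv /= leey lee_fin enorm_ge0.
  by rewrite in_itv /= leey mule_ge0 ?Lnorm_ge0.
by rewrite poweR_EFin poweRM ?Lnorm_ge0 // poweR_EFin Lnorm_pow in e2.
Qed.

(** Hoelder's inequality is applied at each x to the Mehler integral, and invariance of mu then
    removes the outer average. [F] is tied to the gradient almost everywhere only, as is the
    extension [DP]. *)
Lemma grad_Lnorm_stest t (f : V -> R) (F : V -> V) : 0 < t -> stest f ->
  measurable_fun setT F ->
  {ae mu, forall x, F x = frac_grad_sym nu (OU t f) x} ->
  (vLnorm mu p F <= (ou_kappa alpha t * c)%:E * 'N[mu]_p%:E [EFin \o f])%E.
Proof.
move=> t0 sf mF aeF; have tf := sf.2.
have mf := tcl_measurable tf; have [M [fM fL]] := tcl_bounded_lipschitz tf.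
have k0 := ou_kappa_ge0 alpha t.
have kc0 : 0 <= ou_kappa alpha t * c by rewrite mulr_ge0.
have mq := measurable_normrX_powR p mf.
have h : (\int[mu]_x (`|enorm (F x)| `^ p)%:E <=
    ((ou_kappa alpha t * c) `^ p)%:E * \int[mu]_x (`|f x| `^ p)%:E)%E.
  rewrite -(@mehler_invariant _ _ alpha mu lambda alpha12 mu_char t (fun u => (`|f u| `^ p)%:E) (ltW t0)) //;
    last exact/measurable_EFinP.
  have mz : measurable_fun setT (fun z : V * V =>
      (`|f (expR (- t) *: z.1 + c_ t *: z.2)| `^ p)%:E).
    apply/measurable_EFinP; exact: (measurableT_comp mq (measurable_lincomb _ _)).
  have mI : measurable_fun setT (fun x : V =>
      (\int[mu]_y (`|f (expR (- t) *: x + c_ t *: y)| `^ p)%:E)%E).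
    exact: (@measurable_fun_fubini_tonelli_F _ _ _ _ _ mu _ mz).
  rewrite -ge0_integralZl ?lee_fin ?powR_ge0 //; last first.
    by move=> x _; apply: integral_ge0 => y _; rewrite lee_fin powR_ge0.
  apply: ae_ge0_le_integral => //.
  - by apply/measurable_EFinP; apply: measurable_normrX_powR; exact: measurable_fun_enorm.
  - by move=> x _; rewrite mule_ge0 ?lee_fin ?powR_ge0 //; apply: integral_ge0 => y _; rewrite lee_fin powR_ge0.
  - exact: measurable_funeM.
  - apply: filterS aeF => x -> _.
    have -> : frac_grad_sym nu (OU t f) x = ou_kappa alpha t *:
        \row_i \int[mu]_y (y 0 i * f (expR (- t) *: x + c_ t *: y)).
      apply/rowP => i; rewrite [RHS]mxE [X in _ = _ * X]mxE.
      exact: (bismut alpha12 nu_stable mu_nu mu_char i t0 x tf).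
    rewrite enormZ (ger0_norm k0) (ger0_norm (mulr_ge0 k0 (enorm_ge0 _))).
    rewrite (powRM _ k0 (enorm_ge0 _)) (powRM _ k0 c_ge0) !EFinM -muleA.
    rewrite lee_wpmul2l ?lee_fin ?powR_ge0 //.
    by apply: (@enorm_integral_le _ M) => //; exact: measurable_mehler.
exact: le_Lnorm_integral.
Qed.

End hoelder_bound.
End gradient_bound.

(** * Vector-valued L^p functions *)

Section vector_Lp_theory.
Context {R : realType} {d : nat}.
Local Notation V := 'rV[R]_d.
Variables (mu : probability V R) (p : R).
Hypothesis p1 : 1 <= p.
Local Notation vN F := (vLnorm mu p F%R).
Local Notation N f := ('N[mu]_p%:E [EFin \o f%R])%E.
Implicit Types F G H : V -> V.

Let p0 : 0 < p. Proof. exact: lt_le_trans p1. Qed.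

Lemma vLnorm_ge0 F : (0 <= vN F)%E. Proof. exact: Lnorm_ge0. Qed.

Lemma measurable_rVD F G : measurable_fun setT F -> measurable_fun setT G ->
  measurable_fun setT (F + G).
Proof.
move=> mF mG; apply: measurable_fun_rV => i.
under eq_fun do rewrite mxE.
by apply: measurable_funD; exact: (measurableT_comp (measurable_coord i)).
Qed.

Lemma measurable_rVZ (a : R) F : measurable_fun setT F ->
  measurable_fun setT (a *: F).
Proof.
move=> mF; apply: measurable_fun_rV => i.
under eq_fun do rewrite mxE.
by apply: measurable_funM => //; exact: (measurableT_comp (measurable_coord i)).
Qed.

Lemma measurable_rVB F G : measurable_fun setT F -> measurable_fun setT G ->
  measurable_fun setT (F - G).
Proof.
move=> mF mG; rewrite -scaleN1r; apply: measurable_rVD => //; exact: measurable_rVZ.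
Qed.

Lemma vLnormD F G : measurable_fun setT F -> measurable_fun setT G ->
  (vN (F + G) <= vN F + vN G)%E.
Proof.
move=> mF mG; have eF := measurable_fun_enorm mF; have eG := measurable_fun_enorm mG.
apply: (@le_trans _ _ (N ((enorm \o F) \+ (enorm \o G)))); last exact: minkowski_EFin.
apply: le_Lnorm => //.
- apply: measurable_fun_enorm; exact: measurable_rVD.
- exact: measurable_funD.
- by move=> x /=; rewrite !ger0_norm ?addr_ge0 ?enorm_ge0 // enormD.
Qed.

Lemma vLnormZ (a : R) F : measurable_fun setT F ->
  (vN (a *: F) = `|a|%:E * vN F)%E.
Proof.
move=> mF; rewrite /vLnorm.
have -> : enorm \o (a *: F) = fun x => `|a| * enorm (F x).
  by apply/funext => x /=; rewrite enormZ.
rewrite Lnorm_scale // ?normr_id //; exact: measurable_fun_enorm.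
Qed.

Lemma vLnormC F G : vN (F - G) = vN (G - F).
Proof. by apply: eq_Lnorm => x /=; rewrite enormB. Qed.

Lemma vLnorm_triangle G F H : measurable_fun setT F -> measurable_fun setT G ->
  measurable_fun setT H -> (vN (F - H) <= vN (F - G) + vN (G - H))%E.
Proof.
move=> mF mG mH; have -> : F - H = (F - G) + (G - H) by rewrite addrA subrK.
by apply: vLnormD; exact: measurable_rVB.
Qed.

Lemma vLnorm_subr0 F : vN (F - 0) = vN F. Proof. by rewrite subr0. Qed.

Lemma vLnorm0 : vN 0 = 0%E.
Proof.
have := @vLnormZ 0 0 (@measurable_cst _ _ _ _ setT (0 : V)).
by rewrite scaler0 normr0 mul0e.
Qed.

Lemma ae_eq_vLnorm F G : measurable_fun setT F -> measurable_fun setT G ->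
  {ae mu, forall x, F x = G x} -> vN F = vN G.
Proof.
move=> mF mG FG; apply: ae_eq_Lnorm => //; try exact: measurable_fun_enorm.
by apply: filterS FG => x /= ->.
Qed.

Lemma vLnorm_coord F i : measurable_fun setT F -> (N (fun x => F x 0 i) <= vN F)%E.
Proof.
move=> mF; apply: le_Lnorm => //.
- exact: (measurableT_comp (measurable_coord i)).
- exact: measurable_fun_enorm.
- by move=> x /=; rewrite [leRHS]ger0_norm ?enorm_ge0 // coord_le_enorm.
Qed.

Lemma Lnorm_sum_le (I : Type) (s : seq I) (g : I -> V -> R) :
  (forall i, measurable_fun setT (g i)) ->
  (N (fun x => \sum_(i <- s) g i x) <= \sum_(i <- s) N (g i))%E.
Proof.
move=> mg; elim: s => [|i s ih].
  rewrite big_nil; under [X in EFin \o X]eq_fun do rewrite big_nil.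
  have := @Lnorm_scale _ _ _ mu p p0 0 (cst 0) (@measurable_cst _ _ _ _ setT (0 : R)).
  by rewrite normr0 mul0e; under [X in EFin \o X]eq_fun do rewrite mul0r; move=> ->.
rewrite big_cons; under [X in EFin \o X]eq_fun do rewrite big_cons.
apply: (@le_trans _ _ (N (g i) + N (fun x => (\sum_(j <- s) g j x)%R))%E).
  by apply: minkowski_EFin => //; exact: measurable_sum.
by rewrite leeD2l.
Qed.

Lemma vLnorm_le_sum F : measurable_fun setT F ->
  (vN F <= \sum_i N (fun x => F x 0 i))%E.
Proof.
move=> mF.
have mc i : measurable_fun setT (fun x => `|F x 0 i|).
  apply: (measurableT_comp (@normr_measurable R setT)).
  exact: (measurableT_comp (measurable_coord i)).
apply: (@le_trans _ _ (N (fun x => \sum_i `|F x 0 i|)%R)).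
  apply: le_Lnorm => //; [exact: measurable_fun_enorm|exact: measurable_sum|].
  move=> x /=; rewrite !ger0_norm ?enorm_ge0 ?sumr_ge0 //; exact: enorm_le_sum.
rewrite (le_trans (Lnorm_sum_le _ mc)) //.
by under eq_bigr do rewrite Lnorm_normr.
Qed.

Lemma vLnormB_le_sum F G : measurable_fun setT F -> measurable_fun setT G ->
  (vN (F - G) <= \sum_i N (fun x => F x 0 i - G x 0 i))%E.
Proof.
move=> mF mG; rewrite (le_trans (vLnorm_le_sum _)) //; first exact: measurable_rVB.
apply: lee_sum => i _; rewrite le_eqVlt; apply/orP; left; apply/eqP.
by apply: eq_Lnorm => x; rewrite /= !mxE.
Qed.

Lemma in_vLpD F G : in_vLp mu p F -> in_vLp mu p G -> in_vLp mu p (F + G).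
Proof.
move=> [mF F1] [mG G1]; split; first exact: measurable_rVD.
by rewrite (le_lt_trans (vLnormD mF mG)) // lte_add_pinfty.
Qed.

Lemma in_vLpZ (a : R) F : in_vLp mu p F -> in_vLp mu p (a *: F).
Proof.
move=> [mF F1]; split; first exact: measurable_rVZ.
by rewrite vLnormZ // lte_mul_pinfty.
Qed.

Lemma in_vLp0 : in_vLp mu p 0.
Proof. by split; [exact: measurable_cst|rewrite vLnorm0 ltry]. Qed.

End vector_Lp_theory.

Lemma lee_addeps (R : realType) (x y : \bar R) (K : R) : 0 <= K ->
  (forall e : R, 0 < e -> (x <= y + (K * e)%:E)%E) -> (x <= y)%E.
Proof.
move=> K0 h; apply/lee_addgt0Pr => e e0.
have K1 : 0 < K + 1 by rewrite ltr_wpDl.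
rewrite (le_trans (h (e / (K + 1)) _)) ?divr_gt0 // leeD2l // lee_fin.
by rewrite mulrA ler_pdivrMr // mulrC ler_wpM2l ?(ltW e0) // lerDl.
Qed.

Lemma pinv_le (R : realType) (a b : R) : 0 < a -> a <= b -> b^-1 <= a^-1.
Proof. by move=> a0 ab; rewrite lef_pV2 ?posrE // (lt_le_trans a0). Qed.

(** * The gradient of the semigroup on the whole of L^p *)

Section extension.
Context {R : realType} {d : nat}.
Local Notation V := 'rV[R]_d.
Variables (alpha : R) (nu : {measure set V -> \bar R}) (mu : probability V R)
  (lambda : {finite_measure set V -> \bar R}).
Hypothesis alpha12 : 1 < alpha < 2.
Hypothesis nu_stable : stable_levy_measure alpha nu.
Hypothesis mu_nu : stable_law nu mu.
Hypothesis mu_char : forall xi : V, char_fun mu xi =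
  ((expR (- \int[lambda]_(y in usphere) (`|dotv y xi| `^ alpha)))%:C)%C.
Variables (p : R) (c : R).
Hypothesis p_gt : alpha / (alpha - 1) < p.
Hypothesis c_ge0 : 0 <= c.
Hypothesis c_moment : forall z : V, enorm z = 1 ->
  (\int[mu]_u (`|dotv u z| `^ (p / (p - 1)))%:E <= (c `^ (p / (p - 1)))%:E)%E.
Variable DP : R -> (V -> R) -> V -> V.
Hypothesis DP_ext : grad_OU_extension alpha nu mu p DP.

Local Notation OU := (OU alpha mu).
Local Notation c_ := (ou_scale alpha).
Local Notation kappa := (ou_kappa alpha).
Local Notation vN F := (vLnorm mu p F%R).
Local Notation N f := ('N[mu]_p%:E [EFin \o f%R])%E.

(** Since alpha < 2, the threshold alpha / (alpha - 1) is above 2. Strong continuity of the dual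
    semigroup is derived above this exponent. *)
Lemma exponent_gt2 : 2 < p.
Proof.
apply: lt_trans p_gt; have [a1 a2] := andP alpha12.
by rewrite ltr_pdivlMr ?subr_gt0 //; lra.
Qed.

Let p1 : 1 <= p.
Proof. by rewrite (le_trans _ (ltW exponent_gt2)) // ler1n. Qed.

Let p0 : 0 < p. Proof. exact: lt_le_trans p1. Qed.

Lemma stest_Lfun u : stest u -> u \in Lfun mu p%:E.
Proof.
move=> su; have mu' := stest_measurable su; apply/Lfun_mem; split => //.
have [M [uM _]] := tcl_bounded_lipschitz su.2.
apply: le_lt_trans (Lnorm_cst_lty mu p M); apply: le_Lnorm => // x /=.
by rewrite (le_trans (uM x)) // ler_norm.
Qed.

(** An explicit pointwise representative of the gradient on test functions, where linearity in [u]
    and continuity in [t] can be read; [DP t u] is known up to null sets. *)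
Definition mehler_grad t (u : V -> R) (x : V) : V :=
  kappa t *: \row_i \int[mu]_y (y 0 i * u (expR (- t) *: x + c_ t *: y)).

Lemma mehler_gradE t u x i : mehler_grad t u x 0 i =
  kappa t * \int[mu]_y (y 0 i * u (expR (- t) *: x + c_ t *: y)).
Proof. by rewrite /mehler_grad mxE; congr (_ * _); rewrite mxE. Qed.

Lemma frac_grad_OU t u : 0 < t -> stest u ->
  frac_grad_sym nu (OU t u) = mehler_grad t u.
Proof.
move=> t0 su; apply/funext => x; apply/rowP => i; rewrite mehler_gradE.
exact: (bismut alpha12 nu_stable mu_nu mu_char i t0 x su.2).
Qed.

Let imu t u x i : tcl u ->
  mu.-integrable setT (EFin \o (fun y : V => y 0 i * u (expR (- t) *: x + c_ t *: y))).
Proof.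
move=> tg; have [M [gM gL]] := tcl_bounded_lipschitz tg.
apply: (integrable_coordM alpha12 mu_char i (measurable_mehler alpha t x (tcl_measurable tg))).
by move=> y; exact: gM.
Qed.

Lemma mehler_gradB t u v : tcl u -> tcl v ->
  mehler_grad t (fun x => u x - v x) = mehler_grad t u - mehler_grad t v.
Proof.
move=> tu tv; apply/funext => x; rewrite [RHS]/GRing.add /= -scalerN -scalerDr; congr (_ *: _).
apply/rowP => i; rewrite !mxE -RintegralB //; [|exact: imu|exact: imu].
by apply: eq_Rintegral => y _; rewrite mulrBr.
Qed.

Lemma stestB (u v : V -> R) : stest u -> stest v -> stest (fun x => u x - v x).
Proof.
move=> su sv; have := stestD su (stestZ (-1) sv).
by congr stest; apply/funext => x; rewrite mulN1r.
Qed.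

Let mDP t F : 0 < t -> F \in Lfun mu p%:E -> measurable_fun setT (DP t F).
Proof. by move=> t0 hF; have [/(_ F hF)[]] := DP_ext t0. Qed.

Lemma grad_extension_stest t u : 0 < t -> stest u ->
  {ae mu, forall x, DP t u x = mehler_grad t u x}.
Proof.
move=> t0 su; have [_ /(_ u su.1) h _] := DP_ext t0.
by move: h; rewrite frac_grad_OU.
Qed.

Lemma grad_extension_approx t F (e : R) : 0 < t -> F \in Lfun mu p%:E -> 0 < e ->
  exists2 u, stest u & (N (fun x => u x - F x) <= e%:E)%E /\
    (vN (DP t u - DP t F) <= e%:E)%E.
Proof.
move=> t0 hF e0; have [_ _ h3] := DP_ext t0.
have h n : exists u, stest u /\ (N (fun x => u x - F x) <= (n.+1%:R^-1)%:E)%E.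
  by have [u su Nu] := stest_dense p1 hF (e := n.+1%:R^-1) ltac:(by []); exists u.
have [u hu] := choice h.
have c1 : (fun n => N (u n - F)) @ \oo --> 0%E.
  apply/cvge_0P => [n|r r0]; first exact: Lnorm_ge0.
  near=> n; rewrite (le_trans (hu n).2) // lee_fin.
  by near: n; have := near_infty_natSinv_lt (PosNum r0); apply: filterS => n /= /ltW.
have := h3 u F (fun n => stest_Lfun (hu n).1) hF c1.
move=> /cvge_0P => /(_ (fun n => Lnorm_ge0 _ _ _))/(_ e e0) c2.
have := c1 => /cvge_0P => /(_ (fun n => Lnorm_ge0 _ _ _))/(_ e e0) {}c1.
have [n [n1 n2]] : exists n, (N (u n - F) <= e%:E)%E /\ (vN (DP t (u n) - DP t F) <= e%:E)%E.
  near \oo => n; exists n; split; by near: n.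
by exists (u n); [exact: (hu n).1|split].
Unshelve. all: by end_near. Qed.

(** The extension is given by continuity, without a linearity clause. The difference is therefore
    estimated on test functions, where [mehler_grad] is linear, and carried over by
    approximation. *)
Lemma grad_extension_lipschitz t F G : 0 < t -> F \in Lfun mu p%:E ->
  G \in Lfun mu p%:E ->
  (vN (DP t F - DP t G) <= (kappa t * c)%:E * N (fun x => F x - G x))%E.
Proof.
move=> t0 hF hG; set K := kappa t * c.
have K0 : 0 <= K by rewrite mulr_ge0 ?ou_kappa_ge0.
(* Two errors [e] come from the images of the approximants, and two more, multiplied by [K], from
   the approximants themselves. *)
have K2 : 0 <= 2 + 2 * K by move: K0; lra.
apply: (lee_addeps K2) => e e0.
have [u su [u1 u2]] := grad_extension_approx t0 hF e0.
have [v sv [v1 v2]] := grad_extension_approx t0 hG e0.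
have hu := stest_Lfun su; have hv := stest_Lfun sv.
have mF := mDP t0 hF; have mG := mDP t0 hG; have mu' := mDP t0 hu; have mv := mDP t0 hv.
have [mf _] := (Lfun_mem _ _ _).1 hF; have [mg _] := (Lfun_mem _ _ _).1 hG.
have [muu _] := (Lfun_mem _ _ _).1 hu; have [mvv _] := (Lfun_mem _ _ _).1 hv.
have h1 : (vN (DP t u - DP t v) <= K%:E * N (fun x => u x - v x))%E.
  apply: (grad_Lnorm_stest alpha12 nu_stable mu_nu mu_char p_gt c_ge0 c_moment t0).
  - exact: stestB.
  - exact: measurable_rVB.
  - rewrite frac_grad_OU //; last exact: stestB.
    rewrite (mehler_gradB t su.2 sv.2).
    have := grad_extension_stest t0 su; have := grad_extension_stest t0 sv.
    by apply: filterS2 => x h1 h2; rewrite /GRing.add /= /GRing.opp /= h1 h2.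
have h2 : (N (fun x => u x - v x) <= N (fun x => F x - G x) + (2 * e)%:E)%E.
  rewrite (le_trans (Lnorm_triangle mu p1 muu mf mvv)) //.
  rewrite (le_trans (leeD u1 (Lnorm_triangle mu p1 mf mg mvv))) //.
  rewrite Lnorm_distC in v1; rewrite (le_trans (leeD2l _ (leeD2l _ v1))) //.
  by rewrite addeCA -EFinD mulr2n mulrDl mul1r.
rewrite (le_trans (vLnorm_triangle mu p1 mF mu' mG)) //.
rewrite vLnormC (le_trans (leeD u2 (vLnorm_triangle mu p1 mu' mv mG))) //.
rewrite (le_trans (leeD2l _ (leeD h1 v2))) //.
rewrite (le_trans (leeD2l _ (leeD2r _ (lee_wpmul2l _ h2)))) ?lee_fin //.
rewrite ge0_muleDr ?Lnorm_ge0 ?lee_fin ?mulr_ge0 ?(ltW e0) // -EFinM.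
rewrite -addeA -EFinD addeCA -EFinD leeD2l // lee_fin; lra.
Qed.

Lemma grad_extension_bound t F : 0 < t -> F \in Lfun mu p%:E ->
  (vN (DP t F) <= (kappa t * c)%:E * N F)%E.
Proof.
move=> t0 hF; set K := kappa t * c.
have K0 : 0 <= K by rewrite mulr_ge0 ?ou_kappa_ge0.
have K1 : 0 <= 1 + K by move: K0; lra.
apply: (lee_addeps K1) => e e0.
have [u su [u1 u2]] := grad_extension_approx t0 hF e0.
have hu := stest_Lfun su.
have mF := mDP t0 hF; have mu' := mDP t0 hu.
have [mf _] := (Lfun_mem _ _ _).1 hF; have [muu _] := (Lfun_mem _ _ _).1 hu.
have h1 : (vN (DP t u) <= K%:E * N u)%E.
  apply: (grad_Lnorm_stest alpha12 nu_stable mu_nu mu_char p_gt c_ge0 c_moment t0) => //.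
  by rewrite frac_grad_OU //; exact: grad_extension_stest.
have h2 : (N u <= N F + e%:E)%E.
  have {1}-> : u = (fun x => u x - F x) \+ F by apply/funext => x /=; rewrite subrK.
  rewrite (le_trans (minkowski_EFin _ _ _ p1)) //; first exact: measurable_funB.
  by rewrite addeC leeD2l.
have {1}-> : DP t F = (DP t F - DP t u) + DP t u by rewrite subrK.
rewrite (le_trans (vLnormD mu p1 _ _)) //; first exact: measurable_rVB.
rewrite vLnormC (le_trans (leeD u2 h1)) //.
rewrite (le_trans (leeD2l _ (lee_wpmul2l _ h2))) ?lee_fin //.
rewrite ge0_muleDr ?Lnorm_ge0 ?lee_fin ?(ltW e0) // -EFinM.
by rewrite addeCA -EFinD leeD2l // lee_fin; lra.
Qed.

Lemma ou_scale_le s t : 0 < s -> s <= t -> c_ s <= c_ t.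
Proof.
move=> s0 st; have a0 : 0 < alpha by case/andP: alpha12 => a1 _; exact: lt_trans a1.
have t0 : 0 < t by exact: lt_le_trans st.
apply: ge0_ler_powR; rewrite ?invr_ge0 ?(ltW a0) // ?nnegrE.
- by rewrite subr_ge0 expR_le1 oppr_le0 mulr_ge0 // ltW.
- by rewrite subr_ge0 expR_le1 oppr_le0 mulr_ge0 // ltW.
- by rewrite lerD2l lerN2 ler_expR lerN2 ler_wpM2l // ltW.
Qed.

(** Its role is uniformity: the gradients at all times after [s] share the operator bound valid at
    [s]. *)
Lemma ou_kappa_le s t : 0 < s -> s <= t -> kappa t <= kappa s.
Proof.
move=> s0 st; have a1 : 0 < alpha - 1 by case/andP: alpha12; rewrite subr_gt0.
have t0 : 0 < t by exact: lt_le_trans st.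
have cs := ou_scale_gt0 alpha12 s0; have ct := ou_scale_gt0 alpha12 t0.
rewrite /ou_kappa; apply: ler_pM.
- exact: expR_ge0.
- rewrite invr_ge0; exact: powR_ge0.
- by rewrite ler_expR lerN2 ler_wpM2l // ltW.
- have hs := powR_gt0 (alpha - 1) cs; have ht := powR_gt0 (alpha - 1) ct.
  apply: (pinv_le hs); apply: ge0_ler_powR; [exact: ltW|exact: ltW|exact: ltW|exact: ou_scale_le].
Qed.

Section right_continuity.
Variables (t : R) (t_ : nat -> R).
Hypothesis t0 : 0 < t.
Hypothesis t_gt : forall n, t < t_ n.
Hypothesis t_cvg : t_ n @[n --> \oo] --> t.

Let tn0 n : 0 < t_ n. Proof. exact: lt_trans (t_gt n). Qed.

Let cvg_exp (a : R) : expR (- (a * t_ n)) @[n --> \oo] --> expR (- (a * t)).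
Proof.
apply: continuous_cvg; first exact: continuous_expR.
by apply: cvgN; apply: cvgMr.
Qed.

Lemma cvg_ou_scale : c_ (t_ n) @[n --> \oo] --> c_ t.
Proof.
have a0 : 0 < alpha by case/andP: alpha12 => a1 _; exact: lt_trans a1.
have pos s : 0 < s -> 0 < 1 - expR (- (alpha * s)).
  by move=> s0; rewrite subr_gt0 expR_lt1 oppr_lt0 mulr_gt0.
apply: cvg_powR; [exact: pos|by move=> n; exact: pos|].
by apply: cvgB => //; exact: cvg_cst.
Qed.

Lemma cvg_ou_kappa : kappa (t_ n) @[n --> \oo] --> kappa t.
Proof.
have c0 := ou_scale_gt0 alpha12 t0.
apply: cvgM; first exact: cvg_exp.
apply: cvgV; first by rewrite (gt_eqF (powR_gt0 _ c0)).
have h := cvg_powR (x := alpha - 1) c0 (fun n => ou_scale_gt0 alpha12 (tn0 n)) cvg_ou_scale.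
exact: h.
Qed.

(** The factor y_i is unbounded, so Fubini's theorem is applied with the integrable majorant M |y_i|
    on the product space. *)
Lemma measurable_mehler_grad s u i : tcl u -> measurable_fun setT (fun x => mehler_grad s u x 0 i).
Proof.
move=> tu; have [M [uM _]] := tcl_bounded_lipschitz tu.
have M0 : 0 <= M by exact: le_trans (normr_ge0 _) (uM 0).
under eq_fun do rewrite mehler_gradE; apply: measurable_funM => //.
pose g (z : V * V) := z.2 0 i * u (expR (- s) *: z.1 + c_ s *: z.2).
have mg : measurable_fun setT g.
  apply: measurable_funM; first exact: (measurableT_comp (measurable_coord i) measurable_snd).
  exact: (measurableT_comp (tcl_measurable tu) (measurable_lincomb _ _)).
have mg' : measurable_fun setT (EFin \o g) by exact/measurable_EFinP.
have iM := integrableZl measurableT M (integrable_abse (integrable_coord alpha12 mu_char i)).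
have maf : measurable_fun setT (abse \o (EFin \o g)) by exact: measurableT_comp.
have ig : (mu \x mu)%E.-integrable setT (EFin \o g).
  apply: (proj2 (@integrable12ltyP _ _ _ _ _ mu mu _ mg')).
  apply: (@le_lt_trans _ _ (\int[mu]_y (M%:E * `|(y 0 i)%:E|))%E); last first.
    have /integrableP[_] := iM; apply: le_lt_trans; apply: ge0_le_integral => //.
    - by move=> y _; rewrite mule_ge0.
    - by have /integrableP[] := iM.
    - by apply: measurableT_comp => //; have /integrableP[] := iM.
    - by move=> y _; exact: lee_abs.
  have If : (\int[mu]_y (M%:E * `|(y 0 i)%:E|))%E \is a fin_num.
    exact: integrable_fin_num.
  rewrite -(fineK If); apply: integral_le_cst.
  - have h := @measurable_fun_fubini_tonelli_F _ _ _ _ _ mu _ maf (fun z => abse_ge0 _).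
    exact: h.
  - by move=> x; exact: integral_ge0.
  - move=> x; rewrite fineK //; apply: ge0_le_integral => //.
    + exact: (measurableT_comp maf (measurable_pair1 x)).
    + by have /integrableP[] := iM.
    + by move=> y _; rewrite /g /= -EFinM lee_fin normrM mulrC ler_wpM2r.
have h := @measurable_fubini_F _ _ _ _ _ mu mu _ ig.
exact: (measurableT_comp (@fine_measurable R setT measurableT) h).
Qed.

Let mehler_grad_bound u (M : R) s i x : 0 <= M -> tcl u -> (forall x, `|u x| <= M) -> t <= s ->
  `|mehler_grad s u x 0 i| <= kappa t * (M * \int[mu]_y `|y 0 i|).
Proof.
move=> M0 tu uM ts; rewrite mehler_gradE normrM (ger0_norm (ou_kappa_ge0 alpha s)).
apply: ler_pM; [exact: ou_kappa_ge0|exact: normr_ge0|exact: ou_kappa_le|].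
have ii := integrable_coord alpha12 mu_char i.
have ia : mu.-integrable setT (EFin \o (fun y : V => `|y 0 i|)).
  by have h := integrable_abse ii; apply: eq_integrable h.
rewrite -RintegralZl // (le_trans (le_normr_Rintegral measurableT (imu s x i tu))) //.
apply: le_Rintegral => //.
- by have h := integrable_abse (imu s x i tu); apply: eq_integrable h.
- exact: (integrableZl measurableT M ia).
- by move=> y _; rewrite normrM mulrC ler_wpM2r.
Qed.

Lemma cvg_mehler_grad u i x : tcl u ->
  mehler_grad (t_ n) u x 0 i @[n --> \oo] --> mehler_grad t u x 0 i.
Proof.
move=> tu; have [M [uM _]] := tcl_bounded_lipschitz tu.
have M0 : 0 <= M by exact: le_trans (normr_ge0 _) (uM 0).
have e : (fun n => mehler_grad (t_ n) u x 0 i) = fun n => kappa (t_ n) *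
    \int[mu]_y (y 0 i * u (expR (- t_ n) *: x + c_ (t_ n) *: y)).
  by apply/funext => n; exact: mehler_gradE.
rewrite e (mehler_gradE t u x i).
apply: cvgM; first exact: cvg_ou_kappa.
apply: (@cvg_Rintegral_dominated _ _ _ mu _ _ _ (fun y => M * `|y 0 i|)) => //.
- by move=> n; have /integrableP[/measurable_EFinP] := imu (t_ n) x i tu.
- move=> y _; apply: cvgM; first exact: cvg_cst.
  apply: continuous_cvg; first exact: tcl_continuous.
  apply: cvgD; apply: cvgZr_tmp; [|exact: cvg_ou_scale].
  by have := @cvg_exp 1; rewrite mul1r; under eq_fun do rewrite mul1r.
- have h := integrableZl measurableT M
    (integrable_abse (integrable_coord alpha12 mu_char i)).
  by apply: eq_integrable h.
- by move=> n y _; rewrite normrM mulrC ler_wpM2r.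
Qed.

(** The coordinates of [mehler_grad] converge pointwise and, at times after [t], are bounded by a
    constant, so dominated convergence in L^p applies. *)
Lemma grad_extension_cvg_stest u : stest u ->
  (fun n => vN (DP (t_ n) u - DP t u)) @ \oo --> 0%E.
Proof.
move=> su; have tu := su.2; have [M [uM _]] := tcl_bounded_lipschitz tu.
have M0 : 0 <= M by exact: le_trans (normr_ge0 _) (uM 0).
have hu := stest_Lfun su.
have h i : (fun n => N (fun x => mehler_grad (t_ n) u x 0 i - mehler_grad t u x 0 i)) @ \oo --> 0%E.
  apply: (cvg_Lnorm_dominated p0 (g := cst (kappa t * (M * \int[mu]_y `|y 0 i|)))) => //.
  - by move=> n; exact: measurable_mehler_grad.
  - exact: measurable_mehler_grad.
  - by move=> x; exact: cvg_mehler_grad.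
  - by move=> n x; apply: mehler_grad_bound => //; exact: ltW.
  - exact: Lnorm_cst_lty.
have mmg s : measurable_fun setT (mehler_grad s u).
  by apply: measurable_fun_rV => i; exact: measurable_mehler_grad.
have e n : vN (DP (t_ n) u - DP t u) = vN (mehler_grad (t_ n) u - mehler_grad t u).
  apply: ae_eq_vLnorm => //.
  - by apply: measurable_rVB; exact: mDP.
  - exact: measurable_rVB.
  - have := grad_extension_stest (tn0 n) su; have := grad_extension_stest t0 su.
    by apply: filterS2 => x h1 h2; rewrite /GRing.add /= /GRing.opp /= h1 h2.
under eq_fun do rewrite e.
apply: (@squeeze_cvge _ _ _ _ (cst 0%E) _ (fun n => \sum_i N (fun x =>
    mehler_grad (t_ n) u x 0 i - mehler_grad t u x 0 i))%E).
- apply: nearW => n; rewrite vLnorm_ge0 /=.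
  exact: vLnormB_le_sum.
- exact: cvg_cst.
- have h' : (\sum_(i < d) N (fun x => (mehler_grad (t_ n) u x 0 i - mehler_grad t u x 0 i)%R)
      @[n --> \oo] --> \sum_(i < d) 0)%E.
    by apply: cvg_nnesum => [i _|i _]; [apply: nearW => n; exact: Lnorm_ge0|exact: h].
  by rewrite big1 in h'.
Qed.

Lemma grad_extension_cvg (F_ : nat -> V -> R) F : (forall n, F_ n \in Lfun mu p%:E) ->
  F \in Lfun mu p%:E -> (fun n => N (fun x => F_ n x - F x)) @ \oo --> 0%E ->
  (fun n => vN (DP (t_ n) (F_ n) - DP t F)) @ \oo --> 0%E.
Proof.
move=> hFn hF cF; set K := kappa t * c.
have K0 : 0 <= K by rewrite mulr_ge0 ?ou_kappa_ge0.
have [mf _] := (Lfun_mem _ _ _).1 hF.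
apply/cvge_0P => [n|e e0]; first exact: vLnorm_ge0.
have K4 : 0 < 2 * K + 2 by move: K0; lra.
(* From [F_ n] to [F] to [u] costs 2 r, multiplied by [K]; the change of time on [u] and the return
   from [u] to [F] cost r each. *)
pose r := e / (2 * K + 2).
have r0 : 0 < r by rewrite divr_gt0.
have [u su [u1 u2]] := grad_extension_approx t0 hF r0.
have hu := stest_Lfun su; have [muu _] := (Lfun_mem _ _ _).1 hu.
have := grad_extension_cvg_stest su => /cvge_0P => /(_ (fun n => Lnorm_ge0 _ _ _))/(_ r r0) c1.
have := cF => /cvge_0P => /(_ (fun n => Lnorm_ge0 _ _ _))/(_ r r0) c2.
apply: filterS2 c1 c2 => n n1 n2.
have [mfn _] := (Lfun_mem _ _ _).1 (hFn n).
have m1 := mDP (tn0 n) (hFn n); have m2 := mDP t0 hF.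
have m3 := mDP (tn0 n) hu; have m4 := mDP t0 hu.
have h1 : (vN (DP (t_ n) (F_ n) - DP (t_ n) u) <= (K * (2 * r))%:E)%E.
  rewrite (le_trans (grad_extension_lipschitz (tn0 n) (hFn n) hu)) // [X in (_ <= X)%E]EFinM.
  have kt : ((kappa (t_ n) * c)%:E <= K%:E)%E.
    by rewrite lee_fin; exact: (ler_wpM2r c_ge0 (ou_kappa_le t0 (ltW (t_gt n)))).
  rewrite (le_trans (lee_wpmul2r (Lnorm_ge0 _ _ _) kt)) //.
  apply: lee_wpmul2l; first by rewrite lee_fin.
  rewrite (le_trans (Lnorm_triangle mu p1 mfn mf muu)) //.
  rewrite Lnorm_distC in u1.
  by rewrite (le_trans (leeD n2 u1)) // -EFinD lee_fin mulr2n mulrDl mul1r.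
rewrite (le_trans (vLnorm_triangle mu p1 m1 m3 m2)) //.
rewrite (le_trans (leeD h1 (vLnorm_triangle mu p1 m3 m4 m2))) //.
rewrite (le_trans (leeD2l _ (leeD n1 u2))) // -!EFinD lee_fin.
have -> : e = r * (2 * K + 2) by rewrite divfK ?gt_eqF.
lra.
Qed.

End right_continuity.
End extension.

(** * The dual semigroup *)

Section Lp_duality.
Context dT (T : measurableType dT) (R : realType) (mu : probability T R).
Local Notation N r f := ('N[mu]_r%:E [EFin \o f%R])%E.
Implicit Types f g : T -> R.

Lemma conjugateP (p : R) : 1 < p -> [/\ 0 < p, 1 < p / (p - 1) & p^-1 + (p / (p - 1))^-1 = 1].
Proof.
move=> p1; have p0 : 0 < p by exact: lt_trans p1.
split => //; first by rewrite ltr_pdivlMr ?subr_gt0 // mul1r ltrBlDr ltrDl.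
by rewrite invf_div; field; rewrite gt_eqF.
Qed.

Lemma hoelder_Rintegral (p q : R) f g : 0 < p -> 0 < q -> p^-1 + q^-1 = 1 ->
  measurable_fun setT f -> measurable_fun setT g ->
  (N p f < +oo)%E -> (N q g < +oo)%E ->
  mu.-integrable setT (EFin \o (fun x => f x * g x)) /\
  ((`|\int[mu]_x (f x * g x)|)%:E <= N p f * N q g)%E.
Proof.
move=> p0 q0 pq mf mg fy gy.
have h := hoelder mu mf mg p0 q0 pq; rewrite Lnorm1 in h.
have mfg : measurable_fun setT (EFin \o (fun x => f x * g x)).
  by apply/measurable_EFinP; exact: measurable_funM.
have i1 : mu.-integrable setT (EFin \o (fun x => f x * g x)).
  apply/integrableP; split => //; apply: le_lt_trans h _.
  by rewrite lte_mul_pinfty // ?Lnorm_ge0 // ge0_fin_numE // Lnorm_ge0.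
split => //; apply: le_trans h.
rewrite (le_trans _ (le_abse_integral mu measurableT _)) //.
rewrite /Rintegral -abse_EFin fineK //; exact: integrable_fin_num.
Qed.

Lemma bounded_Lfun (q M : R) g : 0 < q -> measurable_fun setT g ->
  (forall x, `|g x| <= M) -> (N q g < +oo)%E.
Proof.
move=> q0 mg gM; have My : (N q (cst M) < +oo)%E.
  by have /Lfun_mem[] := @Lfun_cst _ _ _ mu M q.
apply: le_lt_trans My; apply: le_Lnorm => // x.
by rewrite (le_trans (gM x)) // ler_norm.
Qed.

(** Dividing by A^(1/q), q being the conjugate exponent, leaves A^(1/p) <= C. This closes the
    duality argument once A is finite. *)
Lemma powR_div_le (p C A : R) : 1 < p -> 0 <= C -> 0 <= A ->
  A <= C * A `^ (p / (p - 1))^-1 -> A <= C `^ p.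
Proof.
move=> p1 C0; have [p0 _ pq] := conjugateP p1.
rewrite le_eqVlt => /predU1P[<- _|A0 h]; first exact: powR_ge0.
have Ap : 0 < A `^ p^-1 by rewrite powR_gt0.
have e : A = A `^ p^-1 * A `^ (p / (p - 1))^-1.
  by rewrite -powRD ?pq ?powRr1 ?(ltW A0) // (gt_eqF A0) implybT.
have Aq : 0 < A `^ (p / (p - 1))^-1 by rewrite powR_gt0.
have h2 : A `^ p^-1 <= C by move: h; rewrite {1}e ler_pM2r.
have -> : A = (A `^ p^-1) `^ p by rewrite -powRrM mulVf ?gt_eqF // powRr1 // ltW.
by apply: ge0_ler_powR; rewrite ?nnegrE // ltW.
Qed.

(* The test functions are truncations of sgn f * |f|^(p-1), the equality case
   of Hoelder's inequality. *)
Lemma Lnorm_dual_le (p C : R) f : 1 < p -> 0 <= C -> measurable_fun setT f ->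
  (N p f < +oo)%E ->
  (forall (g : T -> R) (M : R), measurable_fun setT g -> (forall x, `|g x| <= M) ->
    ((\int[mu]_x (f x * g x))%:E <= C%:E * N (p / (p - 1)) g)%E) ->
  (N p f <= C%:E)%E.
Proof.
move=> p1 C0 mf fy h; have [p0 q1 pq] := conjugateP p1.
have q0 : 0 < p / (p - 1) by exact: lt_trans q1.
set q := p / (p - 1) in q0 q1 pq h *.
pose G n x : R := Num.min `|f x| n%:R.
have maf : measurable_fun setT (fun x => `|f x|).
  exact: (measurableT_comp (@normr_measurable R setT)).
have mG n : measurable_fun setT (G n) by apply: measurable_minr.
have G0 n x : 0 <= G n x by rewrite le_min normr_ge0 ler0n.
have Gf n x : G n x <= `|f x| by rewrite ge_min lexx.
have Gn n x : `|G n x| <= n%:R by rewrite ger0_norm // ge_min lexx orbT.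
have NG n : (N p (G n) <= C%:E)%E.
  apply/(Lnorm_le mu p0 _ C0).
  pose s x : R := if 0 <= f x then 1 else -1.
  have ms : measurable_fun setT s.
    by apply: measurable_fun_ifT => //; exact: measurable_fun_ler.
  have s1 x : `|s x| = 1 by rewrite /s; case: ifP => _; rewrite ?normrN normr1.
  have fs x : f x * s x = `|f x|.
    rewrite /s; case: (leP 0 (f x)) => f0; first by rewrite mulr1 ger0_norm.
    by rewrite mulrN1 ltr0_norm.
  pose g x := s x * G n x `^ (p - 1).
  have mGp (r : R) : measurable_fun setT (fun x => G n x `^ r).
    by apply: (measurableT_comp (measurable_powR r)).
  have mg : measurable_fun setT g by exact: measurable_funM.
  have p10 : 0 <= p - 1 by rewrite subr_ge0 ltW.
  have GM (r : R) x : 0 <= r -> `|G n x `^ r| <= n%:R `^ r.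
    move=> r0; rewrite ger0_norm ?powR_ge0 //.
    by apply: ge0_ler_powR; rewrite ?nnegrE ?ler0n // -[G n x]ger0_norm.
  have gM x : `|g x| <= n%:R `^ (p - 1) by rewrite normrM s1 mul1r GM.
  have iG : mu.-integrable setT (EFin \o (fun x => G n x `^ p)).
    apply: (bounded_integrable mu (mGp p)) => x; exact: GM (ltW p0).
  pose A := \int[mu]_x (G n x `^ p).
  have A0 : 0 <= A by apply: Rintegral_ge0 => x _; exact: powR_ge0.
  have AE : ((A%:E) = \int[mu]_x (`|G n x| `^ p)%:E)%E.
    rewrite /A /Rintegral fineK; last exact: integrable_fin_num.
    by apply: eq_integral => x _; rewrite ger0_norm.
  have Nq : (N q g = (A `^ q^-1)%:E)%E.
    have e1 : (N q g `^ q = A%:E)%E.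
      rewrite Lnorm_pow // AE; apply: eq_integral => x _; congr EFin.
      rewrite normrM s1 mul1r ger0_norm ?powR_ge0 // -powRrM ger0_norm //.
      by congr (_ `^ _); rewrite /q; field; rewrite gt_eqF // subr_gt0.
    by rewrite -[LHS]poweRe1 ?Lnorm_ge0 // -(@mulfV _ q) ?gt_eqF // poweRrM e1 poweR_EFin.
  have := h g _ mg gM; rewrite Nq -EFinM lee_fin => h1.
  rewrite -AE lee_fin; apply: powR_div_le => //; apply: le_trans h1.
  have [ifg _] := hoelder_Rintegral p0 q0 pq mf mg fy (bounded_Lfun q0 mg gM).
  apply: le_Rintegral => // x _.
  rewrite /g mulrA fs.
  have -> : G n x `^ p = G n x * G n x `^ (p - 1).
    have [->|Gx] := eqVneq (G n x) 0; first by rewrite mul0r powR0 // gt_eqF.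
    by rewrite -{2}(powRr1 (G0 n x)) -powRD ?(negbTE Gx) ?implybT // addrC subrK.
  by rewrite ler_wpM2r ?powR_ge0.
have cG : (fun n => N p (fun x => G n x - `|f x|)) @ \oo --> 0%E.
  apply: (cvg_Lnorm_dominated p0 (g := fun x => `|f x|)) => //.
  - move=> x; apply: (@cvg_trans _ (cst `|f x| @ \oo)); last exact: cvg_cst.
    apply: near_eq_cvg; near=> n; rewrite /G /cst; apply/esym/min_idPl.
    by near: n; exact: nbhs_infty_ger.
  - by move=> n x; rewrite ger0_norm.
  - by rewrite Lnorm_normr.
apply: (lee_addeps (K := 1)) => [|e e0]; first exact: ler01.
have := cG => /cvge_0P => /(_ (fun n => Lnorm_ge0 _ _ _))/(_ e e0).
move=> [n _ /(_ n (leqnn n))] /= hn.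
rewrite -Lnorm_normr.
have -> : (fun x => `|f x|) = (fun x => `|f x| - G n x) \+ G n.
  by apply/funext => x /=; rewrite subrK.
have mGn := mG n.
rewrite (le_trans (minkowski_EFin _ _ _ (ltW p1))) //; first exact: measurable_funB.
rewrite Lnorm_distC in hn.
by rewrite addeC mul1r leeD.
Unshelve. all: by end_near. Qed.

End Lp_duality.

Section dual_semigroup.
Context {R : realType} {d : nat}.
Local Notation V := 'rV[R]_d.
Variables (alpha : R) (mu : probability V R)
  (lambda : {finite_measure set V -> \bar R}).
Hypothesis alpha12 : 1 < alpha < 2.
Hypothesis mu_char : forall xi : V, char_fun mu xi =
  ((expR (- \int[lambda]_(y in usphere) (`|dotv y xi| `^ alpha)))%:C)%C.
Variable Pstar : R -> (V -> R) -> V -> R.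
Hypothesis Pstar_dual : dual_OU alpha mu Pstar.
Implicit Types f g u : V -> R.
Local Notation OU := (OU alpha mu).
Local Notation N r f := ('N[mu]_r%:E [EFin \o f%R])%E.

Let Lp_meas p f : f \in Lfun mu p%:E -> measurable_fun setT f.
Proof. by move=> /Lfun_mem[]. Qed.

Let Lp_lty (p : R) f : f \in Lfun mu p%:E -> (N p f < +oo)%E.
Proof. by move=> /Lfun_mem[]. Qed.

Let bounded_mem (q M : R) (g : V -> R) : 0 < q -> measurable_fun setT g ->
  (forall x, `|g x| <= M) -> g \in Lfun mu q%:E.
Proof. by move=> q0 mg gM; apply/Lfun_mem; split => //; exact: bounded_Lfun gM. Qed.

(** Tested against bounded functions, [D] is the adjoint image of [H], and the semigroup contracts
    the conjugate space. It is used for the image of one function, for a difference of two images,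
    and for an increment in time. *)
Lemma Lnorm_dual_OU (p t : R) (D H : V -> R) : 1 < p -> 0 <= t ->
  D \in Lfun mu p%:E -> H \in Lfun mu p%:E ->
  (forall (g : V -> R) (M : R), measurable_fun setT g -> (forall x, `|g x| <= M) ->
    \int[mu]_x (D x * g x) = \int[mu]_x (H x * OU t g x)) ->
  (N p D <= N p H)%E.
Proof.
move=> p1 t0 hD hH h; have [p0 q1 pq] := conjugateP p1.
have q0 : 0 < p / (p - 1) by exact: lt_trans q1.
have HF : (N p H \is a fin_num)%E by rewrite ge0_fin_numE ?Lnorm_ge0 // Lp_lty.
rewrite -(fineK HF); apply: Lnorm_dual_le => //.
- by rewrite fine_ge0 // Lnorm_ge0.
- exact: Lp_meas hD.
- exact: Lp_lty.
move=> g M mg gM; rewrite (h g M) // (fineK HF).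
have mO := OU_measurable alpha mu t mg gM.
have [_ ho] := hoelder_Rintegral p0 q0 pq (Lp_meas hH) mO (Lp_lty hH)
  (bounded_Lfun mu q0 mO (fun x => OU_bounded alpha mu t x mg gM)).
apply: (le_trans _ (lee_wpmul2l (Lnorm_ge0 _ _ _)
  (OU_Lnorm_le alpha12 mu_char t0 q1 mg gM))).
by apply: le_trans ho; rewrite lee_fin ler_norm.
Qed.

Lemma dual_mem (p t : R) f : 1 < p -> 0 <= t -> f \in Lfun mu p%:E ->
  Pstar t f \in Lfun mu p%:E.
Proof. by move=> p1 t0 hf; have [] := Pstar_dual p1 t0 hf. Qed.

Lemma dual_adjoint (p t M : R) f g : 1 < p -> 0 <= t -> f \in Lfun mu p%:E ->
  measurable_fun setT g -> (forall x, `|g x| <= M) ->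
  \int[mu]_x (Pstar t f x * g x) = \int[mu]_x (f x * OU t g x).
Proof.
move=> p1 t0 hf mg gM; have [_] := Pstar_dual p1 t0 hf; apply.
have [_ q1 _] := conjugateP p1; have q0 : 0 < p / (p - 1) by exact: lt_trans q1.
exact: bounded_mem gM.
Qed.

Lemma dual_contraction (p t : R) f : 1 < p -> 0 <= t -> f \in Lfun mu p%:E ->
  (N p (Pstar t f) <= N p f)%E.
Proof.
move=> p1 t0 hf; apply: (Lnorm_dual_OU p1 t0) => //; first exact: dual_mem.
by move=> g M mg gM; exact: (dual_adjoint p1 t0 hf mg gM).
Qed.

Let LpB p f g : 1 < p -> f \in Lfun mu p%:E -> g \in Lfun mu p%:E ->
  (fun x => f x - g x) \in Lfun mu p%:E.
Proof.
move=> p1 hf hg; have p0 : 0 < p by exact: lt_trans p1.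
have mf := Lp_meas hf; have mg := Lp_meas hg; have m0 := @measurable_cst _ _ _ _ (setT : set V) (0 : R).
apply/Lfun_mem; split; first exact: measurable_funB.
have {1}-> : (fun x => f x - g x) = f \+ (fun x => -1 * g x).
  by apply/funext => x /=; rewrite mulN1r.
apply: (@le_lt_trans _ _ (N p f + N p (fun x => (-1 * g x)%R))%E).
  by apply: minkowski_EFin => //; [exact: measurable_funM|exact: ltW].
by rewrite Lnorm_scale // normrN1 mul1e lte_add_pinfty // Lp_lty.
Qed.

Let bounded_integrableM (p M : R) f g : 1 < p -> f \in Lfun mu p%:E ->
  measurable_fun setT g -> (forall x, `|g x| <= M) ->
  mu.-integrable setT (EFin \o (fun x => f x * g x)).
Proof.
move=> p1 hf mg gM; have [p0 q1 pq] := conjugateP p1.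
have q0 : 0 < p / (p - 1) by exact: lt_trans q1.
by have [] := hoelder_Rintegral p0 q0 pq (Lp_meas hf) mg (Lp_lty hf) (bounded_Lfun mu q0 mg gM).
Qed.

Let RintegralBM (p M : R) f1 f2 g : 1 < p -> f1 \in Lfun mu p%:E -> f2 \in Lfun mu p%:E ->
  measurable_fun setT g -> (forall x, `|g x| <= M) ->
  \int[mu]_x ((f1 x - f2 x) * g x) = \int[mu]_x (f1 x * g x) - \int[mu]_x (f2 x * g x).
Proof.
move=> p1 h1 h2 mg gM; rewrite -RintegralB //; last 2 first.
- exact: (bounded_integrableM p1 h1 mg gM).
- exact: (bounded_integrableM p1 h2 mg gM).
by apply: eq_Rintegral => x _; rewrite mulrBl.
Qed.

Lemma dual_contractionB (p t : R) f1 f2 : 1 < p -> 0 <= t ->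
  f1 \in Lfun mu p%:E -> f2 \in Lfun mu p%:E ->
  (N p (fun x => (Pstar t f1 x - Pstar t f2 x)%R) <= N p (fun x => (f1 x - f2 x)%R))%E.
Proof.
move=> p1 t0 h1 h2; have d1 := dual_mem p1 t0 h1; have d2 := dual_mem p1 t0 h2.
apply: (Lnorm_dual_OU p1 t0); [exact: LpB|exact: LpB|].
move=> g M mg gM; have mO := OU_measurable alpha mu t mg gM.
have bO x := OU_bounded alpha mu t x mg gM.
rewrite (RintegralBM p1 d1 d2 mg gM) (RintegralBM p1 h1 h2 mO bO).
by rewrite (dual_adjoint p1 t0 h1 mg gM) (dual_adjoint p1 t0 h2 mg gM).
Qed.

(** The semigroup law is transposed by duality: tested against g, the increment from t to s + t
    equals the increment from 0 to s tested against [OU t g]. *)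
Lemma dual_increment (p s t : R) f : 1 < p -> 0 < s -> 0 < t -> f \in Lfun mu p%:E ->
  (N p (fun x => (Pstar (s + t) f x - Pstar t f x)%R) <=
   N p (fun x => (Pstar s f x - f x)%R))%E.
Proof.
move=> p1 s0 t0 hf; have st0 := addr_gt0 s0 t0.
have d1 := dual_mem p1 (ltW st0) hf; have d2 := dual_mem p1 (ltW t0) hf.
have d3 := dual_mem p1 (ltW s0) hf.
apply: (Lnorm_dual_OU p1 (ltW t0)); [exact: LpB|exact: LpB|].
move=> g M mg gM; have mO := OU_measurable alpha mu t mg gM.
have bO x := OU_bounded alpha mu t x mg gM.
rewrite (RintegralBM p1 d1 d2 mg gM) (RintegralBM p1 d3 hf mO bO).
rewrite (dual_adjoint p1 (ltW st0) hf mg gM) (dual_adjoint p1 (ltW t0) hf mg gM).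
have e := dual_adjoint p1 (ltW s0) hf mO bO; apply: (etrans _ (congr1 (fun z => z - \int[mu]_x (f x * OU t g x)) (esym e))).
apply: (congr1 (fun z => z - \int[mu]_x (f x * OU t g x))).
apply: eq_Rintegral => x _; congr (_ * _).
by rewrite (OU_semigroup alpha12 mu_char x s0 t0 mg gM).
Qed.

Section strong_continuity.
Variable s_ : nat -> R.
Hypothesis s_gt0 : forall n, 0 < s_ n.
Hypothesis s_cvg : s_ n @[n --> \oo] --> (0 : R).

Let a0 : 0 < alpha. Proof. by case/andP: alpha12 => h _; exact: lt_trans h. Qed.

Let cvg_exp (a : R) : expR (- (a * s_ n)) @[n --> \oo] --> (1 : R).
Proof.
rewrite -[X in _ --> X]expR0; apply: continuous_cvg; first exact: continuous_expR.
by rewrite -oppr0; apply: cvgN; rewrite -[X in _ --> X](mulr0 a); apply: cvgMr.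
Qed.

Lemma cvg_ou_scale0 : ou_scale alpha (s_ n) @[n --> \oo] --> (0 : R).
Proof.
have ai : 0 < alpha^-1 by rewrite invr_gt0.
have h := (cvg_at_rightP (fun a : R => a `^ alpha^-1) 0 0).1 (powR_cvg0 ai).
apply: (h (fun n => 1 - expR (- (alpha * s_ n)))); split.
  by move=> n; rewrite subr_gt0 expR_lt1 oppr_lt0 mulr_gt0.
rewrite -(subrr (1 : R)); apply: cvgB; [exact: cvg_cst|exact: cvg_exp].
Qed.

Lemma cvg_OU0 u x : tcl u -> OU (s_ n) u x @[n --> \oo] --> u x.
Proof.
move=> tu; have [M [uM _]] := tcl_bounded_lipschitz tu.
rewrite -[X in _ --> X](Rintegral_cst_prob mu (u x)).
apply: (@cvg_Rintegral_bounded _ _ _ mu _ _ M) => //.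
- by move=> n; apply: measurable_mehler; exact: tcl_measurable.
- move=> y; apply: continuous_cvg; first exact: tcl_continuous.
  rewrite -[X in _ --> X](addr0 x) -[X in X + _](scale1r x) -(scale0r y).
  apply: cvgD; apply: cvgZr_tmp; last exact: cvg_ou_scale0.
  by have := @cvg_exp 1; under eq_fun do rewrite mul1r.
Qed.

Let sqrE (f : V -> R) : (\int[mu]_x (`|f x| `^ 2)%:E = \int[mu]_x (f x ^+ 2)%:E)%E.
Proof. by apply: eq_integral => x _; rewrite powR_mulrn // real_normK ?num_real. Qed.

(* |P* u - u|^2 <= 2 |u|^2 - 2 <u, P u> by duality and contraction in L^2 *)
Lemma dual_L2_le n u : stest u ->
  (\int[mu]_x (`|Pstar (s_ n) u x - u x| `^ 2)%:E <=
    (2 * \int[mu]_x (u x * (u x - OU (s_ n) u x)))%:E)%E.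
Proof.
move=> su; have mu' := stest_measurable su; have [M [uM _]] := tcl_bounded_lipschitz su.2.
have s0 := ltW (s_gt0 n).
have mO := OU_measurable alpha mu (s_ n) mu' uM.
have bO x := OU_bounded alpha mu (s_ n) x mu' uM.
have lt12 : (1 : R) < 2 by rewrite ltr1n.
have h2 := bounded_mem (lt_trans ltr01 lt12) mu' uM.
have hP := dual_mem lt12 s0 h2.
have two : (2 : R) / (2 - 1) = 2 by rewrite (_ : 2 - 1 = 1) ?divr1 //; ring.
have [_ _] := conjugateP lt12; rewrite two => pq.
have p20 : (0 : R) < 2 by [].
have [iPP _] := hoelder_Rintegral p20 p20 pq (Lp_meas hP) (Lp_meas hP) (Lp_lty hP) (Lp_lty hP).
have iPu := bounded_integrableM lt12 hP mu' uM.
have iuu := bounded_integrableM lt12 h2 mu' uM.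
have iuO := bounded_integrableM lt12 h2 mO bO.
pose P := Pstar (s_ n) u.
have PP : \int[mu]_x (P x * P x) <= \int[mu]_x (u x * u x).
  rewrite -lee_fin /Rintegral !fineK; [|exact: integrable_fin_num|exact: integrable_fin_num].
  have := dual_contraction lt12 s0 h2 => c1.
  have := gt0_ler_poweR (ltW p20) _ _ c1; rewrite !in_itv /= !leey !Lnorm_ge0 => /(_ isT isT).
  rewrite !Lnorm_pow // !sqrE; congr (_ <= _)%E;
    by apply: eq_integral => x _; rewrite expr2.
have iD : mu.-integrable setT (EFin \o (fun x => P x * P x - 2 * (P x * u x) + u x * u x)).
  have := integrableD measurableT (integrableB measurableT iPP
    (integrableZl measurableT 2 iPu)) iuu.
  by apply: eq_integrable => // x _ /=; rewrite -EFinM -EFinB -EFinD.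
rewrite sqrE.
have -> : (\int[mu]_x ((Pstar (s_ n) u x - u x) ^+ 2)%:E =
    (\int[mu]_x (P x * P x - 2 * (P x * u x) + u x * u x))%:E)%E.
  rewrite /Rintegral fineK; last exact: integrable_fin_num.
  by apply: eq_integral => x _; congr EFin; rewrite /P; ring.
have i2 : mu.-integrable setT (EFin \o (fun x => 2 * (P x * u x))).
  exact: (integrableZl measurableT 2 iPu).
have i3 : mu.-integrable setT (EFin \o (fun x => P x * P x - 2 * (P x * u x))).
  have := integrableB measurableT iPP i2.
  by apply: eq_integrable => // x _ /=; rewrite -EFinB.
rewrite RintegralD // RintegralB // RintegralZl // (dual_adjoint lt12 s0 h2 mu' uM).
have -> : \int[mu]_x (u x * (u x - OU (s_ n) u x)) =
    \int[mu]_x (u x * u x) - \int[mu]_x (u x * OU (s_ n) u x).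
  by rewrite -RintegralB //; apply: eq_Rintegral => x _; rewrite mulrBr.
by rewrite lee_fin; move: PP; lra.
Qed.

(* |v|_p^p <= |v|_2 * | |v|^(p-1) |_2 for v = P* u - u, and the last factor is
   bounded by contraction in L^(2(p-1)). *)
Lemma cvg_dual_stest (p : R) u : 2 < p -> stest u ->
  (fun n => N p (fun x => Pstar (s_ n) u x - u x)) @ \oo --> 0%E.
Proof.
move=> p2 su; have mu' := stest_measurable su; have [M0 [uM _]] := tcl_bounded_lipschitz su.2.
have p1 : 1 < p by apply: lt_trans p2; rewrite ltr1n.
have p0 : 0 < p by exact: lt_trans p1.
pose r := 2 * (p - 1).
have r1 : 1 < r by rewrite /r; move: p2; lra.
have r0 : 0 < r by exact: lt_trans r1.
have hr := bounded_mem r0 mu' uM.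
have hp := bounded_mem p0 mu' uM.
have Nf : (N r u \is a fin_num)%E by rewrite ge0_fin_numE ?Lnorm_ge0 // Lp_lty.
pose M := 2 * fine (N r u).
have M_ge0 : 0 <= M by rewrite mulr_ge0 // fine_ge0 // Lnorm_ge0.
have lt12 : (1 : R) < 2 by rewrite ltr1n.
have p20 : (0 : R) < 2 by [].
have two : (2 : R) / (2 - 1) = 2 by rewrite (_ : 2 - 1 = 1) ?divr1 //; ring.
have [_ _] := conjugateP lt12; rewrite two => pq.
have h2 := bounded_mem p20 mu' uM.
have cd : \int[mu]_x (u x * (u x - OU (s_ n) u x)) @[n --> \oo] --> (0 : R).
  rewrite -[X in _ --> X](Rintegral_cst_prob mu 0).
  apply: (@cvg_Rintegral_bounded _ _ _ mu _ _ (M0 * (M0 + M0))) => //.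
  - move=> n; apply: measurable_funM => //; apply: measurable_funB => //.
    exact: OU_measurable uM.
  - move=> x; rewrite -[X in _ --> X](mulr0 (u x)); apply: cvgMr.
    by rewrite -(subrr (u x)); apply: cvgB; [exact: cvg_cst|exact: cvg_OU0 su.2].
  - move=> n x; rewrite normrM; apply: ler_pM => //.
    by rewrite (le_trans (ler_normB _ _)) // lerD // OU_bounded.
apply/cvge_0P => [n|e e0]; first exact: Lnorm_ge0.
pose B := M `^ (p - 1) + 1.
have B0 : 0 < B by rewrite ltr_wpDl ?powR_ge0.
(* An L^2 distance below [eta] makes the p-th power of the L^p distance at most eta M^(p-1), hence
   at most e^p. The added 1 keeps [B] positive. *)
pose eta := e `^ p / B.
have eta0 : 0 < eta by rewrite divr_gt0 ?powR_gt0.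
have : \forall n \near \oo, 2 * \int[mu]_x (u x * (u x - OU (s_ n) u x)) <= eta ^+ 2.
  have eta2 : 0 < eta ^+ 2 / 2 by rewrite divr_gt0 ?exprn_gt0.
  move/cvgrPdist_le : cd => /(_ _ eta2); apply: filterS => n.
  by rewrite sub0r normrN => /(le_trans (ler_norm _)); rewrite ler_pdivlMr // mulrC.
apply: filterS => n hn; have s0 := ltW (s_gt0 n).
pose D x := Pstar (s_ n) u x - u x.
have hPr := dual_mem r1 s0 hr; have hP2 := dual_mem lt12 s0 h2.
have hD2 : D \in Lfun mu (2 : R)%:E by exact: LpB.
have hDr : D \in Lfun mu r%:E by exact: LpB.
have mD := Lp_meas hD2.
have ND2 : (N 2 D <= eta%:E)%E.
  apply/(Lnorm_le mu p20 _ (ltW eta0)); rewrite powR_mulrn ?(ltW eta0) //.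
  by rewrite (le_trans (dual_L2_le n su)) // lee_fin.
have NDr : (N r D <= M%:E)%E.
  have {1}-> : D = Pstar (s_ n) u \+ (fun x => -1 * u x).
    by apply/funext => x /=; rewrite mulN1r.
  rewrite (le_trans (minkowski_EFin _ _ _ (ltW r1))) //.
  - exact: Lp_meas hPr.
  - exact: measurable_funM.
  rewrite Lnorm_scale // normrN1 mul1e (le_trans (leeD2r _ (dual_contraction r1 s0 hr))) //.
  by rewrite /M mulr2n mulrDl mul1r EFinD fineK.
pose g x := `|D x| `^ (p - 1).
have mg : measurable_fun setT g by exact: measurable_normrX_powR.
have Ng : (N 2 g <= (M `^ (p - 1))%:E)%E.
  apply/(Lnorm_le mu p20 _ (powR_ge0 _ _)).
  have := (Lnorm_le mu r0 D M_ge0).1 NDr.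
  rewrite -powRrM [(p - 1) * 2]mulrC -/r; apply: le_trans.
  rewrite le_eqVlt; apply/orP; left; apply/eqP; apply: eq_integral => x _.
  by rewrite ger0_norm ?powR_ge0 // -powRrM [(p - 1) * 2]mulrC.
have mn : measurable_fun setT (fun x => `|D x|).
  exact: (measurableT_comp (@normr_measurable R setT)).
have nD2 : (N 2 (fun x => `|D x|) < +oo)%E by rewrite Lnorm_normr Lp_lty.
have [ig hg] := hoelder_Rintegral p20 p20 pq mn mg nD2 (le_lt_trans Ng (ltry _)).
apply/(Lnorm_le mu p0 _ (ltW e0)).
apply: (@le_trans _ _ (eta * M `^ (p - 1))%:E).
  rewrite EFinM; apply: (@le_trans _ _ (N 2 (fun x => `|D x|) * N 2 g)%E).
    apply: le_trans hg; apply: (@le_trans _ _ (\int[mu]_x (`|D x| * g x))%:E).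
      rewrite /Rintegral fineK; last exact: integrable_fin_num.
      rewrite le_eqVlt; apply/orP; left; apply/eqP; apply: eq_integral => x _; congr EFin.
      rewrite /g -/(D x); have [->|Gx] := eqVneq `|D x| 0; first by rewrite mul0r powR0 // gt_eqF.
      by rewrite -[X in X * _](powRr1 (normr_ge0 (D x))) -powRD ?(negbTE Gx) ?implybT // addrC subrK.
    by rewrite lee_fin ler_norm.
  rewrite Lnorm_normr (le_trans (lee_wpmul2r (Lnorm_ge0 _ _ _) ND2)) //.
  by apply: lee_wpmul2l; rewrite // lee_fin ltW.
rewrite lee_fin /eta mulrAC ler_pdivrMr // ler_wpM2l ?powR_ge0 //.
by rewrite /B lerDl.
Qed.

Lemma cvg_dual0 (p : R) f : 2 < p -> f \in Lfun mu p%:E ->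
  (fun n => N p (fun x => Pstar (s_ n) f x - f x)) @ \oo --> 0%E.
Proof.
move=> p2 hf; have p1 : 1 < p by apply: lt_trans p2; rewrite ltr1n.
have mf := Lp_meas hf.
apply/cvge_0P => [n|e e0]; first exact: Lnorm_ge0.
have e3 : 0 < e / 3 by rewrite divr_gt0.
have [u su Nu] := stest_dense (ltW p1) hf e3.
have [M [uM _]] := tcl_bounded_lipschitz su.2; have mu' := stest_measurable su.
have hu := bounded_mem (lt_trans ltr01 p1) mu' uM.
have := cvg_dual_stest p2 su => /cvge_0P => /(_ (fun n => Lnorm_ge0 _ _ _))/(_ _ e3).
apply: filterS => n hn; have s0 := ltW (s_gt0 n).
have mPf := Lp_meas (dual_mem p1 s0 hf); have mPu := Lp_meas (dual_mem p1 s0 hu).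
have Nu' := Nu; rewrite Lnorm_distC in Nu'.
have h1 := le_trans (dual_contractionB p1 s0 hf hu) Nu'.
rewrite (le_trans (Lnorm_triangle mu (ltW p1) mPf mPu mf)) //.
rewrite (le_trans (leeD h1 (Lnorm_triangle mu (ltW p1) mPu mu' mf))) //.
rewrite (le_trans (leeD2l _ (leeD hn Nu))) // -!EFinD lee_fin; lra.
Qed.

Lemma cvg_dual (p t : R) f : 2 < p -> 0 < t -> f \in Lfun mu p%:E ->
  (fun n => N p (fun x => Pstar (s_ n + t) f x - Pstar t f x)) @ \oo --> 0%E.
Proof.
move=> p2 t0 hf; have p1 : 1 < p by apply: lt_trans p2; rewrite ltr1n.
apply: (squeeze_cvge _ (cvg_cst 0%E) (cvg_dual0 p2 hf)).
by apply: nearW => n; rewrite Lnorm_ge0 dual_increment.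
Qed.

End strong_continuity.
End dual_semigroup.

(** * Vector-valued integrals *)

Section riesz_fischer.
Context dT (T : measurableType dT) (R : realType) (mu : probability T R).
Variable p : R.
Hypothesis p1 : 1 < p.
Local Notation N f := ('N[mu]_p%:E [EFin \o f%R])%E.
Implicit Types (f G : T -> R) (u v : nat -> T -> R).

Let p0 : 0 < p. Proof. exact: lt_trans p1. Qed.

Lemma integral_norm_le_Lnorm f : measurable_fun setT f ->
  (\int[mu]_x (`|f x|)%:E <= N f)%E.
Proof.
move=> mf; have [_ q1 pq] := conjugateP p1; have q0 := lt_trans ltr01 q1.
have h := hoelder mu mf (@measurable_cst _ _ _ _ setT (1 : R)) p0 q0 pq.
rewrite Lnorm1 Lnorm_cst1_prob mule1 in h; apply: le_trans h.
rewrite le_eqVlt; apply/orP; left; apply/eqP; apply: eq_integral => x _.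
by rewrite /= mulr1.
Qed.

(** The integrals of the increments are summable, so the series of their absolute values is finite
    almost everywhere and the telescoping series converges there. *)
Lemma fast_cauchy_ae_cvg v : (forall k, measurable_fun setT (v k)) ->
  (forall k, (N (fun x => v k.+1 x - v k x) <= (2^-1 ^+ k)%:E)%E) ->
  exists2 G : T -> R, measurable_fun setT G &
    {ae mu, forall x, v k x @[k --> \oo] --> G x}.
Proof.
move=> mv hv.
have md k : measurable_fun setT (fun x => v k.+1 x - v k x) by exact: measurable_funB.
pose w k x := (`|v k.+1 x - v k x|)%:E.
have mw k : measurable_fun setT (w k).
  by apply/measurable_EFinP; exact: (measurableT_comp (@normr_measurable R setT)).
have w0 k x : (0 <= w k x)%E by rewrite lee_fin.
have iw : mu.-integrable setT (fun x => \sum_(0 <= k <oo) w k x)%E.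
  apply/integrableP; split; first by apply: ge0_emeasurable_sum => // k x _ _; exact: w0.
  under eq_integral do rewrite gee0_abs ?nneseries_ge0 //.
  rewrite integral_nneseries //.
  apply: (@le_lt_trans _ _ (\sum_(0 <= k <oo) (1 * 2^-1 ^+ k)%:E)%E).
    apply: lee_nneseries => [k _ _|k _]; first exact: integral_ge0.
    by rewrite mul1r (le_trans _ (hv k)) // integral_norm_le_Lnorm.
  have h1 : (0 : R) <= 2^-1 by rewrite invr_ge0.
  have h2 : (2^-1 : R) < 1 by rewrite invf_lt1 // ltr1n.
  by rewrite (le_lt_trans (nneseries_geometric_le ler01 h1 h2)) // ltry.
(* The upper limit is measurable on the whole space and equals the limit wherever the latter
   exists. *)
exists (fun x => fine (limn_esup (fun k => (v k x)%:E))).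
  apply: (measurableT_comp (@fine_measurable R setT measurableT)).
  by apply: measurable_fun_limn_esup => k; exact/measurable_EFinP.
apply: filterS (integrable_ae measurableT iw) => x /(_ I) sx.
suff [l vl] : exists l : R, v k x @[k --> \oo] --> l.
  suff -> : limn_esup (fun k => (v k x)%:E) = l%:E by [].
  have h : (v k x)%:E @[k --> \oo] --> l%:E by apply: cvg_EFin => //; exact: nearW.
  by rewrite (cvg_limn_einf_sup h).
pose tv := telescope (fun k => v k x).
have : cvgn [normed series tv].
  apply: nondecreasing_is_cvgn.
    by apply: nondecreasing_series => k _ _; exact: normr_ge0.
  exists (fine (\sum_(0 <= k <oo) w k x)%E) => _ [n _ <-].
  rewrite -lee_fin fineK //; have h0 := @nneseries_lim_ge R (fun k => w k x) xpredT 0 n (fun k _ _ => w0 k x).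
  by apply: le_trans h0; rewrite sumEFin.
move=> /normed_cvg /cvg_ex[l]; rewrite telescopeK => h.
exists (l + v 0%N x).
have -> : (fun k => v k x) = (fun k => (v k x - v 0%N x) + v 0%N x).
  by apply/funext => k; rewrite subrK.
by apply: cvgD; [exact: h|exact: cvg_cst].
Qed.

Lemma limn_einf_le (u : nat -> \bar R) (C : \bar R) K :
  (forall k, (K <= k)%N -> u k <= C)%E -> (limn_einf u <= C)%E.
Proof.
move=> uC; rewrite limn_einf_lim; apply: lime_le; first exact: is_cvg_einfs.
apply: nearW => n; apply: (@le_trans _ _ (u (maxn n K))); last exact/uC/leq_maxr.
by apply: ereal_inf_lbound; exists (maxn n K) => //=; exact: leq_maxl.
Qed.

Lemma Lp_complete u : (forall n, measurable_fun setT (u n)) ->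
  (forall e : R, 0 < e -> exists n0, forall n m, (n0 <= n)%N -> (n0 <= m)%N ->
    (N (fun x => u n x - u m x) <= e%:E)%E) ->
  exists2 G : T -> R, measurable_fun setT G & (fun n => N (fun x => u n x - G x)) @ \oo --> 0%E.
Proof.
move=> mu_ cu.
have h2 k : (0 : R) < 2^-1 ^+ k by rewrite exprn_gt0 // invr_gt0.
have [a ha] := choice (fun k => cu _ (h2 k)).
(* Cumulated ranks: [phi] is nondecreasing and stays above both [a k] and [k]. *)
pose phi k := (\sum_(j < k.+1) (a j).+1)%N.
have phiS k : (phi k <= phi k.+1)%N by rewrite /phi [leqRHS]big_ord_recr leq_addr.
have aphi k : (a k <= phi k)%N by rewrite /phi big_ord_recr /= (leq_trans (leqnSn _)) // leq_addl.
pose v k := u (phi k).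
have mv k : measurable_fun setT (v k) by exact: mu_.
have hv k : (N (fun x => v k.+1 x - v k x) <= (2^-1 ^+ k)%:E)%E.
  by apply: ha; [exact: leq_trans (aphi k) (phiS k)|exact: aphi].
have [G mG vG] := fast_cauchy_ae_cvg mv hv.
exists G => //; apply/cvge_0P => [n|e e0]; first exact: Lnorm_ge0.
have [n0 hn0] := cu e e0.
have phi_ge k : (k <= phi k)%N.
  elim: k => // k ih; rewrite /phi big_ord_recr /= -/(phi k) addnS ltnS.
  by rewrite (leq_trans ih) // leq_addr.
have hK k : (n0 <= k)%N -> (n0 <= phi k)%N by move=> h; exact: leq_trans h (phi_ge k).
near=> n.
apply/(Lnorm_le mu p0 _ (ltW e0)).
have mn k : measurable_fun setT (fun x => (`|u n x - v k x| `^ p)%:E).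
  by apply/measurable_EFinP; apply: measurable_normrX_powR; exact: measurable_funB.
have n0n : (n0 <= n)%N by near: n; exists n0.
have hn k : (n0 <= k)%N -> (\int[mu]_x (`|u n x - v k x| `^ p)%:E <= (e `^ p)%:E)%E.
  move=> Kk; apply/(Lnorm_le mu p0 (fun x => u n x - v k x) (ltW e0)).
  by apply: hn0 => //; exact: hK.
(* Fatou's lemma along the subsequence: the limit exists only almost everywhere and only on that
   subsequence. *)
apply: le_trans (limn_einf_le hn).
have mn0 k x : setT x -> (0 <= (`|u n x - v k x| `^ p)%:E)%E.
  by move=> _; rewrite lee_fin powR_ge0.
apply: le_trans (fatou mu measurableT mn mn0).
rewrite le_eqVlt; apply/orP; left; apply/eqP; apply: ae_eq_integral => //.
- by apply/measurable_EFinP; apply: measurable_normrX_powR; exact: measurable_funB.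
- have -> : (fun x => limn_einf (fun k => (`|u n x - v k x| `^ p)%:E)) =
      fun x => (- limn_esup (fun k => - (`|u n x - v k x| `^ p)%:E))%E.
    by apply/funext => x; rewrite (limn_esupN (fun k => (`|u n x - v k x| `^ p)%:E)) oppeK.
  apply: measurableT_comp => //; apply: measurable_fun_limn_esup => k.
  by apply: measurableT_comp => //.
- apply: filterS vG => x vx _.
  have h : (`|u n x - v k x| `^ p)%:E @[k --> \oo] --> (`|u n x - G x| `^ p)%:E.
    apply: cvg_EFin; first exact: nearW.
    apply: (cvg_normr_powR p0); apply: cvgB; [exact: cvg_cst|exact: vx].
  by rewrite (cvg_limn_einf_sup h).
Unshelve. all: by end_near. Qed.

End riesz_fischer.

(** * Step functions with values in L^p *)

Section step_functions.
Context {R : realType} {d : nat} (mu : probability 'rV[R]_d R).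
Local Notation V := 'rV[R]_d.
Variable p : R.
Hypothesis p1 : 1 < p.
Local Notation vN F := (vLnorm mu p F%R).
Local Notation N f := ('N[mu]_p%:E [EFin \o f%R])%E.
Local Notation vLp := (in_vLp mu p).

Let p1' : 1 <= p. Proof. exact: ltW. Qed.

Lemma cvg_vLnorm (F_ : nat -> V -> V) F : (forall n, vLp (F_ n)) -> vLp F ->
  (fun n => vN (F_ n - F)) @ \oo --> 0%E -> (fun n => vN (F_ n)) @ \oo --> vN F.
Proof.
move=> hn hF c.
have Ff : vN F \is a fin_num by rewrite ge0_fin_numE ?vLnorm_ge0 //; case: hF.
have Fnf n : vN (F_ n) \is a fin_num by rewrite ge0_fin_numE ?vLnorm_ge0 //; case: (hn n).
rewrite -(fineK Ff); apply: cvg_EFin; first exact: nearW.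
apply/cvgrPdist_le => e e0.
have := c => /cvge_0P => /(_ (fun n => vLnorm_ge0 _ _ _))/(_ e e0).
apply: filterS => n h /=.
have [mF _] := hF; have [mn _] := hn n.
have h1 : (vN F <= e%:E + vN (F_ n))%E.
  have {1}-> : F = (F - F_ n) + F_ n by rewrite subrK.
  rewrite (le_trans (vLnormD mu p1' _ _)) //; first exact: measurable_rVB.
  by rewrite vLnormC leeD2r.
have h2 : (vN (F_ n) <= e%:E + vN F)%E.
  have {1}-> : F_ n = (F_ n - F) + F by rewrite subrK.
  rewrite (le_trans (vLnormD mu p1' _ _)) //; first exact: measurable_rVB.
  by rewrite leeD2r.
move: h1 h2; rewrite -(fineK Ff) -(fineK (Fnf n)) -!EFinD !lee_fin => h1 h2.
by rewrite ler_norml; apply/andP; split; lra.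
Qed.

Lemma vLp_complete (F_ : nat -> V -> V) : (forall n, vLp (F_ n)) ->
  (forall e : R, 0 < e -> exists n0, forall n m, (n0 <= n)%N -> (n0 <= m)%N ->
    (vN (F_ n - F_ m) <= e%:E)%E) ->
  exists2 G, vLp G & (fun n => vN (F_ n - G)) @ \oo --> 0%E.
Proof.
move=> hF cF.
have mc n i : measurable_fun setT (fun x => F_ n x 0 i).
  by have [mF _] := hF n; exact: (measurableT_comp (measurable_coord i)).
have h i : exists g : V -> R, measurable_fun setT g /\
    (fun n => N (fun x => F_ n x 0 i - g x)) @ \oo --> 0%E.
  suff hc : forall e : R, 0 < e -> exists n0, forall n m, (n0 <= n)%N -> (n0 <= m)%N ->
      (N (fun x => F_ n x 0 i - F_ m x 0 i) <= e%:E)%E.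
    by have [g mg cg] := Lp_complete p1 (fun n => mc n i) hc; exists g.
  move=> e e0; have [n0 h] := cF e e0; exists n0 => n m n0n n0m.
  apply: le_trans (h n m n0n n0m).
  have [mn _] := hF n; have [mm _] := hF m.
  have := vLnorm_coord mu p1' i (measurable_rVB mn mm); apply: le_trans.
  rewrite le_eqVlt; apply/orP; left; apply/eqP.
  by apply: eq_Lnorm => x; rewrite /= !mxE.
have [g hg] := choice h.
pose G (x : V) : V := \row_i g i x.
have mG : measurable_fun setT G.
  by apply: measurable_fun_rV => i; under eq_fun do rewrite mxE; case: (hg i).
have cG : (fun n => vN (F_ n - G)) @ \oo --> 0%E.
  have hs : (\sum_(i < d) N (fun x => (F_ n x 0 i - G x 0 i)%R)
      @[n --> \oo] --> \sum_(i < d) 0)%E.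
    apply: cvg_nnesum => [i _|i _]; first by apply: nearW => n; exact: Lnorm_ge0.
    by have [_] := hg i; under [in X in _ -> X]eq_fun do under [X in EFin \o X]eq_fun do rewrite mxE.
  rewrite big1 // in hs; apply: (squeeze_cvge _ (cvg_cst 0%E) hs).
  apply: nearW => n; rewrite vLnorm_ge0 /=; apply: vLnormB_le_sum => //.
  by case: (hF n).
exists G => //; split => //.
have := cG => /cvge_0P => /(_ (fun n => vLnorm_ge0 _ _ _))/(_ 1 ltr01).
move=> [n _ /(_ n (leqnn n))] /= hn.
have [mn Fn] := hF n.
have -> : G = (G - F_ n) + F_ n by rewrite subrK.
rewrite (le_lt_trans (vLnormD mu p1' _ _)) //; first exact: measurable_rVB.
by rewrite vLnormC lte_add_pinfty // (le_lt_trans hn) // ltry.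
Qed.

Lemma in_vLp_sum (I : Type) (s : seq I) (F : I -> V -> V) : (forall i, vLp (F i)) ->
  vLp (\sum_(i <- s) F i).
Proof.
move=> hF; elim: s => [|i s ih]; first by rewrite big_nil; exact: in_vLp0.
by rewrite big_cons; exact: in_vLpD.
Qed.

(** The simple functions of [bochner_integral]. The sets may overlap, so the values taken are
    partial sums of the [v i]. *)
Definition step_fun k (A : nat -> set R) (v : nat -> V -> V) (t : R) : V -> V :=
  \sum_(i < k) (\1_(A i) t : R) *: v i.

Lemma in_vLp_step k A v t : (forall i, vLp (v i)) -> vLp (step_fun k A v t).
Proof. by move=> hv; apply: in_vLp_sum => i; exact: in_vLpZ. Qed.

Lemma step_funS k A v t :
  step_fun k.+1 A v t = step_fun k A v t + (\1_(A k) t : R) *: v k.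
Proof. by rewrite /step_fun big_ord_recr. Qed.

(** As the sets may overlap, the domain is split along the last one and its value is absorbed into
    the argument of [H]. The induction therefore runs over arbitrary [H] and [w]. *)
Lemma measurable_step k (D : set R) (A : nat -> set R) (v : nat -> V -> V)
    (H : R -> (V -> V) -> \bar R) : measurable D -> (forall i, measurable (A i)) ->
  (forall i, vLp (v i)) -> (forall w, vLp w -> measurable_fun D (H ^~ w)) ->
  forall w, vLp w -> measurable_fun D (fun t => H t (w + step_fun k A v t)).
Proof.
move=> mD mA hv; elim: k H => [|k ih] H mH w hw.
  by under eq_fun do rewrite /step_fun big_ord0 addr0; exact: mH.
pose H' t w := H t (w + (\1_(A k) t : R) *: v k).
have -> : (fun t => H t (w + step_fun k.+1 A v t)) =
    fun t => H' t (w + step_fun k A v t).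
  by apply/funext => t; rewrite /H' step_funS addrA.
apply: ih => // w' hw'.
have e : D = (D `&` A k) `|` (D `\` A k) by rewrite setUIDK.
rewrite e; apply/measurable_funU; [exact: measurableI|exact: measurableD|split].
- apply: (@eq_measurable_fun _ _ _ _ _ (fun t => H t (w' + v k))).
    by move=> t; rewrite inE => -[_ At]; rewrite /H' indicE mem_set // scale1r.
  apply: (measurable_funS mD); first exact: subIsetl.
  by apply: mH; exact: in_vLpD.
- apply: (@eq_measurable_fun _ _ _ _ _ (fun t => H t w')).
    by move=> t; rewrite inE => -[_ At]; rewrite /H' indicE memNset // scale0r addr0.
  by apply: (measurable_funS mD); [exact: subDsetl|exact: mH].
Qed.

Lemma measurable_step_norm k D A v w : measurable D -> (forall i, measurable (A i)) ->
  (forall i, vLp (v i)) -> vLp w ->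
  measurable_fun D (fun t => vN (w + step_fun k A v t)).
Proof.
move=> mD mA hv hw; apply: (@measurable_step k D A v (fun _ => vLnorm mu p)) => //.
Qed.

Local Notation leb := (@lebesgue_measure R).

(* The shift w and the set E serve the induction on k, which splits E along A k. *)
Lemma step_integral_le_aux k (A : nat -> set R) (v : nat -> V -> V) : (forall i, measurable (A i)) ->
  (forall i, vLp (v i)) -> forall (E : set R) w, measurable E -> (leb E < +oo)%E -> vLp w ->
  (vN (fine (leb E) *: w + \sum_(i < k) fine (leb (A i `&` E)) *: v i) <=
   \int[leb]_(t in E) vN (w + step_fun k A v t))%E.
Proof.
move=> mA hv; elim: k => [|k ih] E w mE Ey hw.
  under eq_integral do rewrite /step_fun big_ord0 addr0.
  rewrite big_ord0 addr0 vLnormZ //; last by case: hw.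
  rewrite ger0_norm ?fine_ge0 // fineK ?ge0_fin_numE //.
  by rewrite muleC -integral_cst.
pose E1 := E `&` A k; pose E2 := E `\` A k.
have mE1 : measurable E1 by exact: measurableI.
have mE2 : measurable E2 by exact: measurableD.
have E1y : (leb E1 < +oo)%E by rewrite (le_lt_trans _ Ey) // le_measure ?inE //; exact: subIsetl.
have E2y : (leb E2 < +oo)%E by rewrite (le_lt_trans _ Ey) // le_measure ?inE //; exact: subDsetl.
have eE : E = E1 `|` E2 by rewrite /E1 /E2 setUIDK.
have dis : [disjoint E1 & E2].
  by apply/eqP/seteqP; split => t // [[_ ?] [_ ?]].
have lebE (B : set R) : measurable B -> fine (leb (B `&` E)) =
    fine (leb (B `&` E1)) + fine (leb (B `&` E2)).
  move=> mB; rewrite {1}eE setIUr measureU //; last 3 first.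
  - exact: measurableI.
  - exact: measurableI.
  - by apply/seteqP; split => t // [[_ [_ ?]] [_ [_ ?]]].
  have fn (E' : set R) : measurable E' -> (leb E' < +oo)%E -> leb (B `&` E') \is a fin_num.
    move=> mE' E'y; rewrite ge0_fin_numE // (le_lt_trans _ E'y) // le_measure ?inE //.
    exact: measurableI.
  by rewrite fineD ?fn.
have hwk : vLp (w + v k) by exact: in_vLpD.
have i1 := ih E1 _ mE1 E1y hwk; have i2 := ih E2 _ mE2 E2y hw.
rewrite eE ge0_integral_setU //; last 2 first.
- by rewrite -eE; exact: (@measurable_step_norm k.+1 E A v w mE mA hv hw).
- by move=> t _; exact: vLnorm_ge0.
have -> : (\int[leb]_(t in E1) vN (w + step_fun k.+1 A v t) =
    \int[leb]_(t in E1) vN ((w + v k) + step_fun k A v t))%E.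
  apply: eq_integral => t; rewrite inE => -[_ At].
  by rewrite step_funS indicE mem_set // scale1r addrA addrAC.
have -> : (\int[leb]_(t in E2) vN (w + step_fun k.+1 A v t) =
    \int[leb]_(t in E2) vN (w + step_fun k A v t))%E.
  apply: eq_integral => t; rewrite inE => -[_ At].
  by rewrite step_funS indicE memNset // scale0r addr0.
apply: le_trans (leeD i1 i2); rewrite -eE.
set X1 := (X in (_ <= vN X + _)%E); set X2 := (X in (_ <= _ + vN X)%E).
have mX1 : measurable_fun setT X1.
  have [] : vLp X1 by apply: (in_vLpD p1'); [exact: in_vLpZ|apply: in_vLp_sum => i; exact: in_vLpZ].
  by [].
have mX2 : measurable_fun setT X2.
  have [] : vLp X2 by apply: (in_vLpD p1'); [exact: in_vLpZ|apply: in_vLp_sum => i; exact: in_vLpZ].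
  by [].
have <- : X1 + X2 = fine (leb E) *: w + \sum_(i < k.+1) fine (leb (A i `&` E)) *: v i.
  rewrite /X1 /X2 big_ord_recr /=.
  under [in RHS]eq_bigr do rewrite lebE // scalerDl.
  rewrite big_split /= -[in RHS](setTI E) lebE // !setTI.
  have -> : A k `&` E = E1 by rewrite setIC.
  rewrite scalerDr scalerDl.
  set a := _ *: w; set b := _ *: w; set e := _ *: v k; set S1 := \sum_i _; set S2 := \sum_i _.
  by rewrite -!addrA; congr (_ + _); rewrite addrC -!addrA addrCA.
exact: vLnormD.
Qed.

(** The auxiliary inequality is applied with shift 0 on the union of the sets, which has finite
    measure whereas [D] may not. *)
Lemma step_integral_le k D (A : nat -> set R) (v : nat -> V -> V) : measurable D -> (forall i, measurable (A i)) ->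
  (forall i, A i `<=` D) -> (forall i, (leb (A i) < +oo)%E) -> (forall i, vLp (v i)) ->
  (vN (\sum_(i < k) fine (leb (A i)) *: v i)%R <= \int[leb]_(t in D) vN (step_fun k A v t))%E.
Proof.
move=> mD mA AD Ay hv.
pose E := \big[setU/set0]_(i < k) A i.
have mE : measurable E by exact: bigsetU_measurable.
have Ey : (leb E < +oo)%E.
  rewrite (le_lt_trans (Boole_inequality _ _)) //; first by move=> i _; exact: mA.
  by apply: lte_sum_pinfty => i _; exact: Ay.
have AE (i : 'I_k) : A i `&` E = A i by apply/setIidPl; exact: bigsetU_sup.
have := step_integral_le_aux k mA hv mE Ey (in_vLp0 mu p1').
rewrite scaler0 add0r; under eq_bigr do rewrite AE.
move=> h; apply: le_trans h _; under eq_integral do rewrite add0r.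
apply: ge0_subset_integral => //.
  by under eq_fun do rewrite -[step_fun _ _ _ _]add0r; apply: measurable_step_norm => //; exact: in_vLp0.
- by move=> t _; exact: vLnorm_ge0.
- by move=> t; rewrite /E -bigcup_mkord => -[i _]; exact: AD.
Qed.

End step_functions.

(** * Bochner integrals of right-continuous families *)

Section bochner.
Context {R : realType} {d : nat} (mu : probability 'rV[R]_d R).
Local Notation V := 'rV[R]_d.
Variable p : R.
Hypothesis p1 : 1 < p.
Local Notation vN F := (vLnorm mu p F%R).
Local Notation vLp := (in_vLp mu p).
Local Notation leb := (@lebesgue_measure R).
Local Notation D := (`]0, +oo[%classic : set R).

Let p1' : 1 <= p. Proof. exact: ltW. Qed.

(** The difference of two step functions is again one, indexed by the concatenation of the two
    families with the second values negated; overlapping sets are harmless here. *)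
Lemma step_integralB_le k1 k2 (A1 A2 : nat -> set R) (v1 v2 : nat -> V -> V) :
  (forall i, measurable (A1 i)) -> (forall i, measurable (A2 i)) ->
  (forall i, A1 i `<=` D) -> (forall i, A2 i `<=` D) ->
  (forall i, (leb (A1 i) < +oo)%E) -> (forall i, (leb (A2 i) < +oo)%E) ->
  (forall i, vLp (v1 i)) -> (forall i, vLp (v2 i)) ->
  (vN (\sum_(i < k1) fine (leb (A1 i)) *: v1 i - \sum_(i < k2) fine (leb (A2 i)) *: v2 i) <=
    \int[leb]_(t in D) vN (step_fun k1 A1 v1 t - step_fun k2 A2 v2 t))%E.
Proof.
move=> mA1 mA2 AD1 AD2 Ay1 Ay2 hv1 hv2.
pose A i := if (i < k1)%N then A1 i else A2 (i - k1)%N.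
pose v i := if (i < k1)%N then v1 i else - v2 (i - k1)%N.
have E1 (i : 'I_k1) : (i < k1)%N by [].
have E2 (i : 'I_k2) : (k1 + i < k1)%N = false by rewrite ltnNge leq_addr.
have e1 : \sum_(i < k1) fine (leb (A1 i)) *: v1 i - \sum_(i < k2) fine (leb (A2 i)) *: v2 i
    = \sum_(i < k1 + k2) fine (leb (A i)) *: v i.
  rewrite big_split_ord /= -sumrN; congr (_ + _); apply: eq_bigr => i _.
    by rewrite /A /v E1.
  by rewrite /A /v E2 addKn scalerN.
have e2 t : step_fun k1 A1 v1 t - step_fun k2 A2 v2 t = step_fun (k1 + k2) A v t.
  rewrite /step_fun big_split_ord /= -sumrN; congr (_ + _); apply: eq_bigr => i _.
    by rewrite /A /v E1.
  by rewrite /A /v E2 addKn scalerN.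
rewrite e1; under eq_integral do rewrite e2.
apply: step_integral_le => // i; rewrite /A /v; case: ifP => // _.
by rewrite -scaleN1r; exact: in_vLpZ.
Qed.

Variables (h : R -> V -> V) (b : R -> R).
Hypothesis hLp : forall t, 0 < t -> vLp (h t).
Hypothesis hcont : forall (t : R) (t_ : nat -> R), 0 < t -> (forall n, t < t_ n) ->
  t_ n @[n --> \oo] --> t -> (fun n => vN (h (t_ n) - h t)) @ \oo --> 0%E.
Hypothesis hb : forall t, 0 < t -> (vN (h t) <= (b t)%:E)%E.
Hypothesis bdec : forall s t, 0 < s -> s <= t -> b t <= b s.
Hypothesis bint : leb.-integrable D (EFin \o b).

Let mD : measurable D. Proof. exact: measurable_itv. Qed.

Let D0 t : D t -> 0 < t. Proof. by rewrite /= in_itv /= andbT. Qed.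

Let pow_gt0 n : (0 : R) < 2 ^+ n. Proof. by rewrite exprn_gt0. Qed.

(* Half-open dyadic cells carry the value of h at their right endpoints, where
   the nonincreasing majorant of the norm of h is smaller. *)
Let cell n i : set R := `[i%:R / 2 ^+ n, i.+1%:R / 2 ^+ n[%classic `&` D.
Let value n i : V -> V := h (i.+1%:R / 2 ^+ n).
Let num n := (n * 2 ^ n)%N.
Let next (n : nat) (t : R) : R := (Num.truncn (2 ^+ n * t)).+1%:R / 2 ^+ n.
Local Notation s_ n := (step_fun (num n) (cell n) (value n)).

Let next_gt n t : 0 < t -> t < next n t.
Proof.
move=> t0; rewrite /next ltr_pdivlMr // mulrC.
by have /andP[] := truncn_itv (mulr_ge0 (ltW (pow_gt0 n)) (ltW t0)).
Qed.

Let next_le n t : 0 < t -> next n t <= t + 2^-1 ^+ n.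
Proof.
move=> t0; rewrite /next ler_pdivrMr // mulrDl exprVn mulVf ?gt_eqF // -natr1 lerD2r [leRHS]mulrC.
by have /andP[] := truncn_itv (mulr_ge0 (ltW (pow_gt0 n)) (ltW t0)).
Qed.

Let cvg_next t : 0 < t -> next n t @[n --> \oo] --> t.
Proof.
move=> t0; have l2 : t + 2^-1 ^+ n @[n --> \oo] --> t.
  rewrite -[X in _ --> X]addr0; apply: cvgD; first exact: cvg_cst.
  by apply: cvg_expr; rewrite ger0_norm ?invr_ge0 // invf_lt1 // ltr1n.
apply: (squeeze_cvgr _ (cvg_cst t) l2).
by apply: nearW => n; rewrite (ltW (next_gt n t0)) next_le.
Qed.

Let step_next n t : 0 < t ->
  s_ n t = if (Num.truncn (2 ^+ n * t) < num n)%N then h (next n t) else 0.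
Proof.
move=> t0; set j := Num.truncn _.
have ind (i : nat) : (\1_(cell n i) t : R) = (i == j)%:R.
  rewrite indicE; congr (_%:R); congr nat_of_bool.
  have -> : (i == j) = (i%:R <= 2 ^+ n * t < i.+1%:R).
    by rewrite eq_sym /j truncn_eq // mulr_ge0 // ltW.
  apply/idP/idP; rewrite inE /cell /=.
    by move=> [/=]; rewrite in_itv /= ler_pdivrMr // ltr_pdivlMr // mulrC.
  rewrite !in_itv /= ler_pdivrMr // ltr_pdivlMr // mulrC => ->; by rewrite andbT.
rewrite /step_fun; under eq_bigr do rewrite ind.
case: ifPn => jk.
  rewrite (bigD1 (Ordinal jk)) //= eqxx scale1r big1 ?addr0 // => i ij.
  have -> : (nat_of_ord i == j) = false.
    by apply/negbTE; apply: contraNN ij => /eqP e; exact/eqP/val_inj.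
  by rewrite scale0r.
rewrite big1 // => i _; have -> : (nat_of_ord i == j) = false.
  by apply/negbTE; apply: contraNN jk => /eqP <-.
by rewrite scale0r.
Qed.

(** The [num n] cells of length 2^-n cover [0, n[ within the half-line, so each t belongs to one of
    them as soon as n > t. *)
Let step_near t : 0 < t -> \forall n \near \oo, s_ n t = h (next n t).
Proof.
move=> t0; near=> n; rewrite step_next // ifT // -(ltr_nat R).
apply: (@le_lt_trans _ _ (2 ^+ n * t)).
  by have /andP[] := truncn_itv (mulr_ge0 (ltW (pow_gt0 n)) (ltW t0)).
rewrite /num natrM natrX mulrC ltr_pM2r //.
by near: n; exact: nbhs_infty_gtr.
Unshelve. all: by end_near. Qed.

Let value_Lp n i : vLp (value n i). Proof. by apply: hLp; rewrite divr_gt0. Qed.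

Let mcell n i : measurable (cell n i).
Proof. by apply: measurableI => //; exact: measurable_itv. Qed.

Let cellD n i : cell n i `<=` D. Proof. exact: subIsetr. Qed.

Let cell_lty n i : (leb (cell n i) < +oo)%E.
Proof.
apply: (@le_lt_trans _ _ (leb `[i%:R / 2 ^+ n, i.+1%:R / 2 ^+ n[%classic)).
  by apply: le_measure; rewrite ?inE; [exact: mcell|exact: measurable_itv|exact: subIsetl].
by rewrite lebesgue_measure_itv /=; case: ifP => _; rewrite ?ltry // -EFinB ltry.
Qed.

Let step_Lp n t : vLp (s_ n t). Proof. exact: in_vLp_step. Qed.

Let step_cvg t : 0 < t -> (fun n => vN (h t - s_ n t)) @ \oo --> 0%E.
Proof.
move=> t0; have h1 := hcont t0 (fun n => next_gt n t0) (cvg_next t0).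
apply: cvg_trans h1; apply: near_eq_cvg; apply: filterS (step_near t0) => n ->.
by rewrite vLnormC.
Qed.

(** By right continuity the norm is a pointwise limit of norms of step functions, which are
    measurable in t. *)
Let measurable_hB w : vLp w -> measurable_fun D (fun t => vN (h t - w)).
Proof.
move=> hw; have hNw : vLp (- w) by rewrite -scaleN1r; exact: in_vLpZ.
apply: (emeasurable_fun_cvg (fun n t => vN (- w + s_ n t))).
  by move=> n; exact: measurable_step_norm.
move=> t /D0 t0; rewrite addrC; apply: (cvg_vLnorm p1).
- by move=> n; exact: in_vLpD.
- by apply: in_vLpD => //; exact: hLp.
- apply: cvg_trans (step_cvg t0); apply: near_eq_cvg; apply: nearW => n.
  by rewrite opprD addrACA subrr add0r vLnormC.
Qed.

Let measurable_h : measurable_fun D (fun t => vN (h t)).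
Proof.
have e : (fun t => vN (h t - 0)) = fun t => vN (h t) by apply/funext => t; rewrite subr0.
by have := measurable_hB (in_vLp0 mu p1'); rewrite e.
Qed.

Let measurable_hstep k A v : (forall i, measurable (A i)) -> (forall i, vLp (v i)) ->
  measurable_fun D (fun t => vN (h t - step_fun k A v t)).
Proof.
move=> mA hv.
have e : (fun t => vN (h t - (0 + step_fun k A v t))) = fun t => vN (h t - step_fun k A v t).
  by apply/funext => t; rewrite add0r.
by have := measurable_step p1 k mD mA hv measurable_hB (in_vLp0 mu p1'); rewrite e.
Qed.

Let measurable_step0 k A v : (forall i, measurable (A i)) -> (forall i, vLp (v i)) ->
  measurable_fun D (fun t => vN (step_fun k A v t)).
Proof.
move=> mA hv; have e : (fun t => vN (0 + step_fun k A v t)) = fun t => vN (step_fun k A v t).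
  by apply/funext => t; rewrite add0r.
by have := measurable_step_norm p1 k mD mA hv (in_vLp0 mu p1'); rewrite e.
Qed.

Let measurable_stepB n m : measurable_fun D (fun t => vN (s_ n t - s_ m t)).
Proof.
have hB w : vLp w -> measurable_fun D (fun t => vN (w - s_ m t)).
  move=> hw; have hNw : vLp (- w) by rewrite -scaleN1r; exact: in_vLpZ.
  have e : (fun t => vN (w - s_ m t)) = fun t => vN (- w + s_ m t).
    by apply/funext => t; rewrite vLnormC addrC.
  by rewrite e; exact: (measurable_step_norm p1).
have e : (fun t => vN ((0 + s_ n t) - s_ m t)) = fun t => vN (s_ n t - s_ m t).
  by apply/funext => t; rewrite add0r.
have := measurable_step p1 (num n) mD (mcell n) (value_Lp n)
  (H := fun t w => vN (w - s_ m t)) hB (in_vLp0 mu p1').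
by rewrite e.
Qed.

Let le_split t w : 0 < t -> vLp w -> (vN w <= vN (h t - w) + vN (h t))%E.
Proof.
move=> t0 [mw _]; have [mh _] := hLp t0.
have {1}-> : w = (w - h t) + h t by rewrite subrK.
rewrite (le_trans (vLnormD mu p1' _ _)) //; first exact: measurable_rVB.
by rewrite vLnormC.
Qed.

Lemma bochner_integral_le G : bochner_integral mu p D h G ->
  (vN G <= \int[leb]_(t in D) vN (h t))%E.
Proof.
move=> [[mG Gy] [_ [k [A [v [hA _ c1 c2]]]]]].
have mA n i : measurable (A n i) by have [] := hA n i.
have AD n i : A n i `<=` D by have [] := hA n i.
have Ay n i : (leb (A n i) < +oo)%E by have [] := hA n i.
have hv n i : vLp (v n i) by have [] := hA n i.
apply: (lee_addeps (K := 2)) => // e e0.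
have I0 n : (0 <= \int[leb]_(t in D) vN (h t - step_fun (k n) (A n) (v n) t))%E.
  by apply: integral_ge0 => t _; exact: vLnorm_ge0.
have := c1 => /cvge_0P => /(_ I0)/(_ e e0) d1.
have := c2 => /cvge_0P => /(_ (fun n => vLnorm_ge0 _ _ _))/(_ e e0) d2.
have [n [n1 n2]] : exists n,
    (\int[leb]_(t in D) vN (h t - step_fun (k n) (A n) (v n) t) <= e%:E)%E /\
    (vN (\sum_(i < k n) fine (leb (A n i)) *: v n i - G) <= e%:E)%E.
  near \oo => n; exists n; split; by near: n.
set W := \sum_(i < k n) _ in n2.
have [mW _] : vLp W by apply: in_vLp_sum => // i; exact: in_vLpZ.
have hs t : vLp (step_fun (k n) (A n) (v n) t) by exact: in_vLp_step.
have mhs := measurable_hstep (k n) (mA n) (hv n).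
have W1 : (vN W <= e%:E + \int[leb]_(t in D) vN (h t))%E.
  rewrite (le_trans (step_integral_le p1 (k n) mD (mA n) (AD n) (Ay n) (hv n))) //.
  apply: (@le_trans _ _ (\int[leb]_(t in D) (vN (h t - step_fun (k n) (A n) (v n) t) + vN (h t)))%E).
    apply: ge0_le_integral => //.
    - by move=> t _; exact: vLnorm_ge0.
    - exact: measurable_step0.
    - exact: emeasurable_funD.
    - by move=> t /D0 t0; exact: le_split.
  rewrite ge0_integralD //; [|by move=> t _; exact: vLnorm_ge0|by move=> t _; exact: vLnorm_ge0].
  by rewrite leeD2r.
have -> : G = (G - W) + W by rewrite subrK.
rewrite (le_trans (vLnormD mu p1' _ _)) //; first exact: measurable_rVB.
rewrite vLnormC (le_trans (leeD n2 W1)) // addeA addeC -EFinD leeD2l // lee_fin.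
by rewrite mulr2n mulrDl mul1r.
Unshelve. all: by end_near. Qed.

(** The bound [g] need not be monotone: the nonincreasing [b] serves existence, while a sharper [g]
    provides the constant. *)
Lemma bochner_integral_majorant (g : R -> \bar R) G : measurable_fun D g ->
  (forall t, 0 < t -> (vN (h t) <= g t)%E) -> bochner_integral mu p D h G ->
  (vN G <= \int[leb]_(t in D) g t)%E.
Proof.
move=> mg hg /bochner_integral_le /le_trans; apply; apply: ge0_le_integral => //.
- by move=> t _; exact: vLnorm_ge0.
- by move=> t /D0; exact: hg.
Qed.

Let step_bound n t : 0 < t -> (vN (h t - s_ n t) <= (2 * b t)%:E)%E.
Proof.
move=> t0; have [mh _] := hLp t0; have [ms _] := step_Lp n t.
have sb : (vN (s_ n t) <= (b t)%:E)%E.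
  rewrite step_next //; case: ifP => _.
    have tn := next_gt n t0; have n0 := lt_trans t0 tn.
    by rewrite (le_trans (hb n0)) // lee_fin bdec // ltW.
  by rewrite vLnorm0 ?(lt_trans _ p1) // (le_trans (vLnorm_ge0 _ _ _) (hb t0)).
have m0 := @measurable_cst _ _ _ _ (setT : set V) (0 : V).
rewrite (le_trans (vLnorm_triangle mu p1' mh m0 ms)) //.
rewrite vLnorm_subr0 vLnormC vLnorm_subr0 (le_trans (leeD (hb t0) sb)) //.
by rewrite -EFinD lee_fin mulr2n mulrDl mul1r.
Qed.

Let integral_step_cvg : (fun n => \int[leb]_(t in D) vN (h t - s_ n t))%E @ \oo --> 0%E.
Proof.
rewrite -(integral0 leb D).
apply: (@dominated_cvg _ _ _ leb D mD (fun n t => vN (h t - s_ n t)) (cst 0%E)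
  (fun t => (2 * b t)%:E)) => //.
- by move=> n; exact: measurable_hstep.
- by move=> t /D0 t0; exact: step_cvg.
- have h2 := @integrableZl _ _ _ leb D mD 2 (EFin \o b) bint.
  by apply: eq_integrable h2.
- by move=> n t /D0 t0; rewrite gee0_abs ?vLnorm_ge0 // step_bound.
Qed.

(** The step functions tend to [h] in the integrated norm, so their integrals form a Cauchy
    sequence, and completeness of vector-valued L^p gives the limit. *)
Lemma exists_bochner_integral : exists G, bochner_integral mu p D h G.
Proof.
pose W n := \sum_(i < num n) fine (leb (cell n i)) *: value n i.
have WLp n : vLp (W n) by apply: in_vLp_sum => // i; exact: in_vLpZ.
have I0 n : (0 <= \int[leb]_(t in D) vN (h t - s_ n t))%E.
  by apply: integral_ge0 => t _; exact: vLnorm_ge0.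
have [G hG cG] : exists2 G, vLp G & (fun n => vN (W n - G)) @ \oo --> 0%E.
  apply: vLp_complete => // e e0; have e2 : 0 < e / 2 by rewrite divr_gt0.
  have := integral_step_cvg => /cvge_0P => /(_ I0)/(_ _ e2) [n0 _ hn0].
  exists n0 => n m n0n n0m.
  have := step_integralB_le (num n) (num m) (mcell n) (mcell m) (@cellD n) (@cellD m)
    (cell_lty n) (cell_lty m) (value_Lp n) (value_Lp m).
  move=> /le_trans; apply.
  have ms n' : measurable_fun D (fun t => vN (h t - s_ n' t)) by exact: measurable_hstep.
  apply: (@le_trans _ _ (\int[leb]_(t in D) (vN (h t - s_ n t) + vN (h t - s_ m t)))%E).
    apply: ge0_le_integral => //.
    - by move=> t _; exact: vLnorm_ge0.
    - exact: measurable_stepB.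
    - by apply: emeasurable_funD; exact: ms.
    - move=> t /D0 t0; have [m1 _] := step_Lp n t; have [m2 _] := step_Lp m t.
      have [m3 _] := hLp t0; rewrite (le_trans (vLnorm_triangle mu p1' m1 m3 m2)) //.
      by rewrite vLnormC.
  rewrite ge0_integralD //; try exact: ms; try by move=> t _; exact: vLnorm_ge0.
  rewrite (le_trans (leeD (hn0 n n0n) (hn0 m n0m))) // -EFinD lee_fin.
  by rewrite -mulrDl -mulr2n -[e *+ 2]mulr_natr mulfK.
exists G; split => //; split; first by move=> t /D0; exact: hLp.
exists num, cell, value; split => //.
by apply: aeW => t /D0 t0; exact: step_cvg.
Qed.

End bochner.

(** * The gamma transform *)

Section gamma_integral.
Context {R : realType}.
Local Notation leb := (@lebesgue_measure R).
Local Notation D := (`]0, +oo[%classic : set R).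

Let mD : measurable D. Proof. exact: measurable_itv. Qed.

Let D0 t : D t -> 0 < t. Proof. by rewrite /= in_itv /= andbT. Qed.

Lemma integral_cst_indic_le (c : R) (A : set R) : 0 <= c -> measurable A ->
  (\int[leb]_(t in D) (c * \1_A t)%:E <= c%:E * leb A)%E.
Proof.
move=> c0 mA; under eq_integral do rewrite EFinM.
rewrite ge0_integralZl ?lee_fin //; last first.
- by apply/measurable_EFinP; exact: measurable_indic.
rewrite integral_indic // lee_wpmul2l ?lee_fin //.
by apply: le_measure; rewrite ?inE //; exact: measurableI.
Qed.

Lemma powR_nonincr (s t x : R) : 0 < s -> s <= t -> x <= 0 -> t `^ x <= s `^ x.
Proof.
move=> s0 st x0; rewrite -[x]opprK (powRN t) (powRN s).
apply: pinv_le; first exact: powR_gt0.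
by apply: ge0_ler_powR; rewrite ?nnegrE ?oppr_ge0 // ltW // (lt_le_trans s0).
Qed.

Let measurable_powRx (x : R) (A : set R) : measurable A -> measurable_fun A (fun t : R => t `^ x).
Proof. by move=> mA; apply: measurable_funTS; exact: measurable_powR. Qed.

Let measurable_expRM (x : R) (A : set R) : measurable A -> measurable_fun A (fun t : R => expR (- (x * t))).
Proof.
move=> mA; apply: measurable_funTS; apply: (measurableT_comp (@measurable_expR R)).
by apply: measurableT_comp => //; exact: measurable_funM.
Qed.

(** On the shell between 2^-(k+1) and 2^-k the power is at most its value at the left end.
    Multiplied by the length 2^-k, this gives 2^(1-g) 2^(-g k), of ratio below 1 since g > 0. *)
Lemma integral_powR_near0 (g : R) : 0 < g -> g <= 1 ->
  (\int[leb]_(t in D) (t `^ (g - 1) * \1_(`]0, 1]%classic) t)%:E < +oo)%E.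
Proof.
move=> g0 g1; have g10 : g - 1 <= 0 by rewrite subr_le0.
pose e k : R := 2^-1 ^+ k.
have e0 k : 0 < e k by rewrite exprn_gt0 // invr_gt0.
apply: (@integral_lty_geometric _ _ _ leb D _
  (fun k t => (e k.+1 `^ (g - 1) * \1_(`]0, e k]%classic) t)%:E) (2 `^ (1 - g)) (2 `^ (- g))) => //.
- apply/measurable_EFinP; apply: measurable_funM; first exact: measurable_powRx.
  exact: measurable_indic.
- move=> k; apply/measurable_EFinP; apply: measurable_funM => //; exact: measurable_indic.
- by move=> t _; rewrite lee_fin mulr_ge0 ?powR_ge0.
- by move=> k t _; rewrite lee_fin mulr_ge0 ?powR_ge0.
- move=> t /D0 t0; have [t1|t1] := leP t 1; last first.
    exists 0%N; rewrite lee_fin [X in _ * X]indicE memNset ?mulr0 ?mulr_ge0 ?powR_ge0 //.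
    by rewrite /= in_itv /= t0 leNgt t1.
  have ti : 1 <= t^-1 by rewrite invf_ge1.
  have [k /andP[k1 k2]] := dyadic_scale ti.
  exists k; rewrite lee_fin !indicE !mem_set /= ?in_itv /= ?t0 ?mulr1 ?t1 //; last first.
    by rewrite /e exprVn -[t]invrK lef_pV2 ?posrE ?invr_gt0 // exprn_gt0.
  rewrite powR_nonincr // /e exprVn -[t]invrK lef_pV2 ?posrE ?invr_gt0 ?exprn_gt0 //.
  exact: ltW.
- by rewrite powR2_lt1 // oppr_lt0.
- move=> k; rewrite (le_trans (integral_cst_indic_le _ _)) ?powR_ge0 //.
  rewrite lebesgue_measure_itv /= lte_fin e0 sube0 -EFinM lee_fin.
  have two (n : nat) : e n = 2 `^ (- n%:R) by rewrite powRN powR_mulrn // /e exprVn.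
  have p2 (x y : R) : 2 `^ x * 2 `^ y = 2 `^ (x + y).
    by rewrite powRD // pnatr_eq0 implybT.
  rewrite !two -powRrM -powR_mulrn ?powR_ge0 // -powRrM !p2.
  rewrite le_eqVlt; apply/orP; left; apply/eqP; congr (_ `^ _).
  by rewrite -natr1; ring.
Qed.

Lemma integral_expRN_half : (\int[leb]_(t in D) (expR (- (2^-1 * t)))%:E < +oo)%E.
Proof.
have h2 : (0 : R) < 2^-1 by rewrite invr_gt0.
apply: (@integral_lty_geometric _ _ _ leb D _
  (fun k t => (expR (- (2^-1 * k%:R)) * \1_(`[k%:R, k.+1%:R]%classic) t)%:E) 1 (expR (- 2^-1))) => //.
- by apply/measurable_EFinP; exact: measurable_expRM.
- move=> k; apply/measurable_EFinP; apply: measurable_funM => //; exact: measurable_indic.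
- move=> t /D0 t0; exists (Num.truncn t).
  have /andP[t1 t2] := truncn_itv (ltW t0).
  rewrite lee_fin indicE mem_set ?mulr1 /= ?in_itv /= ?t1 ?(ltW t2) //.
  by rewrite ler_expR lerN2 ler_wpM2l // ltW.
- move=> k; rewrite (le_trans (integral_cst_indic_le _ _)) ?expR_ge0 //.
  have e : k.+1%:R - k%:R = 1 :> R by rewrite -natr1; ring.
  rewrite lebesgue_measure_itv /= lte_fin ltr_nat leqnn -EFinB e mule1 mul1r.
  by rewrite lee_fin -expRM_natl mulrN mulrC.
Qed.

(** For 0 < g <= 1 it is integrable and nonincreasing, as the Bochner construction requires; t^(b-1)
    exp(-t) is not monotone for b > 1, and half of the exponential is spent to absorb the power. *)
Definition gamma_majorant (g t : R) : R := t `^ (g - 1) * expR (- (2^-1 * t)).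

Lemma gamma_majorant_nonincr (g s t : R) : g <= 1 -> 0 < s -> s <= t ->
  gamma_majorant g t <= gamma_majorant g s.
Proof.
move=> g1 s0 st; apply: ler_pM; [exact: powR_ge0|exact: expR_ge0| |].
  by apply: powR_nonincr => //; rewrite subr_le0.
by rewrite ler_expR lerN2 ler_wpM2l // invr_ge0.
Qed.

Lemma integrable_gamma_majorant (g : R) : 0 < g -> g <= 1 ->
  leb.-integrable D (EFin \o gamma_majorant g).
Proof.
move=> g0 g1.
have m1 : measurable_fun D (fun t : R => (t `^ (g - 1) * \1_(`]0, 1]%classic) t)%:E).
  apply/measurable_EFinP; apply: measurable_funM; first exact: measurable_powRx.
  exact: measurable_indic.
have m2 : measurable_fun D (fun t : R => (expR (- (2^-1 * t)))%:E).
  by apply/measurable_EFinP; exact: measurable_expRM.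
have mg : measurable_fun D (EFin \o gamma_majorant g).
  apply/measurable_EFinP; apply: measurable_funM; first exact: measurable_powRx.
  exact: measurable_expRM.
have g_ge0 t : 0 <= gamma_majorant g t by rewrite mulr_ge0 ?powR_ge0 ?expR_ge0.
apply/integrableP; split => //.
under eq_integral do rewrite gee0_abs ?lee_fin //.
apply: (@le_lt_trans _ _ (\int[leb]_(t in D)
  ((t `^ (g - 1) * \1_(`]0, 1]%classic) t)%:E + (expR (- (2^-1 * t)))%:E))%E).
  apply: ge0_le_integral => //.
  - by move=> t _; rewrite lee_fin.
  - exact: emeasurable_funD.
  - move=> t /D0 t0; rewrite -EFinD lee_fin /gamma_majorant.
    have e1 : expR (- (2^-1 * t)) <= 1 by rewrite expR_le1 oppr_le0 mulr_ge0 ?invr_ge0 // ltW.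
    have [t1|t1] := leP t 1.
      rewrite indicE mem_set /= ?in_itv /= ?t0 ?t1 // mulr1 (le_trans (ler_piMr _ e1)) ?powR_ge0 //.
      by rewrite lerDl expR_ge0.
    rewrite indicE memNset ?mulr0 ?add0r; last by rewrite /= in_itv /= t0 leNgt t1.
    apply: ler_piMl; first exact: expR_ge0.
    by have := powR_nonincr ltr01 (ltW t1) (_ : g - 1 <= 0); rewrite powR1 subr_le0; exact.
rewrite ge0_integralD //; [|by move=> t _; rewrite lee_fin mulr_ge0 ?powR_ge0].
by apply: lte_add_pinfty; [exact: integral_powR_near0|exact: integral_expRN_half].
Qed.

(** From ln y <= y at y = t / (2 x): x ln t is at most x ln (2 x) + t / 2. *)
Lemma powR_expRN_le (x t : R) : 0 < x -> 0 < t ->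
  t `^ x * expR (- t) <= expR (x * ln (2 * x)) * expR (- (2^-1 * t)).
Proof.
move=> x0 t0; have x2 : 0 < 2 * x by rewrite mulr_gt0.
have -> : t `^ x = expR (x * ln t) by rewrite /powR (gt_eqF t0).
rewrite -!expRD ler_expR.
have tx : 0 < t / (2 * x) by rewrite divr_gt0.
have h := ltW (ln_sublinear tx).
rewrite ln_div ?posrE // in h.
have h2 : x * (ln t - ln (2 * x)) <= 2^-1 * t.
  have -> : 2^-1 * t = x * (t / (2 * x)) by field; rewrite (gt_eqF x0).
  by rewrite ler_wpM2l // ltW.
by move: h2; rewrite mulrBr; lra.
Qed.

Lemma gamma_integrand_le (b : R) : 0 < b -> exists2 M : R, 0 <= M &
  forall t, 0 < t -> t `^ (b - 1) * expR (- t) <= M * gamma_majorant (Num.min b 1) t.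
Proof.
move=> b0; have [b1|b1] := leP b 1.
  exists 1 => // t t0; rewrite mul1r ler_wpM2l ?powR_ge0 // ler_expR lerN2.
  by move: t0; lra.
exists (expR ((b - 1) * ln (2 * (b - 1)))); first exact: expR_ge0.
move=> t t0; rewrite /gamma_majorant subrr powRr0 mul1r.
by apply: powR_expRN_le => //; rewrite subr_gt0.
Qed.

Lemma integrable_gamma (b : R) : 0 < b ->
  leb.-integrable D (fun t => (t `^ (b - 1) * expR (- t))%:E).
Proof.
move=> b0; have [M M0 hM] := gamma_integrand_le b0.
have g0 : 0 < Num.min b 1 by rewrite lt_min b0 ltr01.
have g1 : Num.min b 1 <= 1 by rewrite ge_min lexx orbT.
have iM := @integrableZl _ _ _ leb D mD M _ (integrable_gamma_majorant g0 g1).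
apply: le_integrable iM => //.
  apply/measurable_EFinP; apply: measurable_funM; first exact: measurable_powRx.
  have h := @measurable_expRM 1 D mD; apply: eq_measurable_fun h => t _.
  by rewrite mul1r.
move=> t /D0 t0; rewrite /= lee_fin ger0_norm; last by rewrite mulr_ge0 ?powR_ge0 ?expR_ge0.
by rewrite (le_trans (hM t t0)) // ler_norm.
Qed.

Lemma Gamma_ge0 (b : R) : 0 <= Gamma b.
Proof. by apply: Rintegral_ge0 => t _; rewrite mulr_ge0 ?powR_ge0 ?expR_ge0. Qed.

Lemma Gamma_EFin (b : R) : 0 < b ->
  ((Gamma b)%:E = \int[leb]_(t in D) (t `^ (b - 1) * expR (- t))%:E)%E.
Proof.
by move=> b0; rewrite /Gamma /Rintegral fineK //; apply: integrable_fin_num => //; exact: integrable_gamma.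
Qed.

End gamma_integral.

(** * Finiteness of the constant C *)

Section C_constant.
Context {R : realType}.
Variable alpha : R.
Hypothesis alpha12 : 1 < alpha < 2.

(** With E = exp(-alpha s), the quantity is (s E / (1 - E))^(1 - 1/alpha), and E (1 + alpha s) <= 1
    bounds the base by 1 / alpha. It also equals s^(1 - 1/alpha) kappa_s, which is how the constant
    enters the estimate. *)
Lemma C_const_spec : exists c : R, [/\ 0 <= c, C_const alpha = c%:E &
  forall s, 0 < s -> s `^ (1 - alpha^-1) * ou_kappa alpha s <= c].
Proof.
have [a1 _] := andP alpha12; have a0 : 0 < alpha by exact: lt_trans a1.
pose a := 1 - alpha^-1; pose B := (alpha^-1) `^ a.
have a_gt0 : 0 < a by rewrite subr_gt0 invf_lt1.
pose elt s := (s `^ a * expR (- ((alpha - 1) * s))) / (1 - expR (- (alpha * s))) `^ a.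
have kE s : s `^ a * ou_kappa alpha s = elt s.
  rewrite /elt /ou_kappa /ou_scale -powRrM mulrA; congr (_ / _ `^ _).
  by rewrite mulrBr mulr1 mulVf ?gt_eqF.
have eltB s : 0 < s -> elt s <= B.
  move=> s0; pose E := expR (- (alpha * s)).
  have E1 : 0 < 1 - E by rewrite subr_gt0 expR_lt1 oppr_lt0 mulr_gt0.
  have -> : elt s = (s * E / (1 - E)) `^ a.
    rewrite !powRM ?invr_ge0 ?mulr_ge0 ?expR_ge0 ?(ltW E1) ?(ltW s0) //.
    rewrite /elt -(powR_inv1 (ltW E1)) -powRrM mulN1r powRN; congr (_ * _ / _).
    by rewrite /E -expRM; congr expR; rewrite /a; field; rewrite gt_eqF.
  apply: ge0_ler_powR; rewrite ?nnegrE ?invr_ge0 ?(ltW a0) ?(ltW a_gt0) //.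
    by rewrite divr_ge0 ?mulr_ge0 ?expR_ge0 // ltW.
  rewrite ler_pdivrMr // -(ler_pM2l a0) mulrA mulrA divff ?gt_eqF // mul1r.
  have h := expR_ge1Dx (alpha * s).
  have h2 : E * (1 + alpha * s) <= 1.
    by apply: (le_trans (ler_wpM2l (expR_ge0 _) h)); rewrite -expRD addNr expR0.
  by move: h2; rewrite mulrDr mulr1 mulrC; lra.
have elt0 s : 0 <= elt s by rewrite divr_ge0 ?mulr_ge0 ?powR_ge0 ?expR_ge0.
have Sb : (C_const alpha <= B%:E)%E.
  rewrite /C_const; apply: ge_ereal_sup => x [s]; rewrite /= in_itv /= andbT => s0 <-.
  by rewrite lee_fin; exact: eltB.
have Su s : 0 < s -> ((elt s)%:E <= C_const alpha)%E.
  by move=> s0; apply: ereal_sup_ubound; exists s => //=; rewrite in_itv /= s0.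
have S0 : (0 <= C_const alpha)%E by rewrite (le_trans _ (Su 1 ltr01)) // lee_fin.
move: Sb Su S0; case: (C_const alpha) => [c| |] // _ Su c0; rewrite lee_fin in c0.
by exists c; split => // s s0; rewrite -lee_fin kE; exact: Su.
Qed.

End C_constant.

Lemma cvg_vLnormZ (R : realType) (d : nat) (mu : probability 'rV[R]_d R) (p : R)
    (a_ : nat -> R) (a : R) (F_ : nat -> 'rV[R]_d -> 'rV[R]_d) F : 1 <= p ->
  (forall n, in_vLp mu p (F_ n)) -> in_vLp mu p F -> a_ n @[n --> \oo] --> a ->
  (fun n => vLnorm mu p (F_ n - F)) @ \oo --> 0%E ->
  (fun n => vLnorm mu p (a_ n *: F_ n - a *: F)) @ \oo --> 0%E.
Proof.
move=> p1 hn hF ca cF.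
have [mF Fy] := hF.
have Ff : vLnorm mu p F \is a fin_num by rewrite ge0_fin_numE ?vLnorm_ge0.
pose x := fine (vLnorm mu p F); have x0 : 0 <= x by rewrite fine_ge0 // vLnorm_ge0.
apply/cvge_0P => [n|e e0]; first exact: vLnorm_ge0.
have aa : 0 < `|a| + 1 by rewrite ltr_wpDl.
have xx : 0 < x + 1 by rewrite ltr_wpDl.
have e1 : 0 < e / 2 / (`|a| + 1) by rewrite !divr_gt0.
have e2 : 0 < e / 2 / (x + 1) by rewrite !divr_gt0.
have := cF => /cvge_0P => /(_ (fun n => vLnorm_ge0 _ _ _))/(_ _ e1) h1.
move/cvgrPdist_le : (ca) => /(_ _ e2) h2.
move/cvgrPdist_le : (ca) => /(_ _ ltr01) h3.
near=> n; have [mn _] := hn n.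
have k1 : (vLnorm mu p (F_ n - F)%R <= (e / 2 / (`|a| + 1))%:E)%E by near: n.
have k2 : `|a - a_ n| <= e / 2 / (x + 1) by near: n.
have k3 : `|a - a_ n| <= 1 by near: n.
have k4 : `|a_ n| <= `|a| + 1.
  by rewrite -[a_ n](subrK a) addrC (le_trans (ler_normD _ _)) // lerD2l distrC.
have mB := measurable_rVB mn mF.
have -> : a_ n *: F_ n - a *: F = a_ n *: (F_ n - F) + (a_ n - a) *: F.
  by rewrite scalerBr scalerBl addrA subrK.
rewrite (le_trans (vLnormD mu p1 (measurable_rVZ _ mB) (measurable_rVZ _ mF))) //.
rewrite !vLnormZ //.
apply: (@le_trans _ _ ((e / 2)%:E + (e / 2)%:E)%E); last first.
  by rewrite -EFinD lee_fin -mulrDl -mulr2n -[e *+ 2]mulr_natr mulfK.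
apply: leeD.
- have an0 : (0 <= `|a_ n|%:E :> \bar R)%E by rewrite lee_fin.
  rewrite (le_trans (lee_wpmul2l an0 k1)) // -EFinM lee_fin mulrA ler_pdivrMr //.
  by rewrite mulrC ler_wpM2l // divr_ge0 // ltW.
- rewrite -(fineK Ff) -EFinM lee_fin distrC -/x.
  rewrite (le_trans (ler_wpM2r x0 k2)) // mulrAC ler_pdivrMr // ler_wpM2l ?lerDl //.
  by rewrite divr_ge0 // ltW.
Unshelve. all: by end_near. Qed.

(** * The integrand of the gamma transform *)

Section gamma_transform.
Context {R : realType} {d : nat}.
Local Notation V := 'rV[R]_d.
Variables (alpha : R) (nu : {measure set V -> \bar R}) (mu : probability V R)
  (lambda : {finite_measure set V -> \bar R}).
Hypothesis alpha12 : 1 < alpha < 2.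
Hypothesis nu_stable : stable_levy_measure alpha nu.
Hypothesis mu_nu : stable_law nu mu.
Hypothesis mu_char : forall xi : V, char_fun mu xi =
  ((expR (- \int[lambda]_(y in usphere) (`|dotv y xi| `^ alpha)))%:C)%C.
Variables (p c : R).
Hypothesis p_gt : alpha / (alpha - 1) < p.
Hypothesis c_ge0 : 0 <= c.
Hypothesis c_moment : forall z : V, enorm z = 1 ->
  (\int[mu]_u (`|dotv u z| `^ (p / (p - 1)))%:E <= (c `^ (p / (p - 1)))%:E)%E.
Variable DP : R -> (V -> R) -> V -> V.
Hypothesis DP_ext : grad_OU_extension alpha nu mu p DP.
Variable Pstar : R -> (V -> R) -> V -> R.
Hypothesis Pstar_dual : dual_OU alpha mu Pstar.
Variables (C r : R).
Hypothesis C_ge0 : 0 <= C.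
Hypothesis C_bound : forall s, 0 < s -> s `^ (1 - alpha^-1) * ou_kappa alpha s <= C.
Hypothesis r_min : 2 * (alpha - 1) / alpha < r.
Variable f : V -> R.
Hypothesis f_Lp : f \in Lfun mu p%:E.

Local Notation vN F := (vLnorm mu p F%R).
Local Notation N f := ('N[mu]_p%:E [EFin \o f%R])%E.
Local Notation leb := (@lebesgue_measure R).
Local Notation D := (`]0, +oo[%classic : set R).
Local Notation h := (fun t => (expR (- t) / (Gamma (r / 2) * t `^ (1 - r / 2))) *:
  DP (t / alpha) (Pstar (t / alpha) f)).
Let b := r / 2 + alpha^-1 - 1.
Let K := alpha `^ ((alpha - 1) / alpha) * C * c * fine (N f) / Gamma (r / 2).

Let p2 : 2 < p. Proof. exact: (exponent_gt2 alpha12 p_gt). Qed.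

Let p1 : 1 < p. Proof. by apply: lt_trans p2; rewrite ltr1n. Qed.

Let a0 : 0 < alpha. Proof. by case/andP: alpha12 => h _; exact: lt_trans h. Qed.

(** [r_min] amounts to r / 2 > 1 - 1 / alpha, which is integrability at 0 of the bound of order
    t^(b-1) on the integrand. *)
Let b_gt0 : 0 < b.
Proof.
have e : 2 * (alpha - 1) / alpha = 2 * (1 - alpha^-1) by field; rewrite gt_eqF.
by move: r_min; rewrite e /b; move: (alpha^-1) => ai; lra.
Qed.

Let K_ge0 : 0 <= K.
Proof.
by rewrite divr_ge0 ?Gamma_ge0 // !mulr_ge0 ?powR_ge0 // fine_ge0 // Lnorm_ge0.
Qed.

Let weightE t : expR (- t) / (Gamma (r / 2) * t `^ (1 - r / 2)) =
  (Gamma (r / 2))^-1 * (expR (- t) * t `^ (r / 2 - 1)).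
Proof. by rewrite invfM -powRN opprB; ring. Qed.

Let weight_ge0 t : 0 <= expR (- t) / (Gamma (r / 2) * t `^ (1 - r / 2)).
Proof. by rewrite weightE !mulr_ge0 ?invr_ge0 ?Gamma_ge0 ?expR_ge0 ?powR_ge0. Qed.

Let ta t : 0 < t -> 0 < t / alpha. Proof. by move=> t0; rewrite divr_gt0. Qed.

Let PL t : 0 < t -> Pstar (t / alpha) f \in Lfun mu p%:E.
Proof. by move=> t0; apply: (dual_mem Pstar_dual p1) => //; exact/ltW/ta. Qed.

Let DL t : 0 < t -> in_vLp mu p (DP (t / alpha) (Pstar (t / alpha) f)).
Proof. by move=> t0; have [h1 _ _] := DP_ext (ta t0); exact/h1/PL. Qed.

Lemma transform_in_vLp t : 0 < t -> in_vLp mu p (h t).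
Proof. by move=> t0; apply: in_vLpZ => //; [exact: ltW|exact: DL]. Qed.

Lemma transform_right_continuous (t : R) (t_ : nat -> R) : 0 < t ->
  (forall n, t < t_ n) -> t_ n @[n --> \oo] --> t ->
  (fun n => vN (h (t_ n) - h t)) @ \oo --> 0%E.
Proof.
move=> t0 t_gt ct; have tn0 n : 0 < t_ n by exact: lt_trans (t_gt n).
apply: cvg_vLnormZ; [exact: ltW|by move=> n; exact: DL|exact: DL| |].
- rewrite weightE; under eq_fun do rewrite weightE.
  apply: cvgMr; apply: cvgM.
    by apply: continuous_cvg; [exact: continuous_expR|exact: cvgN].
  exact: (cvg_powR (x := r / 2 - 1) t0 tn0 ct).
- have cta : t_ n / alpha @[n --> \oo] --> t / alpha by exact: cvgMl.
  have tagt n : t / alpha < t_ n / alpha by rewrite ltr_pM2r ?invr_gt0.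
  apply: (grad_extension_cvg alpha12 nu_stable mu_nu mu_char p_gt c_ge0 c_moment DP_ext
    (ta t0) tagt cta) => [n||]; [exact: PL|exact: PL|].
  pose s_ n := t_ n / alpha - t / alpha.
  have s0 n : 0 < s_ n by rewrite subr_gt0.
  have cs : s_ n @[n --> \oo] --> (0 : R).
    by rewrite -(subrr (t / alpha)); apply: cvgB => //; exact: cvg_cst.
  have hc := cvg_dual alpha12 mu_char Pstar_dual s0 cs p2 (ta t0) f_Lp.
  have e : (fun n => N (fun x => (Pstar (s_ n + t / alpha) f x - Pstar (t / alpha) f x)%R)) =
      fun n => N (fun x => (Pstar (t_ n / alpha) f x - Pstar (t / alpha) f x)%R).
    by apply/funext => n; rewrite /s_ subrK.
  by rewrite e in hc.
Qed.

(** The semigroup runs at time t / alpha; the change of scale in [C_bound] produces the factor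
    alpha^((alpha-1)/alpha) of the final constant. *)
Let kappa_bound t : 0 < t -> ou_kappa alpha (t / alpha) <=
  alpha `^ ((alpha - 1) / alpha) * C * t `^ (- (1 - alpha^-1)).
Proof.
move=> t0; have := C_bound (ta t0); rewrite powRM ?invr_ge0 ?(ltW t0) ?(ltW a0) //.
have -> : (alpha - 1) / alpha = 1 - alpha^-1 by field; rewrite gt_eqF.
have inv x : alpha^-1 `^ x = (alpha `^ x)^-1.
  by rewrite -[alpha^-1](powR_inv1 (ltW a0)) -powRrM mulN1r powRN.
rewrite inv powRN.
have := powR_gt0 (1 - alpha^-1) t0; have := powR_gt0 (1 - alpha^-1) a0.
move: (t `^ _) (alpha `^ _) (ou_kappa _ _) => u v k v0 u0 hk.
have -> : k = v * u^-1 * (u / v * k) by field; rewrite !gt_eqF.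
by rewrite [leRHS]mulrAC ler_wpM2l // divr_ge0 // ltW.
Qed.

Lemma transform_bound t : 0 < t ->
  (vN (h t) <= (K * (t `^ (b - 1) * expR (- t)))%:E)%E.
Proof.
move=> t0; have [mD _] := DL t0; rewrite vLnormZ ?(lt_trans ltr01 p1) //; last exact: ltW.
rewrite ger0_norm ?weight_ge0 //.
have Nf : N f \is a fin_num by rewrite ge0_fin_numE ?Lnorm_ge0 //; have /Lfun_mem[] := f_Lp.
have h1 := grad_extension_bound alpha12 nu_stable mu_nu mu_char p_gt c_ge0 c_moment DP_ext
  (ta t0) (PL t0).
have h2 := dual_contraction alpha12 mu_char Pstar_dual p1 (ltW (ta t0)) f_Lp.
have k0 := ou_kappa_ge0 alpha (t / alpha).
have kc0 : 0 <= ou_kappa alpha (t / alpha) * c by rewrite mulr_ge0.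
have h3 := le_trans h1 (lee_wpmul2l (x := (ou_kappa alpha (t / alpha) * c)%:E) kc0 h2).
rewrite (le_trans (lee_wpmul2l _ h3)) ?lee_fin ?weight_ge0 //.
have n0 : 0 <= fine (N f) by rewrite fine_ge0 // Lnorm_ge0.
rewrite -(fineK Nf) -!EFinM lee_fin weightE /K.
have -> : t `^ (b - 1) = t `^ (r / 2 - 1) * t `^ (- (1 - alpha^-1)).
  by rewrite -powRD ?(gt_eqF t0) ?implybT //; congr (_ `^ _); rewrite /b; ring.
have g0 : 0 <= (Gamma (r / 2))^-1 by rewrite invr_ge0 Gamma_ge0.
have e0 := expR_ge0 (- t); have u0 := powR_ge0 t (r / 2 - 1).
have := kappa_bound t0.
move: k0 n0 g0 e0 u0; move: (ou_kappa _ _) (fine _) (Gamma _)^-1 (expR _) (t `^ (r / 2 - 1)).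
move: (alpha `^ _) (t `^ _) => v w k n g e u k0 n0 g0 e0 u0 hk.
have -> : v * C * c * n * g * (u * w * e) = g * (e * u) * ((v * C * w) * c * n) by ring.
by rewrite ler_wpM2l ?mulr_ge0 // ler_wpM2r // ler_wpM2r.
Qed.

Lemma exists_grad_gamma_transform :
  exists G, grad_gamma_transform alpha mu r p Pstar DP f G.
Proof.
have [M M0 hM] := gamma_integrand_le b_gt0.
have g0 : 0 < Num.min b 1 by rewrite lt_min b_gt0 ltr01.
have g1 : Num.min b 1 <= 1 by rewrite ge_min lexx orbT.
have KM : 0 <= K * M by rewrite mulr_ge0.
apply: (exists_bochner_integral (b := fun t => K * M * gamma_majorant (Num.min b 1) t) p1).
- exact: transform_in_vLp.
- exact: transform_right_continuous.
- move=> t t0; rewrite (le_trans (transform_bound t0)) // lee_fin -mulrA ler_wpM2l //.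
  exact: hM.
- by move=> s t s0 st; rewrite ler_wpM2l // gamma_majorant_nonincr.
- have h1 := @integrableZl _ _ _ leb D (measurable_itv _) (K * M) _
    (integrable_gamma_majorant g0 g1).
  by apply: eq_integrable h1.
Qed.

(** The pointwise bound t^(b-1) exp(-t) is integrated exactly, which brings out [Gamma b]; the
    monotone majorant used for existence would lose the constant. *)
Lemma grad_gamma_transform_le G : grad_gamma_transform alpha mu r p Pstar DP f G ->
  (vN G <= (K * Gamma b)%:E)%E.
Proof.
move=> hG; have ig := integrable_gamma b_gt0.
have mg : measurable_fun D (fun t => (t `^ (b - 1) * expR (- t))%:E) by have /integrableP[] := ig.
have e : (\int[leb]_(t in D) (K * (t `^ (b - 1) * expR (- t)))%:E = (K * Gamma b)%:E)%E.
  rewrite EFinM Gamma_EFin // -ge0_integralZl //.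
  by move=> t _; rewrite lee_fin mulr_ge0 ?powR_ge0 ?expR_ge0.
rewrite -e; apply: (bochner_integral_majorant p1 transform_in_vLp transform_right_continuous) hG.
- by apply/measurable_EFinP; apply: measurable_funM => //; exact/measurable_EFinP.
- exact: transform_bound.
Qed.

End gamma_transform.

Theorem corollary4p2 (R : realType) (d : nat) (d_gt0 : (0 < d)%N)
    (alpha r : R) (alpha12 : 1 < alpha < 2)
    (r_min : 2 * (alpha - 1) / alpha < r)
    (nu : {measure set 'rV[R]_d -> \bar R})
    (sigma : {finite_measure set 'rV[R]_d -> \bar R})
    (nu_stable : stable_levy_measure alpha nu)
    (nu_polar : polar_part alpha nu sigma)
    (nu_sym : symmetric_measure sigma)
    (mu : probability 'rV[R]_d R)
    (mu_nu : stable_law nu mu)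
    (lambda1 : {finite_measure set 'rV[R]_d -> \bar R})
    (lambda1_mu : spectral_measure alpha sigma mu lambda1)
    (nu_nondeg : nondegenerate_spectral alpha lambda1)
    (Pstar : R -> ('rV[R]_d -> R) -> 'rV[R]_d -> R)
    (Pstar_dual : dual_OU alpha mu Pstar)
    (dO : measure_display) (Omega : measurableType dO)
    (P : probability Omega R) (Y : {RV P >-> R})
    (Y_stable : sym_stable_rv alpha Y)
    (p : R) (p_gt : alpha / (alpha - 1) < p)
    (DP : R -> ('rV[R]_d -> R) -> 'rV[R]_d -> 'rV[R]_d)
    (DP_ext : grad_OU_extension alpha nu mu p DP)
    (f : 'rV[R]_d -> R) (f_Lp : f \in Lfun mu p%:E) :
  let q := p / (p - 1) in
  (exists G, grad_gamma_transform alpha mu r p Pstar DP f G) /\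
  (forall G, grad_gamma_transform alpha mu r p Pstar DP f G ->
    (vLnorm mu p G <=
       (alpha `^ ((alpha - 1) / alpha))%:E * C_const alpha *
       gamma_const alpha lambda1 Y q *
       (Gamma (r / 2 + alpha^-1 - 1) / Gamma (r / 2))%:E *
       'N[mu]_p%:E [EFin \o f])%E).
Proof.
move=> q; have [_ _ _ mu_char] := lambda1_mu.
have /andP[q1 qa] := conjugate_lt alpha12 p_gt.
have q0 : 0 < q by exact: lt_trans q1.
have [c [c0 cE cm]] := gamma_const_spec alpha12 mu_char Y_stable nu_nondeg d_gt0 q0 qa.
have [C [C0 CE Ck]] := C_const_spec alpha12.
split; first exact: (exists_grad_gamma_transform alpha12 nu_stable mu_nu mu_char p_gt c0 cm
  DP_ext Pstar_dual C0 Ck r_min f_Lp).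
move=> G hG.
have Nf : ('N[mu]_p%:E [EFin \o f] \is a fin_num)%E.
  by rewrite ge0_fin_numE ?Lnorm_ge0 //; have /Lfun_mem[] := f_Lp.
have := grad_gamma_transform_le alpha12 nu_stable mu_nu mu_char p_gt c0 cm
  DP_ext Pstar_dual C0 Ck r_min f_Lp hG.
rewrite CE cE -(fineK Nf) -!EFinM => /le_trans; apply; rewrite lee_fin.
have e (x y z u : R) : u * C * c * z / y * x = u * C * c * (x / y) * z by ring.
by rewrite le_eqVlt; apply/orP; left; apply/eqP; exact: e.
Qed.
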